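(* Let $a,c>0$, let $N\ge2$ be an integer, let $R_0\in\mathbb{R}^N$, and let $R_t$ be the $\mathbb{R}^N$-valued Ornstein--Uhlenbeck process $dR_t=-\frac a2R_t\,dt+\frac c2\,dW_t$ started at $R_0$, where $W$ is a standard $N$-dimensional Brownian motion with filtration $\mathcal{F}_t$. Let $r_t=R_t^\dagger R_t$ and $V_t=\exp\left[-\int_0^tR_s^\dagger R_s\,ds\right]$. Then for $0\le t<T$ the zero coupon bond price $P_{tT}=E[V_t^{-1}V_T\,|\,\mathcal{F}_t]$ is given by $$P_{tT}=\left[\det(1+2C_T)\right]^{-N/2}\prod_{\mu=1}^N\exp\left[-\frac{4}{c^2}(R_t^\mu)^2\,\big(C_T(1+2C_T)^{-1}\big)(t,t)\right].$$ Thus $P_{tT}=\exp[-\beta(t,T)r_t-\alpha(t,T)]$ with $$\beta(t,T)=\frac4{c^2}\,[C_T(1+2C_T)^{-1}](t,t),\qquad \alpha(t,T)=\frac N2\log\big[\det(1+2C_T)\big].$$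
   Context: $\dagger$ denotes transpose, so $r_t=\sum_\mu(R_t^\mu)^2$. The process $r_t$ is the Cox--Ingersoll--Ross spot rate $dr_t=a(b-r_t)dt+c\sqrt{r_t}\,d\tilde W_t$ with $N=4ab/c^2$, and the market price of risk is taken to be zero, so that $V_t$ is the state price density. $C_T$ denotes the integral operator on $L^2([t,T])$ (scalar functions) with continuous symmetric kernel $$C_T(s_1,s_2)=\frac{c^2}{4a}\left[e^{-\frac a2|s_1-s_2|}-e^{\frac a2(s_1+s_2-2T)}\right],\qquad s_1,s_2\in[t,T].$$ $\det(1+2C_T)$ is the Fredholm determinant on $L^2([t,T])$, and $\big(C_T(1+2C_T)^{-1}\big)(s_1,s_2)$ is the (continuous) kernel of the integral operator $C_T(1+2C_T)^{-1}$ on $L^2([t,T])$, evaluated at $s_1=s_2=t$. *)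

(* Defs.v *)
From mathcomp Require Export all_boot all_order all_algebra.
From mathcomp Require Export all_classical all_reals all_analysis.

Set Implicit Arguments.
Unset Strict Implicit.
Unset Printing Implicit Defensive.
Import Order.TTheory GRing.Theory Num.Theory.
Import numFieldNormedType.Exports.

Local Open Scope classical_set_scope.
Local Open Scope ring_scope.

Section Processes.
Context {d : measure_display} {Omega : measurableType d} {R : realType}.
Variable P : probability Omega R.

(* Time is a real number; only the times in [0, +oo[ matter. *)
Definition filtration (F : R -> set (set Omega)) : Prop :=
  [/\ forall t, 0 <= t -> sigma_algebra setT (F t),
      forall t, 0 <= t -> F t `<=` measurable
    & forall s t, 0 <= s -> s <= t -> F s `<=` F t].

Definition measurable_wrt (G : set (set Omega)) (X : Omega -> R) : Prop :=
  forall B : set R, measurable B -> G (X @^-1` B).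

Definition adapted (N : nat) (F : R -> set (set Omega))
    (X : R -> Omega -> 'cV[R]_N) : Prop :=
  forall t, 0 <= t -> forall i, measurable_wrt (F t) (fun w => X t w i 0).

Definition continuous_path (N : nat) (x : R -> 'cV[R]_N) : Prop :=
  forall i, {within `[0, +oo[, continuous (fun t => x t i 0)}.

(* The sigma-algebra generated by a random vector. *)
Definition sigma_of (N : nat) (X : Omega -> 'cV[R]_N) : set (set Omega) :=
  <<s [set A | exists i (B : set R),
         measurable B /\ A = (fun w => X w i 0) @^-1` B] >>.

Definition independent_sigma (G H : set (set Omega)) : Prop :=
  forall A B, G A -> H B -> P (A `&` B) = (P A * P B)%E.

(* Law N(0, v I_N), for a variance v > 0: the components are independent
   centred normal variables of variance v.  The second parameter of
   normal_prob is a standard deviation. *)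
Definition isotropic_normal (N : nat) (v : R) (X : Omega -> 'cV[R]_N) : Prop :=
  (forall B : 'I_N -> set R, (forall i, measurable (B i)) ->
     P [set w | forall i, B i (X w i 0)] =
     (\prod_(i < N) P ((fun w => X w i 0%R) @^-1` B i))%E) /\
  (forall i (B : set R), measurable B ->
     P ((fun w => X w i 0) @^-1` B) = normal_prob 0 (Num.sqrt v) B).

Definition brownian_motion (N : nat) (F : R -> set (set Omega))
    (W : R -> Omega -> 'cV[R]_N) : Prop :=
  [/\ adapted F W,
      {ae P, forall w, W 0 w = 0},
      {ae P, forall w, continuous_path (W^~ w)},
      forall s t, 0 <= s -> s < t ->
        independent_sigma (F s) (sigma_of (fun w => W t w - W s w))
    & forall s t, 0 <= s -> s < t ->
        isotropic_normal (t - s) (fun w => W t w - W s w)].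

(* dX = -(a/2) X dt + (c/2) dW, X_0 = x0.  As the noise is additive, the
   stochastic integral is (c/2) W_t and the equation is pathwise. *)
Definition ornstein_uhlenbeck (N : nat) (a c : R) (x0 : 'cV[R]_N)
    (F : R -> set (set Omega)) (W X : R -> Omega -> 'cV[R]_N) : Prop :=
  [/\ adapted F X,
      forall w, continuous_path (X^~ w)
    & {ae P, forall w, forall t : R, 0 <= t -> forall i,
        X t w i 0 = x0 i 0
          - a / 2 * \int[lebesgue_measure]_(s in `[0, t]) X s w i 0
          + c / 2 * W t w i 0}].

(* Y is a version of E[X | G]. *)
Definition is_cond_exp (G : set (set Omega)) (X Y : Omega -> R) : Prop :=
  [/\ P.-integrable setT (EFin \o X),
      P.-integrable setT (EFin \o Y),
      measurable_wrt G Y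
    & forall A, G A -> (\int[P]_(w in A) (Y w)%:E = \int[P]_(w in A) (X w)%:E)%E].

Definition spot_rate (N : nat) (X : R -> Omega -> 'cV[R]_N) (t : R) (w : Omega) : R :=
  ((X t w)^T *m X t w) 0 0.

Definition state_price_density (N : nat) (X : R -> Omega -> 'cV[R]_N)
    (t : R) (w : Omega) : R :=
  expR (- \int[lebesgue_measure]_(s in `[0, t]) spot_rate X s w).

End Processes.

Section IntegralOperators.
Context {R : realType}.
Variables t T : R.

(* Representatives of the elements of L^2([t, T]); equality in L^2([t, T])
   is eqL2, and values outside [t, T] are irrelevant. *)
Definition L2 (f : R -> R) : Prop :=
  measurable_fun `[t, T] f /\
  lebesgue_measure.-integrable `[t, T] (fun s => (f s ^+ 2)%:E).

Definition eqL2 (f g : R -> R) : Prop :=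
  {ae lebesgue_measure, forall s, s \in `[t, T] -> f s = g s}.

Definition integral_op (K : R -> R -> R) (f : R -> R) (s1 : R) : R :=
  \int[lebesgue_measure]_(s2 in `[t, T]) (K s1 s2 * f s2).

Definition L2_bijective (A : (R -> R) -> R -> R) : Prop :=
  [/\ forall f, L2 f -> L2 (A f),
      forall f, L2 f -> exists2 g, L2 g & eqL2 (A g) f
    & forall f g, L2 f -> L2 g -> eqL2 (A f) (A g) -> eqL2 f g].

Definition one_plus_two (K : R -> R -> R) (f : R -> R) (s : R) : R :=
  f s + 2 * integral_op K f s.

(* M is the continuous kernel of the operator K (1 + 2K)^-1 on L^2([t, T]):
   1 + 2K is invertible and, whenever g = (1 + 2K)^-1 f, the operators with
   kernels M and K satisfy M f = K g. *)
Definition is_resolvent_kernel (K M : R -> R -> R) : Prop :=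
  [/\ L2_bijective (one_plus_two K),
      {within `[t, T] `*` `[t, T], continuous (fun p : R * R => M p.1 p.2)}
    & forall f g, L2 f -> L2 g -> eqL2 (one_plus_two K g) f ->
        eqL2 (integral_op M f) (integral_op K g)].

(* Integral of f [:: s_1; ...; s_n] over (s_1, ..., s_n) in [t, T]^n. *)
Fixpoint iterated_integral (n : nat) (f : seq R -> R) : R :=
  if n is n'.+1 then
    \int[lebesgue_measure]_(s in `[t, T])
      iterated_integral n' (fun v => f (s :: v))
  else f [::].

(* det(1 + K) on L^2([t, T]) as Fredholm's series
   sum_n 1/n! int_([t, T]^n) det [K(s_i, s_j)]_(i, j) ds_1 ... ds_n. *)
Definition fredholm_term (K : R -> R -> R) (n : nat) : R :=
  (n`!%:R)^-1 *
  iterated_integral n (fun s => \det (\matrix_(i < n, j < n) K s`_i s`_j)).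

Definition fredholm_det (K : R -> R -> R) : R :=
  limn (series (fredholm_term K)).

End IntegralOperators.

Definition bond_kernel {R : realType} (a c T s1 s2 : R) : R :=
  c ^+ 2 / (4 * a) *
  (expR (- (a / 2) * `|s1 - s2|) - expR (a / 2 * (s1 + s2 - 2 * T))).

(* Main.v *)
(** Put tau = T - t and let p, q solve p' = - a p + q, q' = (c^2 / 2) p with
    p 0 = 0 and q 0 = 1.

    For s <= u the kernel 2 C_T is phi s * psi u, so row operations reduce the
    n-th Fredholm determinant to an (n - 1)-st one; Fredholm's series is thus
    the Neumann series of a Volterra equation, solved by (c^2 / 2) p (T - s), and
    det (1 + 2 C_T) = q tau.  The kernel of C_T (1 + 2 C_T)^-1 is a Green function
    built from two solutions of a second-order linear equation; Green's identity
    for it and C_T gives the resolvent equations, and its value at (t, t) is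
    (c^2 / 4) p tau / q tau.

    On the probability side, the Euler scheme Y of the Ornstein-Uhlenbeck
    equation started at X_t has independent Gaussian increments, so
    E [exp (- sum dt |Y_k|^2) | F_t] is computed exactly, one step at a time, as
    q_n^(-N / 2) exp (- (p_n / q_n) |X_t|^2), where (p_n, q_n) is a discretisation
    of (p, q).  The noise is additive, so the scheme converges pathwise to X, and
    bounded convergence identifies the conditional expectation. *)

Require Import Defs.
From HB Require Import structures.
From mathcomp Require Import perm ring lra measurable_realfun.
Set Implicit Arguments.
Unset Strict Implicit.
Unset Printing Implicit Defensive.
Import Order.TTheory GRing.Theory Num.Theory.
Import numFieldNormedType.Exports.
Local Open Scope classical_set_scope.
Local Open Scope ring_scope.

(** The analytic and the probabilistic side share nothing but p and q. The quotient b = p / q solves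
    the Riccati equation b' = 1 - a b - (c^2/2) b^2 of the square-root model, and the linear system
    for (p, q) is the linearisation of that equation.

    The kernel C_T is the covariance of a component of the Ornstein-Uhlenbeck process on [t, T]
    given its value at t, reflected by s -> t + T - s. It is also c^2/4 times the Green function of
    - y'' + (a^2/4) y with y' = (a/2) y at t and y = 0 at T; the resolvent only shifts the
    potential, so C_T (1 + 2 C_T)^-1 is c^2/4 times the Green function for a^2/4 + c^2/2 with the
    same boundary conditions.

    Two obstacles shape the analysis. The product form of C_T needs ordered points while Fredholm's
    series integrates over a cube: the symmetry of the determinant reduces the cube to the part
    where one variable is the smallest. And an operator on L^2 determines its kernel only up to null
    sets, so its value at (t, t) has a meaning through continuity alone, which calls for a separate
    uniqueness argument. *)

Section IntervalIntegrals.
Context {R : realType}.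
Notation mu := (@lebesgue_measure R).
Implicit Types (a b c x K : R) (f g : R -> R).

Lemma lebesgue_itvcc_lty a b : (mu `[a, b]%classic < +oo)%E.
Proof. by rewrite /= lebesgue_measure_itv/=; case: ifP => // _; rewrite -EFinB ltry. Qed.

Lemma integrable_bounded_itv a b f K : measurable_fun `[a, b] f ->
  (forall x, a <= x <= b -> `|f x| <= K) -> mu.-integrable `[a, b] (EFin \o f).
Proof.
move=> mf fK; apply: measurable_bounded_integrable => //.
  exact: lebesgue_itvcc_lty.
exists K; split; first exact: num_real.
by move=> M KM x /=; rewrite in_itv/= => /fK/le_trans; apply; exact: ltW.
Qed.

Lemma integrable_continuous_itv a b f : {within `[a, b], continuous f} ->
  mu.-integrable `[a, b] (EFin \o f).
Proof. by move=> cf; apply: continuous_compact_integrable => //; exact: segment_compact. Qed.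

Lemma Rintegral_itvcc_cst a b K : a <= b ->
  \int[mu]_(x in `[a, b]) K = K * (b - a).
Proof.
move=> ab; rewrite Rintegral_cst//= lebesgue_measure_itv/= lte_fin.
have [_|] := ltP a b; first by rewrite -EFinB.
by move=> ba; have -> : a = b; [lra|rewrite subrr].
Qed.

Lemma normr_Rintegral_itv_le a b f K : a <= b -> measurable_fun `[a, b] f ->
  (forall x, a <= x <= b -> `|f x| <= K) ->
  `|\int[mu]_(x in `[a, b]) f x| <= K * (b - a).
Proof.
move=> ab mf fK; rewrite -Rintegral_itvcc_cst//.
have If := integrable_bounded_itv mf fK.
apply: (le_trans (le_normr_Rintegral _ If)) => //.
apply: le_Rintegral => //.
- apply: (@integrable_bounded_itv _ _ _ K); first exact: measurableT_comp.
  by move=> x /fK; rewrite normr_id.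
- apply: (@integrable_bounded_itv _ _ _ `|K|) => //.
Qed.

Lemma integrable_itvZl a b c f : mu.-integrable `[a, b] (EFin \o f) ->
  mu.-integrable `[a, b] (EFin \o (fun x => c * f x)).
Proof.
by move=> If; under [EFin \o _]eq_fun do rewrite /= EFinM; exact: integrableZl.
Qed.

Lemma integrable_itv_norm a b f : mu.-integrable `[a, b] (EFin \o f) ->
  mu.-integrable `[a, b] (EFin \o (fun x => `|f x|)).
Proof. by move=> If; have := integrable_abse If. Qed.

Lemma Rintegral_itvZl a b c f : mu.-integrable `[a, b] (EFin \o f) ->
  \int[mu]_(x in `[a, b]) (c * f x) = c * \int[mu]_(x in `[a, b]) f x.
Proof. by move=> If; rewrite RintegralZl. Qed.

Lemma Rintegral_itv_split a b c f : a <= c <= b ->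
  mu.-integrable `[a, b] (EFin \o f) ->
  \int[mu]_(x in `[a, b]) f x =
    \int[mu]_(x in `[a, c]) f x + \int[mu]_(x in `[c, b]) f x.
Proof.
move=> /andP[ac cb] If; have := @Rintegral_itvB R f (BLeft a) (BRight b) c If.
rewrite !bnd_simp => /(_ ac cb) H.
rewrite -(@Rintegral_itv_obnd_cbnd _ c); last first.
  by apply: integrableS If => //; exact: subset_itvr.
by rewrite -H addrC subrK.
Qed.

Lemma Rintegral_FTC2 a b f F : a <= b -> continuous f ->
  (forall x : R, is_derive x 1 F (f x)) ->
  \int[mu]_(x in `[a, b]) f x = F b - F a.
Proof.
rewrite le_eqVlt => /predU1P[<-|ab] cf dF.
  by rewrite set_itv1 Rintegral_set1 subrr.
rewrite /Rintegral (@continuous_FTC2 _ f F)//.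
- by apply: continuous_subspaceT => x; exact: cf.
- have cF (x : R) : {for x, continuous F}.
    by apply/differentiable_continuous/derivable1_diffP; have [] := dF x.
  split.
  + by move=> x _; have [] := dF x.
  + by apply: cvg_at_right_filter; exact: cF.
  + by apply: cvg_at_left_filter; exact: cF.
- by move=> x _; rewrite derive1E; exact: derive_val.
Qed.

End IntervalIntegrals.

(** * Parametric integrals and Fubini's theorem on intervals *)

Section ParametricIntegrals.
Context {R : realType}.
Notation mu := (@lebesgue_measure R).

Lemma Rintegral_itv_indic (a b : R) (f : R -> R) :
  \int[mu]_(s in `[a, b]) f s = \int[mu]_s (if a <= s <= b then f s else 0).
Proof.
rewrite Rintegral_mkcond; apply: eq_Rintegral => s _.
rewrite patchE; congr (if _ then _ else _).
by apply/idP/idP; rewrite inE/= in_itv.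
Qed.

Lemma measurable_if_itv d (X : measurableType d) (l r : X -> R)
    (f : X * R -> R) :
  measurable_fun setT l -> measurable_fun setT r -> measurable_fun setT f ->
  measurable_fun setT (fun p : X * R => if l p.1 <= p.2 <= r p.1 then f p else 0).
Proof.
move=> ml mr mf; apply: measurable_fun_ifT => //.
apply: measurable_and; apply: measurable_fun_ler => //;
  exact: measurableT_comp.
Qed.

(** The moving endpoints are absorbed into the integrand as a cut-off; the integral is then the
    finite part of a difference of two Tonelli integrals, those of the positive and the negative
    part. *)
Lemma measurable_Rintegral_itv d (X : measurableType d) (l r : X -> R)
    (f : X * R -> R) :
  measurable_fun setT l -> measurable_fun setT r -> measurable_fun setT f ->
  measurable_fun setT (fun x => \int[mu]_(s in `[l x, r x]) f (x, s)).
Proof.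
move=> ml mr mf.
pose g : X * R -> \bar R :=
  EFin \o (fun p => if l p.1 <= p.2 <= r p.1 then f p else 0).
have mg : measurable_fun setT g.
  by apply/measurable_EFinP; exact: measurable_if_itv.
rewrite (_ : (fun _ => _) = (fun x => fine
    (\int[mu]_s (g^\+ (x, s)) - \int[mu]_s (g^\- (x, s)))%E)); last first.
  apply/funext => x; rewrite Rintegral_itv_indic /Rintegral; congr fine.
  rewrite integralE; congr (_ - _)%E; apply: eq_integral => s _.
    by rewrite !funeposE.
  by rewrite !funenegE.
apply: measurableT_comp => //; apply: emeasurable_funB.
  apply: (@measurable_fun_fubini_tonelli_F _ _ _ _ R mu (g^\+)%E) => //.
  exact: measurable_funepos.
apply: (@measurable_fun_fubini_tonelli_F _ _ _ _ R mu (g^\-)%E) => //.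
exact: measurable_funeneg.
Qed.

Lemma mem_itvccE (a b x : R) : (x \in `[a, b]%classic) = (a <= x <= b).
Proof. by apply/idP/idP; rewrite inE/= in_itv. Qed.

(** The bound [h] depends on [u] alone because [integral_op_comp] needs an integrable, possibly
    unbounded function of that variable. The integrand is cut off to 0 outside the square, so that
    Fubini's theorem on the plane applies. *)
Lemma Rintegral_Fubini (a b : R) (f : R * R -> R) (h : R -> R) :
  measurable_fun setT f -> mu.-integrable `[a, b] (EFin \o h) ->
  (forall s u, a <= s <= b -> a <= u <= b -> `|f (s, u)| <= h u) ->
  \int[mu]_(s in `[a, b]) \int[mu]_(u in `[a, b]) f (s, u) =
  \int[mu]_(u in `[a, b]) \int[mu]_(s in `[a, b]) f (s, u).
Proof.
move=> mf Ih fh.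
pose g : R * R -> R := fun p => if a <= p.1 <= b then (if a <= p.2 <= b then f p else 0) else 0.
have mg : measurable_fun setT g.
  apply: measurable_fun_ifT => //.
    by apply: measurable_and; apply: measurable_fun_ler => //.
  by apply: (measurable_if_itv (l := cst a) (r := cst b)).
have mgE : measurable_fun setT (EFin \o g) by exact/measurable_EFinP.
have If1 s : a <= s <= b -> mu.-integrable `[a, b] (fun u => (f (s, u))%:E).
  move=> sab; apply: (le_integrable _ _ _ Ih) => //.
    by apply/measurable_EFinP/measurable_funTS; exact: measurableT_comp.
  move=> u /=; rewrite in_itv/= => uab; rewrite lee_fin.
  by rewrite (le_trans (fh s u sab uab))// ler_norm.
have If2 u : a <= u <= b -> mu.-integrable `[a, b] (fun s => (f (s, u))%:E).
  move=> uab; apply: (@integrable_bounded_itv _ _ _ _ (h u)).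
    by apply/measurable_funTS; apply: measurableT_comp => //.
  by move=> s sab; exact: fh.
have Ig : (mu \x mu)%E.-integrable setT (EFin \o g).
  apply/integrable12ltyP => //.
  apply: (@le_lt_trans _ _ (\int[mu]_(s in `[a, b]) \int[mu]_(u in `[a, b]) `|(h u)%:E|)%E).
    rewrite [leRHS]integral_mkcond.
    apply: ge0_le_integral => //=.
    - by move=> x _; exact: integral_ge0.
    - apply: (@measurable_fun_fubini_tonelli_F _ _ _ _ R mu (abse \o (EFin \o g))).
        exact: measurableT_comp.
      by move=> p; exact: abse_ge0.
    - by apply/(measurable_restrictT _ _).1 => //.
    - move=> s _; rewrite patchE mem_itvccE; case: ifPn => sab; last first.
        by rewrite integral0_eq// => u _; rewrite /g/= (negbTE sab) normr0.
      rewrite [leRHS]integral_mkcond; apply: ge0_le_integral => //=.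
      + by apply: measurableT_comp => //; apply: measurableT_comp => //; apply: measurableT_comp.
      + apply/(measurable_restrictT _ _).1 => //.
        apply/measurable_EFinP; apply: measurableT_comp => //.
        by apply/measurable_EFinP; case/integrableP: Ih.
      + move=> u _; rewrite patchE mem_itvccE /g/= sab; case: ifPn => uab.
          by rewrite lee_fin (le_trans (fh s u sab uab))// ler_norm.
        by rewrite normr0.
  rewrite integral_cst//=; case/integrableP: Ih => _ Ih.
  by apply: lte_mul_pinfty; rewrite ?integral_ge0 ?ge0_fin_numE ?integral_ge0// lebesgue_itvcc_lty.
transitivity (fine (\int[mu]_s \int[mu]_u (g (s, u))%:E)%E).
  rewrite /Rintegral [in LHS]integral_mkcond; congr fine.
  apply: eq_integral => s _; rewrite patchE mem_itvccE /g/=.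
  case: ifPn => [sab|_]; last by rewrite integral0.
  rewrite fineK; last by apply: integrable_fin_num => //; exact: If1.
  rewrite integral_mkcond; apply: eq_integral => u _.
  by rewrite patchE mem_itvccE; case: ifP.
rewrite (@Fubini _ _ _ _ _ mu mu (EFin \o g))//.
rewrite /Rintegral [in RHS]integral_mkcond; congr fine.
apply: eq_integral => u _; rewrite patchE mem_itvccE /g/=.
case: ifPn => [uab|_]; last by rewrite integral0_eq// => s _; case: ifP.
rewrite fineK; last by apply: integrable_fin_num => //; exact: If2.
rewrite [in RHS]integral_mkcond; apply: eq_integral => s _.
by rewrite patchE mem_itvccE; case: ifP.
Qed.

(** Both sides integrate over the triangle [a <= u <= s <= b]; cutting [f] off outside it reduces
    the claim to Fubini on the square. *)
Lemma Rintegral_triangle (a b K : R) (f : R * R -> R) :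
  measurable_fun setT f ->
  (forall s u, a <= s <= b -> a <= u <= b -> `|f (s, u)| <= K) ->
  \int[mu]_(s in `[a, b]) \int[mu]_(u in `[a, s]) f (s, u) =
  \int[mu]_(u in `[a, b]) \int[mu]_(s in `[u, b]) f (s, u).
Proof.
move=> mf fK.
pose g p := if p.2 <= p.1 then f p else 0.
transitivity (\int[mu]_(s in `[a, b]) \int[mu]_(u in `[a, b]) g (s, u)).
  apply: eq_Rintegral => s; rewrite mem_itvccE => /andP[as_ sb].
  rewrite !Rintegral_itv_indic; apply: eq_Rintegral => u _; rewrite /g/=.
  have [us|us] := leP u s; last by rewrite andbF; case: ifP.
  by rewrite (le_trans us sb).
rewrite (@Rintegral_Fubini _ _ _ (cst K)).
- apply: eq_Rintegral => u; rewrite mem_itvccE => /andP[au ub].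
  rewrite !Rintegral_itv_indic; apply: eq_Rintegral => s _; rewrite /g/=.
  have [us|us] /= := leP u s; last by case: ifP.
  by rewrite (le_trans au us).
- by apply: measurable_fun_ifT => //; apply: measurable_fun_ler.
- by apply: (@integrable_bounded_itv _ _ _ _ `|K|).
- move=> s u sab uab; rewrite /g/=; case: ifP => _; first exact: fK.
  by rewrite normr0; apply: le_trans (fK _ _ sab uab).
Qed.

End ParametricIntegrals.

(** * Iterated integrals and Fredholm's series *)

Section IteratedIntegrals.
Context {R : realType}.
Notation mu := (@lebesgue_measure R).

(* f x is jointly measurable in x and the first n entries of its list argument. *)
Fixpoint list_measurable n d (X : measurableType d) (f : X -> seq R -> R) : Prop :=
  if n is n'.+1 then
    @list_measurable n' _ (X * R)%type (fun p v => f p.1 (p.2 :: v))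
  else measurable_fun setT (fun x => f x [::]).

Lemma list_measurable_comp n d (X : measurableType d) d' (Y : measurableType d')
    (g : Y -> X) (f : X -> seq R -> R) : measurable_fun setT g ->
  list_measurable n f -> list_measurable n (fun y => f (g y)).
Proof.
elim: n d X d' Y g f => [|n IH] d X d' Y g f mg /=.
  move=> mf; exact: (measurableT_comp mf mg).
move=> mf; apply: (IH _ _ _ _ (fun p : Y * R => (g p.1, p.2)) _ _ mf).
by apply: measurable_fun_pair => //; exact: measurableT_comp.
Qed.

Lemma list_measurable_fst n d (X : measurableType d) (h : X -> R) :
  measurable_fun setT h -> list_measurable n (fun x _ => h x).
Proof.
elim: n d X h => [|n IH] d X h mh //=.
by apply: (IH _ _ (fun p => h p.1)); exact: measurableT_comp.
Qed.

Lemma list_measurable_nth n d (X : measurableType d) i :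
  list_measurable n (fun (_ : X) v => v`_i).
Proof.
elim: n d X i => [|n IH] d X [|i] //=.
  by apply: list_measurable_fst.
exact: IH.
Qed.

Lemma list_measurable_op2 n d (X : measurableType d) (op : R -> R -> R)
    (f g : X -> seq R -> R) : measurable_fun setT (fun p : R * R => op p.1 p.2) ->
  list_measurable n f -> list_measurable n g ->
  list_measurable n (fun x v => op (f x v) (g x v)).
Proof.
move=> mop; elim: n d X f g => [|n IH] d X f g /= mf mg; last exact: IH.
by apply: (measurableT_comp mop (g := fun x => (f x [::], g x [::])));
  exact: measurable_fun_pair.
Qed.

Lemma list_measurable_bigop n d (X : measurableType d) (op : R -> R -> R) (idx : R)
    (I : Type) (r : seq I) (F : I -> X -> seq R -> R) :
  measurable_fun setT (fun p : R * R => op p.1 p.2) ->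
  (forall i, list_measurable n (F i)) ->
  list_measurable n (fun x v => \big[op/idx]_(i <- r) F i x v).
Proof.
move=> mop mF; elim: r => [|i r IH].
  under [X in list_measurable _ X]eq_fun do under eq_fun do rewrite big_nil.
  exact: list_measurable_fst.
under [X in list_measurable _ X]eq_fun do under eq_fun do rewrite big_cons.
exact: list_measurable_op2.
Qed.

Lemma list_measurable_det n (k : R -> R -> R) d (X : measurableType d) :
  measurable_fun setT (fun p : R * R => k p.1 p.2) ->
  list_measurable n (fun (_ : X) v => \det (\matrix_(i < n, j < n) k v`_i v`_j)).
Proof.
move=> mk; rewrite /determinant.
apply: list_measurable_bigop => [|s]; first exact: measurable_funD.
apply: list_measurable_op2; first exact: measurable_funM.
  exact: list_measurable_fst.
apply: list_measurable_bigop => [|i]; first exact: measurable_funM.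
rewrite (_ : (fun _ => _) = fun (_ : X) v => k v`_i v`_(s i)); last first.
  by apply/funext => x; apply/funext => v; rewrite mxE.
by apply: list_measurable_op2 => //; exact: list_measurable_nth.
Qed.

(** The lower limit may depend on the parameter, since below the current smallest variable serves as
    the lower limit for all others. *)
Lemma measurable_iterated_integral n d (X : measurableType d) (l : X -> R) (b : R)
    (f : X -> seq R -> R) : measurable_fun setT l -> list_measurable n f ->
  measurable_fun setT (fun x => iterated_integral (l x) b n (f x)).
Proof.
elim: n d X l f => [|n IH] d X l f ml mf //=.
apply: (measurable_Rintegral_itv (r := cst b)
  (f := fun p => iterated_integral (l p.1) b n (fun v => f p.1 (p.2 :: v)))) => //.
by apply: (IH _ (X * R)%type (fun p => l p.1)) => //; exact: measurableT_comp.
Qed.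

Lemma eq_iterated_integral (a b : R) n (f g : seq R -> R) :
  (forall v, size v = n -> all (fun s => a <= s <= b) v -> f v = g v) ->
  iterated_integral a b n f = iterated_integral a b n g.
Proof.
elim: n f g => [|n IH] f g fg /=; first exact: fg.
apply: eq_Rintegral => s; rewrite mem_itvccE => sab; apply: IH => v sv vab.
by apply: fg => /=; rewrite ?sv ?sab.
Qed.

Lemma normr_iterated_integral (a b K : R) n (f : seq R -> R) :
  a <= b -> list_measurable n (fun (_ : unit) => f) ->
  (forall v, size v = n -> all (fun s => a <= s <= b) v -> `|f v| <= K) ->
  `|iterated_integral a b n f| <= K * (b - a) ^+ n.
Proof.
move=> ab; elim: n f => [|n IH] f mf fK /=; first by rewrite mulr1; exact: fK.
rewrite exprSr mulrA.
have mf' s : list_measurable n (fun _ : unit => fun v => f (s :: v)).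
  apply: (list_measurable_comp (g := fun u : unit => (u, s)) _ mf).
  exact: measurable_fun_pair.
apply: normr_Rintegral_itv_le => //.
  apply: measurable_funTS.
  apply: (@measurable_iterated_integral _ _ _ (cst a) b (fun s v => f (s :: v))) => //.
  apply: (list_measurable_comp (g := fun s => (tt, s)) _ mf).
  exact: measurable_fun_pair.
by move=> s sab; apply: IH => // v sv vab; apply: fK => /=; rewrite ?sv ?sab.
Qed.

End IteratedIntegrals.

Section SymmetricIteratedIntegrals.
Context {R : realType}.
Notation mu := (@lebesgue_measure R).

Lemma iterated_integralS (a b : R) n (f : seq R -> R) :
  iterated_integral a b n.+1 f =
  \int[mu]_(s in `[a, b]) iterated_integral a b n (fun v => f (s :: v)).
Proof. by []. Qed.

Definition list_bounded (a b K : R) n (f : seq R -> R) :=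
  forall v, size v = n -> all (fun s => a <= s <= b) v -> `|f v| <= K.

Definition list_symmetric n (f : seq R -> R) :=
  forall v w, size v = n -> perm_eq v w -> f v = f w.

Lemma list_measurable_cons n (f : seq R -> R) (s : R) :
  list_measurable n.+1 (fun _ : unit => f) ->
  list_measurable n (fun _ : unit => fun v => f (s :: v)).
Proof.
apply: (list_measurable_comp (g := fun u : unit => (u, s))).
exact: measurable_fun_pair.
Qed.

Lemma list_measurable_consx n (f : seq R -> R) :
  list_measurable n.+1 (fun _ : unit => f) ->
  list_measurable n (fun s v => f (s :: v)).
Proof.
apply: (list_measurable_comp (g := fun s => (tt, s))).
exact: measurable_fun_pair.
Qed.

Lemma list_measurable_consxx n (f : seq R -> R) :
  list_measurable n.+2 (fun _ : unit => f) ->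
  list_measurable n (fun (p : R * R) v => f (p.1 :: p.2 :: v)).
Proof. by move/list_measurable_consx. Qed.

Lemma list_bounded_cons n a b K (f : seq R -> R) (s : R) : a <= s <= b ->
  list_bounded a b K n.+1 f -> list_bounded a b K n (fun v => f (s :: v)).
Proof. by move=> sab fK v sv vab; apply: fK => /=; rewrite ?sv ?sab. Qed.

Lemma list_boundedS n a b K (f : seq R -> R) (s : R) : a <= s ->
  list_bounded a b K n f -> list_bounded s b K n f.
Proof.
move=> as_ fK v sv vab; apply: fK => //; apply: sub_all vab => x /andP[sx ->].
by rewrite (le_trans as_).
Qed.

Lemma list_symmetric_cons n (f : seq R -> R) s :
  list_symmetric n.+1 f -> list_symmetric n (fun v => f (s :: v)).
Proof. by move=> sf v w sv vw; apply: sf => /=; rewrite ?sv// perm_cons. Qed.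

Lemma measurable_iterated_integral_cons n (l : R -> R) b (f : seq R -> R) :
  measurable_fun setT l -> list_measurable n.+1 (fun _ : unit => f) ->
  measurable_fun setT (fun s => iterated_integral (l s) b n (fun v => f (s :: v))).
Proof.
move=> ml mf.
apply: (@measurable_iterated_integral _ n _ _ l b (fun s v => f (s :: v))) => //.
exact: list_measurable_consx.
Qed.

Lemma iterated_integralZ (a b c K : R) n (f : seq R -> R) : a <= b ->
  list_measurable n (fun _ : unit => f) -> list_bounded a b K n f ->
  iterated_integral a b n (fun v => c * f v) = c * iterated_integral a b n f.
Proof.
move=> ab; elim: n f => [|n IH] f mf fK //=.
under eq_Rintegral => s.
  rewrite mem_itvccE => sab; rewrite IH; last 2 first.
    exact: list_measurable_cons.
    exact: list_bounded_cons.
  over.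
rewrite RintegralZl//; apply: (@integrable_bounded_itv _ _ _ _ (K * (b - a) ^+ n)).
  by apply: measurable_funTS; exact: (measurable_iterated_integral_cons (l := cst a)).
move=> s sab; apply: normr_iterated_integral => //.
  exact: list_measurable_cons.
exact: list_bounded_cons.
Qed.

Lemma list_bounded_ge0 n a b K (f : seq R -> R) : a <= b -> list_bounded a b K n f -> 0 <= K.
Proof.
move=> ab fK; apply: le_trans (fK (nseq n a) _ _); rewrite ?normr_ge0 ?size_nseq//.
by rewrite all_nseq lexx ab orbT.
Qed.

(* By symmetry, the n.+1 parts of the cube on which a given variable is the
   smallest one contribute equally. *)
Lemma iterated_integral_symmetric (a b K : R) n (f : seq R -> R) : a <= b ->
  list_measurable n.+1 (fun _ : unit => f) -> list_bounded a b K n.+1 f ->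
  list_symmetric n.+1 f ->
  iterated_integral a b n.+1 f =
  n.+1%:R * \int[mu]_(s in `[a, b]) iterated_integral s b n (fun v => f (s :: v)).
Proof.
elim: n a f => [|n IH] a f ab mf fK sf; first by rewrite mul1r.
have K0 := list_bounded_ge0 ab fK.
pose g p := iterated_integral p.2 b n (fun v => f (p.1 :: p.2 :: v)).
have mg : measurable_fun setT g.
  apply: (@measurable_iterated_integral _ n _ _ (fun p => p.2) b
    (fun p v => f (p.1 :: p.2 :: v))); first exact: measurable_snd.
  exact: list_measurable_consxx.
have gK s u : a <= s <= b -> a <= u <= b -> `|g (s, u)| <= K * (b - a) ^+ n.
  move=> sab uab; apply: (@le_trans _ _ (K * (b - u) ^+ n)).
    case/andP: (uab) => au ub.
    apply: normr_iterated_integral => //=.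
      exact: (list_measurable_cons u (list_measurable_cons s mf)).
    exact: (list_boundedS au (list_bounded_cons uab (list_bounded_cons sab fK))).
  rewrite ler_wpM2l// lerXn2r ?nnegrE; lra.
have mg1 s : measurable_fun setT (fun u => g (s, u)).
  by apply: (measurableT_comp mg (g := fun u => (s, u))); exact: measurable_fun_pair.
(* The induction hypothesis is used on [[a, b]] and on [[s, b]]; the two differ by the integral over
   [[a, s]], where the second variable is smaller than [s]. *)
have E s : a <= s <= b -> iterated_integral a b n.+1 (fun v => f (s :: v)) =
    n.+1%:R * \int[mu]_(u in `[a, s]) g (s, u) + iterated_integral s b n.+1 (fun v => f (s :: v)).
  move=> sab; case/andP: (sab) => as_ sb.
  have mfs := list_measurable_cons s mf.
  have fsK := list_bounded_cons sab fK.
  have sfs := list_symmetric_cons s sf.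
  rewrite (IH a _ ab mfs fsK sfs) (IH s _ sb mfs (list_boundedS as_ fsK) sfs).
  rewrite -mulrDr; congr (_ * _); rewrite (Rintegral_itv_split (c := s))//.
  apply: (@integrable_bounded_itv _ _ _ _ (K * (b - a) ^+ n)).
    by apply: measurable_funTS; exact: mg1.
  by move=> u uab; exact: gK.
pose J s := iterated_integral s b n.+1 (fun v => f (s :: v)).
transitivity (\int[mu]_(s in `[a, b]) (n.+1%:R * \int[mu]_(u in `[a, s]) g (s, u) + J s)).
  by rewrite iterated_integralS; apply: eq_Rintegral => s; rewrite mem_itvccE => /E.
have I1 : mu.-integrable `[a, b] (EFin \o (fun s => \int[mu]_(u in `[a, s]) g (s, u))).
  apply: (@integrable_bounded_itv _ _ _ _ (K * (b - a) ^+ n * (b - a))).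
    apply: measurable_funTS.
    by apply: (measurable_Rintegral_itv (l := cst a) (r := id)).
  move=> s sab; case/andP: (sab) => as_ sb.
  apply: (@le_trans _ _ (K * (b - a) ^+ n * (s - a))).
    apply: normr_Rintegral_itv_le => //.
      by apply: measurable_funTS; exact: mg1.
    by move=> u /andP[au us]; apply: gK => //; rewrite au (le_trans us).
  by rewrite ler_wpM2l ?mulr_ge0// ?exprn_ge0//; lra.
have mJ : measurable_fun setT J.
  exact: (@measurable_iterated_integral_cons n.+1 id).
have I2 : mu.-integrable `[a, b] (EFin \o J).
  apply: (@integrable_bounded_itv _ _ _ _ (K * (b - a) ^+ n.+1)).
    exact: measurable_funTS.
  move=> s sab; case/andP: (sab) => as_ sb.
  apply: (@le_trans _ _ (K * (b - s) ^+ n.+1)).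
    apply: (normr_iterated_integral sb (list_measurable_cons s mf)).
    exact: (list_boundedS as_ (list_bounded_cons sab fK)).
  rewrite ler_wpM2l// lerXn2r ?nnegrE; lra.
rewrite RintegralD//; last first.
  exact: (integrable_itvZl n.+1%:R I1).
rewrite (Rintegral_itvZl n.+1%:R I1).
(* On the left [u] is the smaller of the two leading variables. Exchanging the order of integration
   over the triangle, then the two arguments by symmetry, makes the outer variable the smallest
   one. *)
suff H : \int[mu]_(s in `[a, b]) \int[mu]_(u in `[a, s]) g (s, u) =
    \int[mu]_(s in `[a, b]) J s.
  rewrite -[in RHS]natr1 mulrDl mul1r.
  exact: (congr1 (fun z => n.+1%:R * z + \int[mu]_(s in `[a, b]) J s) H).
apply: (eq_trans (Rintegral_triangle mg gK)).
apply: eq_Rintegral => u _; rewrite /J iterated_integralS.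
apply: eq_Rintegral => s _.
apply: eq_iterated_integral => v sv _; apply: sf => /=; first by rewrite sv.
by rewrite (perm_catCA [:: s] [:: u] v).
Qed.

End SymmetricIteratedIntegrals.

(** * Determinants of separable kernels *)

Section SeparableDeterminants.
Context {R : realType}.
Variable k : R -> R -> R.

Definition kernel_det n (s : seq R) : R := \det (\matrix_(i < n, j < n) k s`_i s`_j).

(** Permuting the points permutes rows and columns alike, so the sign of the permutation enters
    twice. *)
Lemma kernel_det_symmetric n : list_symmetric n (kernel_det n).
Proof.
move=> v w sv vw; have sw : size w = n by rewrite -(perm_size vw).
have /tuple_permP[s vE] : perm_eq (Tuple (introT eqP sv)) (Tuple (introT eqP sw)) by [].
have E (i : 'I_n) : v`_i = w`_(s i).
  have -> : v = tval (Tuple (introT eqP sv)) by [].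
  rewrite vE /= (nth_map i) ?size_enum_ord// nth_ord_enum.
  by rewrite (tnth_nth 0).
rewrite /kernel_det.
have -> : (\matrix_(i < n, j < n) k v`_i v`_j) =
    row_perm s (col_perm s (\matrix_(i < n, j < n) k w`_i w`_j)).
  by apply/matrixP => i j; rewrite !mxE !E.
rewrite row_permE col_permE !det_mulmx !det_perm mulrC -mulrA.
by rewrite odd_permV -signr_addb addbb mulr1.
Qed.

(** Leibniz's formula with each of the [n!] products bounded by [K ^+ n]. This crude bound serves
    integrability; convergence of the series comes from [rest_le]. *)
Lemma list_bounded_kernel_det (a b K : R) n :
  (forall s u, a <= s <= b -> a <= u <= b -> `|k s u| <= K) -> a <= b ->
  list_bounded a b (n`!%:R * K ^+ n) n (kernel_det n).
Proof.
move=> kK ab v sv vab; rewrite /kernel_det /determinant.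
have K0 : 0 <= K by apply: le_trans (kK a a _ _); rewrite ?normr_ge0// lexx.
apply: (le_trans (ler_norm_sum _ _ _)).
apply: (@le_trans _ _ (\sum_(s : 'S_n) K ^+ n)).
  apply: ler_sum => s _; rewrite normrM normrX normrN1 expr1n mul1r normr_prod.
  rewrite -[X in K ^+ X]card_ord -prodr_const.
  apply: ler_prod => i _; rewrite normr_ge0 mxE.
  by apply: kK; apply: (allP vab); rewrite mem_nth// sv.
by rewrite sumr_const card_Sn mulr_natl.
Qed.

Variables (phi psi : R -> R).
Hypothesis phi_neq0 : forall s, phi s != 0.
Hypothesis kE : forall s u, s <= u -> k s u = phi s * psi u.
Hypothesis kC : forall s u, k s u = k u s.

(** The diagonal entry [k s s - phi s / phi u * k u s] that survives the row operation, for
    [s <= u]. *)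
Definition kernel_step s u := phi s * psi s - phi s ^+ 2 * psi u / phi u.

(* Subtract from the first row the multiple of the second one that clears all
   its entries but the diagonal one. *)
Lemma kernel_det_step n s u v : s <= u -> all (fun x => u <= x) v -> size v = n ->
  kernel_det n.+2 [:: s, u & v] = kernel_step s u * kernel_det n.+1 (u :: v).
Proof.
move=> su uv sv; rewrite /kernel_det.
set A := \matrix_(i < n.+2, j < n.+2) _.
pose B := \matrix_(i < n.+2, j < n.+2)
  if i == 0 then (if j == 0 then kernel_step s u else 0) else A i j.
pose C := \matrix_(i < n.+2, j < n.+2) if i == 0 then A (lift 0 0) j else A i j.
have rE (j : 'I_n.+2) : A 0 j = B 0 j + phi s / phi u * C 0 j.
  rewrite !mxE /=.
  case: (unliftP ord0 j) => [j' ->|->] /=.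
    have uj : u <= (u :: v)`_j'.
      case: j' => -[|m] hm //=; apply: (allP uv); rewrite mem_nth// sv.
      by rewrite -ltnS.
    rewrite (kE uj) (kE (le_trans su uj)) add0r.
    by rewrite mulrA divfK.
  rewrite (kC u) !kE// /kernel_step; field; exact: phi_neq0.
have rB : row' 0 B = row' 0 A.
  by apply/matrixP => i j; rewrite !mxE.
have rC : row' 0 C = row' 0 A.
  by apply/matrixP => i j; rewrite !mxE.
rewrite (@determinant_multilinear _ _ A B C 0 1 (phi s / phi u)) ?rB ?rC//; last first.
  by apply/rowP => j; have := rE j; rewrite !mxE mul1r => ->.
rewrite mul1r (@determinant_alternate _ _ C 0 (lift 0 0))//; last first.
  by move=> j; rewrite !mxE.
rewrite mulr0 addr0 (expand_det_row _ 0) big_ord_recl big1 => [|j _]; last first.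
  by rewrite !mxE /= mul0r.
rewrite addr0 !mxE/= /cofactor /= expr0 mul1r; congr (_ * \det _).
by apply/matrixP => i j; rewrite !mxE.
Qed.

End SeparableDeterminants.

(** * Fredholm's series as the Neumann series of a Volterra equation *)

Section FredholmSeries.
Context {R : realType}.
Notation mu := (@lebesgue_measure R).
Variables (k : R -> R -> R) (phi psi : R -> R) (t T : R).
Hypothesis tT : t <= T.
Hypothesis phi_neq0 : forall s, phi s != 0.
Hypothesis kE : forall s u, s <= u -> k s u = phi s * psi u.
Hypothesis kC : forall s u, k s u = k u s.
Hypothesis mk : measurable_fun setT (fun p : R * R => k p.1 p.2).
Variable K : R.
Hypothesis kK : forall s u, t <= s <= T -> t <= u <= T -> `|k s u| <= K.
Let q := kernel_step phi psi.
Hypothesis mq : measurable_fun setT (fun p : R * R => q p.1 p.2).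
Variable Q : R.
Hypothesis qQ : forall s u, t <= s -> s <= u -> u <= T -> `|q s u| <= Q.

(** The term of order [n.+1] with its smallest variable frozen at [s] and the [n] others in
    [[s, T]]. The factor [n.+1] gained from symmetry turns [1 / n.+1!] into [1 / n!]. *)
Let B n s := (n`!%:R)^-1 * iterated_integral s T n (fun v => kernel_det k n.+1 (s :: v)).

Let mdet n : list_measurable n (fun _ : unit => kernel_det k n).
Proof. exact: list_measurable_det. Qed.

Let detK n s : t <= s <= T -> list_bounded s T (n`!%:R * K ^+ n) n (kernel_det k n).
Proof.
move=> /andP[ts sT]; apply: list_bounded_kernel_det => // x y /andP[sx xT] /andP[sy yT].
by apply: kK; rewrite ?xT ?yT andbT; exact: le_trans ts _.
Qed.

Let mB n : measurable_fun setT (B n).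
Proof.
apply: measurable_funM => //; apply: (@measurable_iterated_integral_cons _ n id) => //.
Qed.

Let B_bounded n : exists C : R, forall s, t <= s <= T -> `|B n s| <= C.
Proof.
exists ((n`!%:R)^-1 * (n.+1`!%:R * K ^+ n.+1 * (T - t) ^+ n)) => s sT.
have K0 : 0 <= K by apply: le_trans (kK (s := t) (u := t) _ _); rewrite ?normr_ge0// lexx.
case/andP: (sT) => ts sT'.
rewrite normrM ger0_norm ?invr_ge0 ?ler0n// ler_wpM2l ?invr_ge0 ?ler0n//.
apply: (@le_trans _ _ (n.+1`!%:R * K ^+ n.+1 * (T - s) ^+ n)).
  apply: (normr_iterated_integral sT' (list_measurable_cons s (mdet n.+1))).
  by apply: list_bounded_cons; rewrite ?lexx//; exact: detK.
by rewrite ler_wpM2l ?mulr_ge0 ?exprn_ge0 ?ler0n// lerXn2r ?nnegrE//; lra.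
Qed.

Let IB n s : t <= s -> mu.-integrable `[s, T] (EFin \o B n).
Proof.
have [C BC] := B_bounded n; move=> ts.
apply: (@integrable_bounded_itv _ _ _ _ C); first exact: measurable_funTS.
by move=> x /andP[sx xT]; apply: BC; rewrite xT (le_trans ts).
Qed.

Let Iq (f : R -> R) C s : measurable_fun setT f ->
  (forall u, t <= u <= T -> `|f u| <= C) -> t <= s ->
  mu.-integrable `[s, T] (EFin \o (fun u => q s u * f u)).
Proof.
move=> mf fC ts; apply: (@integrable_bounded_itv _ _ _ _ (Q * C)).
  apply: measurable_funTS; apply: measurable_funM => //.
  by apply: (measurableT_comp mq (g := fun u => (s, u))); exact: measurable_fun_pair.
move=> u /andP[su uT]; rewrite normrM ler_pM ?qQ ?fC// uT andbT.
exact: le_trans su.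
Qed.

Let IqB n s : t <= s -> mu.-integrable `[s, T] (EFin \o (fun u => q s u * B n u)).
Proof. by have [C BC] := B_bounded n; exact: (Iq (C := C)). Qed.

Let fredholm_term0 : fredholm_term t T k 0 = 1.
Proof. by rewrite /fredholm_term /= fact0 invr1 mul1r det_mx00. Qed.

Let fredholm_termS n : fredholm_term t T k n.+1 = \int[mu]_(s in `[t, T]) B n s.
Proof.
have tt : t <= t <= T by rewrite lexx.
rewrite /fredholm_term -/(kernel_det k n.+1).
rewrite (iterated_integral_symmetric tT (mdet _) (detK tt)
  (@kernel_det_symmetric _ k n.+1)).
have I : mu.-integrable `[t, T] (EFin \o B n) by exact: IB.
under [in LHS]eq_Rintegral => s _.
  rewrite (_ : iterated_integral _ _ _ _ = n`!%:R * B n s); last first.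
    by rewrite /B mulrA divff ?mul1r// pnatr_eq0 -lt0n fact_gt0.
  over.
rewrite (Rintegral_itvZl _ I) factS natrM.
by rewrite [_ * (_ * \int[mu]_(_ in _) _)]mulrA mulKf// mulf_neq0 ?pnatr_eq0// -lt0n fact_gt0.
Qed.

Let B0 s : B 0 s = k s s.
Proof. by rewrite /B /= fact0 invr1 mul1r /kernel_det det_mx11 mxE. Qed.

(** Among the remaining [n.+1] variables a smallest one [u] is singled out by symmetry again, and
    the row operation then splits off the factor [q s u]. *)
Let BS n s : t <= s <= T -> B n.+1 s = \int[mu]_(u in `[s, T]) (q s u * B n u).
Proof.
move=> tsT; case/andP: (tsT) => ts sT.
have H := list_symmetric_cons s (@kernel_det_symmetric _ k n.+2).
have ss : s <= s <= T by rewrite lexx.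
rewrite {1}/B (iterated_integral_symmetric sT (list_measurable_cons s (mdet n.+2))
  (list_bounded_cons ss (detK tsT)) H).
have -> : \int[mu]_(u in `[s, T]) iterated_integral u T n
      (fun v => kernel_det k n.+2 [:: s, u & v]) =
    \int[mu]_(u in `[s, T]) (n`!%:R * (q s u * B n u)).
  apply: eq_Rintegral => u; rewrite mem_itvccE => /andP[su uT].
  have tu : t <= u by exact: le_trans su.
  have tuT : t <= u <= T by rewrite tu.
  have uu : u <= u <= T by rewrite lexx.
  transitivity (iterated_integral u T n (fun v => q s u * kernel_det k n.+1 (u :: v))).
    apply: eq_iterated_integral => v sv uvT; apply: kernel_det_step => //.
    by apply: sub_all uvT => x /andP[].
  rewrite (iterated_integralZ _ uT (list_measurable_cons u (mdet n.+1))
    (list_bounded_cons uu (detK tuT))) /B.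
  by rewrite mulrCA mulVKf// pnatr_eq0 -lt0n fact_gt0.
rewrite (Rintegral_itvZl _ (IqB n ts)) factS natrM.
by rewrite [_ * (_ * \int[mu]_(_ in _) _)]mulrA mulKf// mulf_neq0 ?pnatr_eq0// -lt0n fact_gt0.
Qed.

(** A bounded solution of the Volterra equation is supplied from outside, in closed form for the
    bond kernel; the estimate of the remainder shows that the [B n] sum to it. *)
Variable A : R -> R.
Hypothesis mA : measurable_fun setT A.
Variable L : R.
Hypothesis AL : forall s, t <= s <= T -> `|A s| <= L.
Hypothesis AE : forall s, t <= s <= T ->
  A s = k s s + \int[mu]_(u in `[s, T]) (q s u * A u).

Let rest m s := A s - \sum_(n < m) B n s.

Let mrest m : measurable_fun setT (rest m).
Proof. by apply: measurable_funB => //; apply: measurable_sum. Qed.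

Let rest_bounded m : exists C : R, forall s, t <= s <= T -> `|rest m s| <= C.
Proof.
elim: m => [|m [C IH]]; first by exists L => s; rewrite /rest big_ord0 subr0; exact: AL.
have [C' BC'] := B_bounded m; exists (C + C') => s sT.
rewrite /rest big_ord_recr/= opprD addrA (le_trans (ler_normB _ _))//.
by rewrite lerD ?BC'// IH.
Qed.

Let restS m s : t <= s <= T -> rest m.+1 s = \int[mu]_(u in `[s, T]) (q s u * rest m u).
Proof.
move=> sT; case/andP: (sT) => ts _; elim: m => [|m IH].
  rewrite /rest big_ord1 B0 AE// addrC addKr.
  by apply: eq_Rintegral => u _; rewrite big_ord0 subr0.
have -> : rest m.+2 s = rest m.+1 s - B m.+1 s.
  by rewrite /rest big_ord_recr/= opprD addrA.
rewrite IH BS// -RintegralB//; last 2 first.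
- have [C HC] := rest_bounded m; exact: (Iq (C := C)).
- exact: IqB.
apply: eq_Rintegral => u _; rewrite -mulrBr; congr (_ * _).
by rewrite /rest big_ord_recr/= opprD addrA.
Qed.

(** The classical Volterra estimate: by [restS] each remainder is the image of the previous one
    under a kernel bounded by [Q] and supported on [s <= u], so each step integrates
    [(T - u) ^+ m / m!] once. *)
Let rest_le m s : t <= s <= T -> `|rest m s| <= L * Q ^+ m * ((T - s) ^+ m / m`!%:R).
Proof.
have Q0 : 0 <= Q by apply: le_trans (qQ (lexx t) (lexx t) tT); exact: normr_ge0.
have L0 : 0 <= L by apply: le_trans (AL (s := t) _); rewrite ?normr_ge0// lexx.
elim: m s => [|m IH] s sT.
  by rewrite !expr0 fact0 divr1 !mulr1 /rest big_ord0 subr0 AL.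
case/andP: (sT) => ts sT'; rewrite restS//.
have [C HC] := rest_bounded m.
have I1 := Iq (mrest m) HC ts.
apply: (le_trans (le_normr_Rintegral _ I1)) => //.
pose G u := - (L * Q ^+ m.+1 * ((T - u) ^+ m.+1 / m.+1`!%:R)).
pose g u := L * Q ^+ m.+1 * ((T - u) ^+ m / m`!%:R).
have gc : continuous g.
  move=> u; rewrite /g; apply: cvgM; first exact: cvg_cst.
  apply: cvgM; last exact: cvg_cst.
  apply: (@continuous_comp _ _ _ (fun u => T - u) (fun x => x ^+ m)).
    by apply: cvgB; [exact: cvg_cst|exact: cvg_id].
  exact: exprn_continuous.
have -> : L * Q ^+ m.+1 * ((T - s) ^+ m.+1 / (m.+1)`!%:R) = \int[mu]_(u in `[s, T]) g u.
  have dG (u : R) : is_derive u 1 G (g u).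
    have -> : G = (- (L * Q ^+ m.+1 / m.+1`!%:R)) *: ((cst T - id) ^+ m.+1 : R -> R).
      by apply/funext => x; rewrite /G !fctE /GRing.scale/=; ring.
    apply: is_derive_eq; rewrite /g !fctE /GRing.scale/= factS natrM.
    have h1 : m.+1%:R != 0 :> R by rewrite pnatr_eq0.
    have h2 : m`!%:R != 0 :> R by rewrite pnatr_eq0 -lt0n fact_gt0.
    move: (m.+1%:R : R) (m`!%:R : R) h1 h2 (Q ^+ m.+1) ((T - u) ^+ m).
    by move=> x y x0 y0 Qm z; field; rewrite x0 y0.
  rewrite (Rintegral_FTC2 sT' gc dG).
  by rewrite /G subrr expr0n /= mul0r mulr0 oppr0 sub0r opprK.
apply: le_Rintegral => //.
- exact: integrable_itv_norm I1.
- by apply: integrable_continuous_itv; exact: continuous_subspaceT.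
- move=> u /=; rewrite in_itv/= => /andP[su uT].
  rewrite normrM /g exprS (mulrCA L) -mulrA.
  apply: ler_pM => //; first exact: qQ.
  by apply: IH; rewrite uT (le_trans ts).
Qed.

Lemma fredholm_series_cvg : series (fredholm_term t T k) @ \oo --> 1 + \int[mu]_(s in `[t, T]) A s.
Proof.
have tt : t <= t <= T by rewrite lexx.
have Q0 : 0 <= Q by apply: le_trans (qQ (lexx t) (lexx t) tT); exact: normr_ge0.
have L0 : 0 <= L by apply: le_trans (AL tt).
have IA : mu.-integrable `[t, T] (EFin \o A).
  by apply: (integrable_bounded_itv _ AL); exact: measurable_funTS.
(* Off by one: the term of order 0 is the leading 1 and the term of order [n.+1] is the integral of
   [B n], so the first [m.+1] terms leave exactly [rest m]. *)
have E m : series (fredholm_term t T k) m.+1 = 1 + \int[mu]_(s in `[t, T]) A s - \int[mu]_(s in `[t, T]) rest m s.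
  elim: m => [|m IH].
    rewrite /series/= big_nat1 fredholm_term0 -addrA -RintegralB//; last first.
      have [C HC] := rest_bounded 0; apply: (integrable_bounded_itv _ HC); exact: measurable_funTS.
    rewrite -[LHS]addr0; congr (_ + _); rewrite (_ : \int[mu]_(s in _) _ = \int[mu]_(s in `[t, T]) 0).
      by rewrite Rintegral_itvcc_cst// mul0r.
    by apply: eq_Rintegral => s _; rewrite /rest big_ord0 subr0 subrr.
  rewrite seriesSr IH fredholm_termS.
  have [C HC] := rest_bounded m.
  have Ir : mu.-integrable `[t, T] (EFin \o rest m).
    by apply: (integrable_bounded_itv _ HC); exact: measurable_funTS.
  have -> : \int[mu]_(s in `[t, T]) rest m.+1 s =
      \int[mu]_(s in `[t, T]) rest m s - \int[mu]_(s in `[t, T]) B m s.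
    rewrite -RintegralB//; last exact: IB.
    by apply: eq_Rintegral => s _; rewrite /rest big_ord_recr/= opprD addrA.
  by rewrite opprB addrA addrAC.
rewrite -(cvg_shiftS _).
have -> : [sequence series (fredholm_term t T k) m.+1]_m = (fun m => 1 + \int[mu]_(s in `[t, T]) A s - \int[mu]_(s in `[t, T]) rest m s).
  by apply/funext => m; rewrite /= E.
suff H : (fun m => \int[mu]_(s in `[t, T]) rest m s) @ \oo --> 0.
  set c := 1 + _.
  have : (fun m => c - \int[mu]_(s in `[t, T]) rest m s) @ \oo --> c - 0.
    by apply: cvgB => //; exact: cvg_cst.
  by rewrite subr0.
apply/norm_cvg0P.
apply: (@squeeze_cvgr _ _ _ _ (cst 0) (fun m => L * (T - t) * exp_coeff (Q * (T - t)) m)).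
- near=> m; rewrite normr_ge0/=.
  have -> : L * (T - t) * exp_coeff (Q * (T - t)) m =
      L * Q ^+ m * ((T - t) ^+ m / m`!%:R) * (T - t).
    by rewrite /exp_coeff/= exprMn; ring.
  apply: normr_Rintegral_itv_le => //; first exact: measurable_funTS.
  move=> s sT; apply: (le_trans (rest_le m sT)).
  rewrite ler_wpM2l ?mulr_ge0 ?exprn_ge0// ler_wpM2r ?invr_ge0// lerXn2r ?nnegrE//; lra.
- exact: cvg_cst.
- have : (fun m => L * (T - t) * exp_coeff (Q * (T - t)) m) @ \oo --> L * (T - t) * 0.
    apply: cvgM; first exact: cvg_cst.
    exact: (cvg_series_cvg_0 (is_cvg_series_exp_coeff (Q * (T - t)))).
  by rewrite mulr0.
Unshelve. all: end_near.
Qed.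

End FredholmSeries.

(** * Rules of differentiation in pointwise form *)

Section PointwiseDerivatives.
Context {R : realType}.
Implicit Types (f g : R -> R) (x df dg k : R).

Lemma is_deriveM_pt f g x df dg : is_derive x 1 f df -> is_derive x 1 g dg ->
  is_derive x 1 (fun y => f y * g y) (df * g x + f x * dg).
Proof.
move=> Hf Hg; have := @is_deriveM _ _ f g x 1 df dg Hf Hg.
by move/is_derive_eq; apply; rewrite addrC /GRing.scale/= [g x * _]mulrC.
Qed.

Lemma is_deriveD_pt f g x df dg : is_derive x 1 f df -> is_derive x 1 g dg ->
  is_derive x 1 (fun y => f y + g y) (df + dg).
Proof. by move=> Hf Hg; exact: (@is_deriveD _ _ _ f g x 1 df dg Hf Hg). Qed.

Lemma is_deriveB_pt f g x df dg : is_derive x 1 f df -> is_derive x 1 g dg ->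
  is_derive x 1 (fun y => f y - g y) (df - dg).
Proof. by move=> Hf Hg; exact: (@is_deriveB _ _ _ f g x 1 df dg Hf Hg). Qed.

Lemma is_deriveZ_pt k f x df : is_derive x 1 f df ->
  is_derive x 1 (fun y => k * f y) (k * df).
Proof. by move=> Hf; exact: (@is_deriveZ _ _ _ f k x 1 df Hf). Qed.

Lemma is_derive_affine f k l x df : is_derive (k * x + l) 1 f df ->
  is_derive x 1 (fun y => f (k * y + l)) (k * df).
Proof.
move=> Hf.
have H : is_derive x 1 (fun y : R => k * y + l) k.
  have := is_deriveD_pt (is_deriveZ_pt k (is_derive_id x 1)) (is_derive_cst l x 1).
  by rewrite mulr1 addr0.
have := @is_derive1_comp _ f (fun y => k * y + l) x df k Hf H.
by move/is_derive_eq; apply; rewrite mulrC.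
Qed.

Lemma is_derive_expRM k x : is_derive x 1 (fun y => expR (k * y)) (k * expR (k * x)).
Proof.
have := @is_derive_affine expR k 0 x (expR (k * x + 0)) (is_derive_expR _).
rewrite addr0; congr is_derive.
by apply/funext => y; rewrite addr0.
Qed.

Lemma is_derive_continuous f f' : (forall x : R, is_derive x 1 f (f' x)) -> continuous f.
Proof.
by move=> df x; apply/differentiable_continuous/derivable1_diffP; have [] := df x.
Qed.

Lemma continuous_itv_bounded f (a b : R) : {within `[a, b], continuous f} ->
  exists K : R, forall x : R, a <= x <= b -> `|f x| <= K.
Proof.
move=> cf; have [ab|ba] := leP a b; last first.
  by exists 0 => x /andP[ax xb]; have := lt_le_trans ba (le_trans ax xb); rewrite ltxx.
have cnf : {within `[a, b], continuous (fun x => `|f x|)}.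
  by move=> x; apply: continuous_comp; [exact: cf|exact: norm_continuous].
have [c _ fc] := EVT_max ab cnf.
by exists `|f c| => x xab; apply: fc; rewrite in_itv.
Qed.

End PointwiseDerivatives.

(** * The Fredholm determinant of the bond kernel *)

Section BondFunctions.
Context {R : realType}.
Variables a c : R.
Hypotheses (a_gt0 : 0 < a) (c_gt0 : 0 < c).

(** The characteristic roots of the linear system for (p, q) are [- a / 2 + w] and [- a / 2 - w].
    Twice [w] is the constant sqrt(a^2 + 2 c^2) of the Cox-Ingersoll-Ross bond formula. *)
Definition bond_freq : R := Num.sqrt (a ^+ 2 / 4 + c ^+ 2 / 2).
Local Notation w := bond_freq.

(** [bond_num] and [bond_den] are p and q in closed form, named after their places in the quotient p
    / q. *)
Definition bond_num (x : R) :=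
  (expR ((w - a / 2) * x) - expR (- (w + a / 2) * x)) / (2 * w).

Definition bond_den (x : R) :=
  ((w + a / 2) * expR ((w - a / 2) * x) + (w - a / 2) * expR (- (w + a / 2) * x))
  / (2 * w).

Lemma sqr_bond_freq : w ^+ 2 = a ^+ 2 / 4 + c ^+ 2 / 2.
Proof. by rewrite sqr_sqrtr// addr_ge0// divr_ge0 ?sqr_ge0. Qed.

Lemma bond_freq_gt : a / 2 < w.
Proof.
have -> : a / 2 = Num.sqrt (a ^+ 2 / 4).
  have -> : a ^+ 2 / 4 = (a / 2) ^+ 2 by field.
  by rewrite sqrtr_sqr ger0_norm// divr_ge0// ltW.
rewrite ltr_sqrt ?ltrDl; first by rewrite divr_gt0// exprn_gt0.
by rewrite addr_gt0// divr_gt0// exprn_gt0.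
Qed.

Lemma bond_freq_gt0 : 0 < w.
Proof. by apply: lt_trans bond_freq_gt; rewrite divr_gt0. Qed.

Let w2 : 2 * w != 0.
Proof. by rewrite mulf_neq0// gt_eqF// bond_freq_gt0. Qed.

Lemma bond_num0 : bond_num 0 = 0.
Proof. by rewrite /bond_num !mulr0 subrr mul0r. Qed.

Lemma bond_den0 : bond_den 0 = 1.
Proof.
rewrite /bond_den !mulr0 expR0 !mulr1.
by rewrite (_ : w + a / 2 + (w - a / 2) = 2 * w) ?divff//; ring.
Qed.

Lemma bond_num_ge0 x : 0 <= x -> 0 <= bond_num x.
Proof.
move=> x0; rewrite /bond_num divr_ge0//; last first.
  by rewrite mulr_ge0// ltW// bond_freq_gt0.
rewrite subr_ge0 ler_expR ler_wpM2r//.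
by have := bond_freq_gt; have := a_gt0; lra.
Qed.

Lemma bond_den_gt0 x : 0 < bond_den x.
Proof.
have := bond_freq_gt; have := a_gt0 => h1 h2.
rewrite /bond_den divr_gt0//; last by rewrite mulr_gt0// bond_freq_gt0.
by rewrite addr_gt0// mulr_gt0 ?expR_gt0//; lra.
Qed.

Lemma is_derive_bond_num (x : R) :
  is_derive x 1 bond_num (- a * bond_num x + bond_den x).
Proof.
have := is_deriveZ_pt (2 * w)^-1 (is_deriveB_pt
  (is_derive_expRM (w - a / 2) x) (is_derive_expRM (- (w + a / 2)) x)).
rewrite (_ : (fun y => _) = bond_num); last first.
  by apply/funext => y; rewrite /bond_num mulrC.
move/is_derive_eq; apply; rewrite /bond_num /bond_den.
by field; move: w2; rewrite mulf_eq0 => /norP[].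
Qed.

Lemma is_derive_bond_den (x : R) : is_derive x 1 bond_den (c ^+ 2 / 2 * bond_num x).
Proof.
have := is_deriveZ_pt (2 * w)^-1 (is_deriveD_pt
  (is_deriveZ_pt (w + a / 2) (is_derive_expRM (w - a / 2) x))
  (is_deriveZ_pt (w - a / 2) (is_derive_expRM (- (w + a / 2)) x))).
rewrite (_ : (fun y => _) = bond_den); last first.
  by apply/funext => y; rewrite /bond_den mulrC.
move/is_derive_eq; apply; rewrite /bond_num.
have -> : c ^+ 2 / 2 = w ^+ 2 - a ^+ 2 / 4 by rewrite sqr_bond_freq; ring.
by field; move: w2; rewrite mulf_eq0 => /norP[].
Qed.

End BondFunctions.

Section BondDeterminant.
Context {R : realType}.
Notation mu := (@lebesgue_measure R).
Variables a c t T : R.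
Hypotheses (a_gt0 : 0 < a) (c_gt0 : 0 < c) (tT : t <= T).

Let k s u := 2 * bond_kernel a c T s u.
Let phi s := expR (a / 2 * s).
Let psi u := c ^+ 2 / (2 * a) * (expR (- (a / 2) * u) - expR (a / 2 * u - a * T)).

Let a0 : a != 0. Proof. by rewrite gt_eqF. Qed.

Lemma bond_kernelC s u : bond_kernel a c T s u = bond_kernel a c T u s.
Proof. by rewrite /bond_kernel distrC (addrC s). Qed.

Lemma bond_kernel_le s u : s <= u ->
  bond_kernel a c T s u = expR (a / 2 * s) *
    (c ^+ 2 / (4 * a) * (expR (- (a / 2) * u) - expR (a / 2 * u - a * T))).
Proof.
move=> su; rewrite /bond_kernel distrC ger0_norm ?subr_ge0//.
have -> : - (a / 2) * (u - s) = a / 2 * s + - (a / 2) * u by ring.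
have -> : a / 2 * (s + u - 2 * T) = a / 2 * s + (a / 2 * u - a * T) by field.
by rewrite !expRD; ring.
Qed.

Let kE s u : s <= u -> k s u = phi s * psi u.
Proof.
move=> su; rewrite /k bond_kernel_le// /phi /psi.
by field.
Qed.

(** The step kernel is [phi s ^+ 2] times a difference of two values of [psi / phi]. That quotient
    is an exponential plus a constant, so the dependence on [T] cancels and a function of [u - s]
    remains. *)
Let qE s u : kernel_step phi psi s u = c ^+ 2 / (2 * a) * (1 - expR (- a * (u - s))).
Proof.
have E x : psi x / phi x = c ^+ 2 / (2 * a) * (expR (- a * x) - expR (- a * T)).
  rewrite /psi /phi -expRN -mulrA mulrBl -!expRD.
  by congr (_ * (expR _ - expR _)); field.
have E2 x : phi x ^+ 2 = expR (a * x) by rewrite /phi expr2 -expRD; congr expR; field.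
have -> : kernel_step phi psi s u = phi s ^+ 2 * (psi s / phi s - psi u / phi u).
  by rewrite /kernel_step; field; rewrite !gt_eqF ?expR_gt0.
rewrite !E E2 -mulrBr mulrCA; congr (_ * _).
have -> : - a * (u - s) = - a * u + a * s by ring.
rewrite expRD.
have : expR (a * s) * expR (- a * s) = 1 by rewrite mulNr expRN divff// gt_eqF// expR_gt0.
move: (expR _) (expR _) (expR _) (expR _) => x y z r; move=> h.
by rewrite opprB addrA subrK mulrBr h mulrC.
Qed.

Lemma measurable_bond_kernel : measurable_fun setT (fun p : R * R => bond_kernel a c T p.1 p.2).
Proof.
rewrite /bond_kernel; apply: measurable_funM => //.
have m1 : measurable_fun setT (fun p : R * R => p.1 - p.2) by exact: measurable_funB.
have m2 : measurable_fun setT (fun p : R * R => p.1 + p.2 - 2 * T).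
  by apply: measurable_funB => //; exact: measurable_funD.
apply: measurable_funB; apply: (measurableT_comp (@measurable_expR R)).
  by apply: measurable_funM => //; exact: measurableT_comp.
exact: measurable_funM.
Qed.

Lemma normr_bond_kernel_le s u : t <= s <= T -> t <= u <= T ->
  `|bond_kernel a c T s u| <= c ^+ 2 / (4 * a).
Proof.
move=> sT uT; rewrite /bond_kernel normrM ger0_norm; last first.
  by rewrite divr_ge0 ?sqr_ge0// mulr_ge0// ltW.
rewrite ler_piMr//; first by rewrite divr_ge0 ?sqr_ge0// mulr_ge0// ltW.
have h1 : expR (- (a / 2) * `|s - u|) <= 1.
  by rewrite -[leRHS]expR0 ler_expR mulNr oppr_le0 mulr_ge0// divr_ge0// ltW.
have h2 : expR (a / 2 * (s + u - 2 * T)) <= 1.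
  rewrite -[leRHS]expR0 ler_expR mulr_ge0_le0//; first by rewrite divr_ge0// ltW.
  lra.
have := expR_ge0 (- (a / 2) * `|s - u|); have := expR_ge0 (a / 2 * (s + u - 2 * T)).
by rewrite ler_norml; lra.
Qed.

(** This is q' at [T - s], so that 1 plus the integral of [A] over [[t, T]] is q at [T - t]. *)
Let A s := c ^+ 2 / 2 * bond_num a c (T - s).

Let dA (f : R -> R) (df u : R) : is_derive (T - u) 1 f df ->
  is_derive u 1 (fun u => f (T - u)) (- df).
Proof.
have E : (fun y => f (-1 * y + T)) = (fun y => f (T - y)).
  by apply/funext => y; rewrite mulN1r addrC.
move=> H; have := @is_derive_affine _ f (-1) T u df.
by rewrite E !mulN1r addrC; apply.
Qed.

Let cA : continuous A.
Proof.
apply: (@is_derive_continuous _ A) => u; exact: (is_deriveZ_pt (c ^+ 2 / 2) (dA (is_derive_bond_num a_gt0 c_gt0 (T - u)))).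
Qed.

Let intA s : s <= T -> \int[mu]_(u in `[s, T]) A u = bond_den a c (T - s) - 1.
Proof.
have dF (u : R) : is_derive u 1 (fun u => - 1 * bond_den a c (T - u)) (A u).
  have := is_deriveZ_pt (-1) (dA (is_derive_bond_den a_gt0 c_gt0 (T - u))).
  by rewrite mulN1r opprK.
move=> sT; rewrite (Rintegral_FTC2 sT cA dF).
by rewrite subrr bond_den0//; ring.
Qed.

Let AE s : t <= s <= T ->
  A s = k s s + \int[mu]_(u in `[s, T]) (kernel_step phi psi s u * A u).
Proof.
move=> /andP[ts sT].
have de (u : R) : is_derive u 1 (fun u => expR (- a * (u - s))) (- a * expR (- a * (u - s))).
  have := is_deriveZ_pt (expR (a * s)) (is_derive_expRM (- a) u).
  have E y : expR (a * s) * expR (- a * y) = expR (- a * (y - s)).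
    by rewrite -expRD; congr expR; ring.
  by rewrite mulrCA E; congr is_derive; apply/funext.
have dn u := dA (is_derive_bond_num a_gt0 c_gt0 (T - u)).
have dd u := dA (is_derive_bond_den a_gt0 c_gt0 (T - u)).
(* Integration by parts. With e = exp(- a (u - s)), the derivative of e q(T - u) is the wanted - e
   (c^2/2) p(T - u) plus a leftover - a e q(T - u); since e p(T - u) has derivative - e q(T - u),
   subtracting a times it removes the leftover. *)
pose F u := c ^+ 2 / (2 * a) * (expR (- a * (u - s)) * bond_den a c (T - u)
  - bond_den a c (T - u) - a * (bond_num a c (T - u) * expR (- a * (u - s)))).
have dF (u : R) : is_derive u 1 F (kernel_step phi psi s u * A u).
  have := is_deriveZ_pt (c ^+ 2 / (2 * a)) (is_deriveB_pt (is_deriveB_pt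
    (is_deriveM_pt (de u) (dd u)) (dd u)) (is_deriveZ_pt a (is_deriveM_pt (dn u) (de u)))).
  by move/is_derive_eq; apply; rewrite qE /A; field.
have cf : continuous (fun u => kernel_step phi psi s u * A u).
  move=> u; apply: cvgM; last exact: cA.
  move: u; rewrite (_ : kernel_step phi psi s =
    fun u => c ^+ 2 / (2 * a) * (1 - expR (- a * (u - s)))); last exact/funext/qE.
  move=> u; apply: cvgM; first exact: cvg_cst.
  by apply: cvgB; [exact: cvg_cst|exact: (is_derive_continuous de)].
rewrite (Rintegral_FTC2 sT cf dF) /F !subrr bond_num0 bond_den0// mulr0 expR0.
rewrite /k /bond_kernel subrr normr0 mulr0 expR0 /A.
have -> : a / 2 * (s + s - 2 * T) = - a * (T - s) by field.
by field.
Qed.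

Lemma fredholm_series_bond_kernel :
  series (fredholm_term t T (fun s u => 2 * bond_kernel a c T s u)) @ \oo -->
  bond_den a c (T - t).
Proof.
have [L AL] := continuous_itv_bounded (continuous_subspaceT (A := `[t, T]) cA).
have := @fredholm_series_cvg _ k phi psi t T tT _ kE _ _ (c ^+ 2 / (2 * a)) _ _
  (c ^+ 2 / (2 * a)) _ A _ L AL AE.
rewrite intA// addrC subrK; apply.
- by move=> s; rewrite gt_eqF// expR_gt0.
- by move=> s u; rewrite /k bond_kernelC.
- by apply: measurable_funM => //; exact: measurable_bond_kernel.
- move=> s u sT uT; rewrite /k normrM ger0_norm//.
  apply: le_trans (ler_wpM2l _ (normr_bond_kernel_le sT uT)) _ => //.
  by rewrite le_eqVlt; apply/orP; left; apply/eqP; field.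
- under [X in measurable_fun _ X]eq_fun do rewrite qE.
  apply: measurable_funM => //; apply: measurable_funB => //.
  apply: (measurableT_comp (@measurable_expR R)).
  by apply: measurable_funM => //; exact: measurable_funB.
- move=> s u ts su uT; rewrite qE normrM ger0_norm; last first.
    by rewrite divr_ge0 ?sqr_ge0// mulr_ge0// ltW.
  rewrite ler_piMr//; first by rewrite divr_ge0 ?sqr_ge0// mulr_ge0// ltW.
  have h1 : expR (- a * (u - s)) <= 1.
    by rewrite -[leRHS]expR0 ler_expR mulNr oppr_le0 mulr_ge0// ?subr_ge0// ltW.
  by have := expR_ge0 (- a * (u - s)); rewrite ler_norml; lra.
- exact: continuous_measurable_fun.
Qed.

End BondDeterminant.

(** * Resolvent kernels *)

Section ResolventKernels.
Context {R : realType}.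
Notation mu := (@lebesgue_measure R).
Variables t T : R.
Local Notation D := (`[t, T]%classic).
Implicit Types (f g : R -> R) (K M : R -> R -> R).

Lemma lebesgue_aeS (P Q : R -> Prop) : (forall x, P x -> Q x) ->
  {ae mu, forall x, P x} -> {ae mu, forall x, Q x}.
Proof. exact: (@filterS _ _ (ae_filter_ringOfSetsType mu) P Q). Qed.

Definition integrable_on f := measurable_fun D f /\ mu.-integrable D (EFin \o f).

(** The bound is confined to the square because the kernels in use grow exponentially outside it;
    measurability on the whole plane lets parametric integrals be formed directly. *)
Definition bounded_kernel K := measurable_fun setT (fun p : R * R => K p.1 p.2) /\
  exists B : R, forall s u, t <= s <= T -> t <= u <= T -> `|K s u| <= B.

Lemma bounded_kernelT K : bounded_kernel K -> bounded_kernel (fun s u => K u s).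
Proof.
move=> [mK [B KB]]; split; last by exists B => s u sT uT; exact: KB.
apply: (measurableT_comp mK (g := fun p : R * R => (p.2, p.1))).
exact: measurable_fun_pair.
Qed.

Lemma bounded_kernel_section K s : bounded_kernel K -> measurable_fun setT (K s).
Proof.
move=> [mK _]; apply: (measurableT_comp mK (g := fun u : R => (s, u))).
exact: measurable_fun_pair.
Qed.

Lemma L2_integrable_on f : L2 t T f -> integrable_on f.
Proof.
move=> [mf If]; split => //.
have I1 : mu.-integrable D (EFin \o (fun x => 1 + f x ^+ 2)).
  under [EFin \o _]eq_fun do rewrite /= EFinD.
  apply: integrableD => //; apply: (@integrable_bounded_itv _ _ _ (cst 1) 1) => //.
  by move=> x _; rewrite normr1.
apply: le_integrable I1 => //; first exact/measurable_EFinP.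
move=> x _; rewrite /= lee_fin [leRHS]ger0_norm; last by rewrite addr_ge0// sqr_ge0.
rewrite -[f x ^+ 2]real_normK ?num_real//.
have := sqr_ge0 (`|f x| - 1); have := normr_ge0 (f x).
by move: `|f x| => y; rewrite sqrrB1; nra.
Qed.

Lemma bounded_L2 f B : measurable_fun D f -> (forall s, t <= s <= T -> `|f s| <= B) ->
  L2 t T f.
Proof.
move=> mf fB; split => //.
apply: (@integrable_bounded_itv _ _ _ _ (B ^+ 2)).
  by apply: measurable_funX.
move=> x xT; rewrite normrX lerXn2r ?nnegrE//; last exact: fB.
exact: le_trans (fB _ xT).
Qed.

Lemma L2D f g : L2 t T f -> L2 t T g -> L2 t T (fun s => f s + g s).
Proof.
move=> [mf If] [mg Ig]; split; first exact: measurable_funD.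
have I1 : mu.-integrable D (EFin \o (fun x => 2 * (f x ^+ 2) + 2 * (g x ^+ 2))).
  under [EFin \o _]eq_fun do rewrite /= EFinD.
  by apply: integrableD => //; exact: integrable_itvZl.
apply: le_integrable I1 => //.
  by apply/measurable_EFinP; apply: measurable_funX; exact: measurable_funD.
move=> x _; rewrite /= lee_fin (ger0_norm (sqr_ge0 _)) [leRHS]ger0_norm; last first.
  by apply: addr_ge0; apply: mulr_ge0 => //; exact: sqr_ge0.
have := sqr_ge0 (f x - g x); move: (f x) (g x) => y z; nra.
Qed.

Lemma L2Z k f : L2 t T f -> L2 t T (fun s => k * f s).
Proof.
move=> [mf If]; split; first exact: measurable_funM.
by have := integrable_itvZl (k ^+ 2) If; apply: eq_integrable => // x _; rewrite /= exprMn.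
Qed.

Lemma integral_op_integrable K f s : bounded_kernel K -> integrable_on f -> t <= s <= T ->
  mu.-integrable D (EFin \o (fun u => K s u * f u)).
Proof.
move=> bK [mf If] sT; have mKs := bounded_kernel_section s bK.
case: bK => _ [B KB].
apply: le_integrable (integrable_itvZl B (integrable_itv_norm If)) => //.
  by apply/measurable_EFinP; apply: measurable_funM => //; exact: measurable_funTS.
move=> u /=; rewrite in_itv/= => uT; rewrite lee_fin !normrM normr_id.
by rewrite ler_wpM2r// (le_trans (KB _ _ sT uT))// ler_norm.
Qed.

Lemma integrable_on_restrict f : integrable_on f -> measurable_fun setT (f \_ D).
Proof. by move=> [mf _]; apply/(measurable_restrictT _ _).1. Qed.

Lemma integral_op_restrict K f s : integral_op t T K (f \_ D) s = integral_op t T K f s.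
Proof. by apply: eq_Rintegral => u uD; rewrite patchE uD. Qed.

Lemma measurable_integral_op K f : bounded_kernel K -> integrable_on f ->
  measurable_fun setT (integral_op t T K f).
Proof.
move=> [mK _] If.
rewrite (_ : integral_op t T K f = integral_op t T K (f \_ D)); last first.
  by apply/funext => s; rewrite integral_op_restrict.
apply: (@measurable_Rintegral_itv _ _ _ (cst t) (cst T)
  (fun p => K p.1 p.2 * (f \_ D) p.2)) => //.
apply: measurable_funM => //.
exact: (measurableT_comp (integrable_on_restrict If) measurable_snd).
Qed.

(** The image is even bounded, by [B] times the integral of [|f|]. *)
Lemma integral_op_L2 K f : bounded_kernel K -> integrable_on f ->
  L2 t T (integral_op t T K f).
Proof.
move=> bK If; case: (bK) => _ [B KB].
apply: (@bounded_L2 _ (B * \int[mu]_(u in D) `|f u|)).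
  by apply: measurable_funTS; exact: measurable_integral_op.
move=> s sT; have IK := integral_op_integrable bK If sT.
apply: (le_trans (le_normr_Rintegral _ IK)) => //.
have I1 := integrable_itv_norm If.2.
rewrite -Rintegral_itvZl//; apply: le_Rintegral => //.
- exact: integrable_itv_norm IK.
- exact: integrable_itvZl.
- by move=> u /=; rewrite in_itv/= => uT; rewrite normrM ler_wpM2r// KB.
Qed.

Lemma integral_opD K f g k s : bounded_kernel K -> integrable_on f -> integrable_on g ->
  t <= s <= T -> integral_op t T K (fun u => f u + k * g u) s =
    integral_op t T K f s + k * integral_op t T K g s.
Proof.
move=> bK If Ig sT; rewrite /integral_op.
have I1 := integral_op_integrable bK If sT.
have I2 := integral_op_integrable bK Ig sT.
rewrite -(Rintegral_itvZl k I2) -RintegralD//; last exact: integrable_itvZl.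
by apply: eq_Rintegral => u _; rewrite mulrDr mulrCA.
Qed.

(** Fubini, with the integrand bounded by [A * B * |f v|]. As [f] is measurable on [[t, T]] only, it
    is first extended by 0. *)
Lemma integral_op_comp K M f s : bounded_kernel K -> bounded_kernel M ->
  integrable_on f -> t <= s <= T ->
  integral_op t T K (integral_op t T M f) s =
  integral_op t T (fun s v => \int[mu]_(u in D) (K s u * M u v)) f s.
Proof.
move=> bK bM If sT; pose f' := f \_ D.
have mf' := integrable_on_restrict If.
case: (bK) => mK [A KA]; case: (bM) => mM [B MB].
have mKs := bounded_kernel_section s bK.
transitivity (\int[mu]_(u in D) \int[mu]_(v in D) (K s u * (M u v * f' v))).
  apply: eq_Rintegral => u; rewrite mem_itvccE => uT.
  rewrite -(Rintegral_itvZl _ (integral_op_integrable bM If uT)).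
  by apply: eq_Rintegral => v vD; rewrite /f' patchE vD.
rewrite (@Rintegral_Fubini _ t T (fun p => K s p.1 * (M p.1 p.2 * f' p.2))
  (fun v => A * B * `|f v|)).
- apply: eq_Rintegral => v vD; move: (vD); rewrite mem_itvccE => vT.
  have := @Rintegral_itvZl _ t T (f v) (fun u => K s u * M u v).
  rewrite mulrC => <-.
    by apply: eq_Rintegral => u _; rewrite /f' patchE vD; ring.
  apply: (@integrable_bounded_itv _ _ _ _ (A * B)).
    apply: measurable_funTS; apply: measurable_funM => //.
    exact: (bounded_kernel_section v (bounded_kernelT bM)).
  by move=> u uT; rewrite normrM ler_pM// ?KA ?MB.
- apply: measurable_funM; first exact: (measurableT_comp mKs measurable_fst).
  apply: measurable_funM => //; exact: (measurableT_comp mf' measurable_snd).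
- exact: (integrable_itvZl (A * B) (integrable_itv_norm If.2)).
- move=> u v uT vT; rewrite /f' patchE mem_itvccE vT !normrM -mulrA.
  by rewrite ler_pM ?mulr_ge0// ?KA// ler_wpM2r// MB.
Qed.

(** Integrals ignore null sets, so the values agree at every [s]; this turns equalities in L^2 into
    pointwise ones. *)
Lemma eqL2_integral_op K f g s : bounded_kernel K -> integrable_on f -> integrable_on g ->
  eqL2 t T f g -> integral_op t T K f s = integral_op t T K g s.
Proof.
move=> bK [mf If] [mg Ig] fg; have mKs := bounded_kernel_section s bK.
rewrite /integral_op /Rintegral; congr fine; apply: ae_eq_integral => //.
- by apply/measurable_EFinP; apply: measurable_funM => //; exact: measurable_funTS.
- by apply/measurable_EFinP; apply: measurable_funM => //; exact: measurable_funTS.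
- by apply: lebesgue_aeS fg => u fgu uD; rewrite fgu.
Qed.

(* The resolvent identities below say that [1 - 2 M] is the inverse of
   [1 + 2 K]. *)
Lemma is_resolvent_kernelI K M : bounded_kernel K -> bounded_kernel M ->
  {within `[t, T] `*` `[t, T], continuous (fun p : R * R => M p.1 p.2)} ->
  (forall s v, t <= s <= T -> t <= v <= T ->
    \int[mu]_(u in D) (K s u * M u v) = (K s v - M s v) / 2) ->
  (forall s v, t <= s <= T -> t <= v <= T ->
    \int[mu]_(u in D) (M s u * K u v) = (K s v - M s v) / 2) ->
  is_resolvent_kernel t T K M.
Proof.
move=> bK bM cM KM MK.
have opE (k : R -> R -> R) f s : (forall v, t <= v <= T -> k s v = (K s v - M s v) / 2) ->
    integrable_on f -> t <= s <= T ->
    integral_op t T k f s = (integral_op t T K f s - integral_op t T M f s) / 2.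
  move=> kE If sT.
  have I1 := integral_op_integrable bK If sT.
  have I2 := integral_op_integrable bM If sT.
  rewrite /integral_op -RintegralB// mulrC -Rintegral_itvZl; last first.
    by under [EFin \o _]eq_fun do rewrite /= EFinB; exact: integrableB.
  by apply: eq_Rintegral => v; rewrite mem_itvccE => vT; rewrite kE//; ring.
have opKM f s : integrable_on f -> t <= s <= T ->
    integral_op t T K (integral_op t T M f) s =
    (integral_op t T K f s - integral_op t T M f s) / 2.
  by move=> If sT; rewrite integral_op_comp// opE// => v vT; rewrite KM.
have opMK f s : integrable_on f -> t <= s <= T ->
    integral_op t T M (integral_op t T K f) s =
    (integral_op t T K f s - integral_op t T M f s) / 2.
  by move=> If sT; rewrite integral_op_comp// opE// => v vT; rewrite MK.
have L2A f : L2 t T f -> L2 t T (one_plus_two t T K f).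
  move=> Lf; apply: L2D => //; apply: L2Z; apply: integral_op_L2 => //.
  exact: L2_integrable_on.
have opMA f s : L2 t T f -> t <= s <= T ->
    integral_op t T M (one_plus_two t T K f) s = integral_op t T K f s.
  move=> Lf sT; have If := L2_integrable_on Lf.
  rewrite /one_plus_two integral_opD//; last first.
    by apply: L2_integrable_on; exact: integral_op_L2.
  by rewrite opMK//; field.
split => //.
- split => //.
  + move=> f Lf; have If := L2_integrable_on Lf.
    exists (fun s => f s + -2 * integral_op t T M f s).
      by apply: L2D => //; apply: L2Z; exact: integral_op_L2.
    apply: aeW => s; rewrite in_itv/= => sT; rewrite /one_plus_two integral_opD//; last first.
      by apply: L2_integrable_on; exact: integral_op_L2.
    by rewrite opKM//; field.
  + move=> f g Lf Lg fg.
    have E s : t <= s <= T -> integral_op t T K f s = integral_op t T K g s.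
      move=> sT; rewrite -(opMA _ _ Lf sT) -(opMA _ _ Lg sT); apply: eqL2_integral_op => //.
        by apply: L2_integrable_on; exact: L2A.
      by apply: L2_integrable_on; exact: L2A.
    apply: lebesgue_aeS fg => s fgs sT; have := fgs sT; rewrite /one_plus_two E.
      exact: addIr.
    by rewrite in_itv/= in sT.
- move=> f g Lf Lg gf; apply: aeW => s; rewrite in_itv/= => sT.
  rewrite -(opMA _ _ Lg sT); apply: eqL2_integral_op => //; first exact: L2_integrable_on.
    by apply: L2_integrable_on; exact: L2A.
  by apply: lebesgue_aeS gf => u guf uT; rewrite guf.
Qed.

End ResolventKernels.

(** * Uniqueness of the resolvent kernel at the corner *)

Section ResolventUniqueness.
Context {R : realType}.
Notation mu := (@lebesgue_measure R).
Variables t T : R.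
Hypothesis tT : t < T.
Local Notation D := (`[t, T]%classic).

Lemma within_continuous_section (M : R -> R -> R) s :
  {within `[t, T] `*` `[t, T], continuous (fun p : R * R => M p.1 p.2)} ->
  t <= s <= T -> {within `[t, T], continuous (M s)}.
Proof.
move=> /subspace_continuousP cM sT; apply/subspace_continuousP => u uT.
have cMu := cM (s, u) (conj _ uT).
have /cMu H : `[t, T]%classic s by rewrite /= in_itv.
apply: (cvg_comp (fun u => (s, u)) (fun p => M p.1 p.2) _ H).
move=> A [[A1 A2] [/= nA1 nA2] A12].
change (nbhs u (fun v => `[t, T]%classic v -> A (s, v))).
apply: filterS nA2 => v A2v vT; apply: (A12 (s, v)) => //.
by split => //=; exact: nbhs_singleton nA1.
Qed.

(** Two resolvent kernels define the same operator. If [M t t] exceeded [M' t t], continuity would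
    keep [M - M'] above a positive constant on a small square at (t, t); applied to the indicator of
    its side, the operators would then differ at every point of that side, a set of positive
    measure. *)
Let resolvent_kernel_le (K M M' : R -> R -> R) :
  is_resolvent_kernel t T K M -> is_resolvent_kernel t T K M' -> M t t <= M' t t.
Proof.
move=> [[_ surj _] cM MK] [_ cM' MK']; rewrite leNgt; apply/negP => lt_M'M.
(* A third of the gap: each kernel moves by less than [e] on the square, and [e] is left between
   them. *)
pose e := (M t t - M' t t) / 3.
have e0 : 0 < e by rewrite divr_gt0// subr_gt0.
have tD : `[t, T]%classic t by rewrite /= in_itv/= lexx ltW.
have near_diag (N : R -> R -> R) :
    {within `[t, T] `*` `[t, T], continuous (fun p : R * R => N p.1 p.2)} ->
    exists2 r : R, 0 < r & forall s u, t <= s <= T -> t <= u <= T -> s < t + r -> u < t + r ->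
      `|N t t - N s u| < e.
  move=> /subspace_continuousP /(_ (t, t) (conj tD tD)) /cvgrPdist_lt /(_ _ e0).
  move=> [[A1 A2] [/= /nbhs_ballP[r1 /= r10 B1] /nbhs_ballP[r2 /= r20 B2]] A12].
  exists (Num.min r1 r2); first by rewrite lt_min r10.
  move=> s u sT uT; rewrite -!ltrBlDl !lt_min => /andP[s1 _] /andP[_ u2].
  apply: (A12 (s, u)); last by split; rewrite /= in_itv.
  case/andP: sT => ts _; case/andP: uT => tu _.
  split => /=.
    by apply: B1; rewrite /ball/= distrC ger0_norm// subr_ge0.
  by apply: B2; rewrite /ball/= distrC ger0_norm// subr_ge0.
have [r1 r10 H1] := near_diag _ cM.
have [r2 r20 H2] := near_diag _ cM'.
(* Halving keeps the closed interval [[t, t + r]] strictly within both radii; the minimum with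
   [T - t] keeps it inside [[t, T]]. *)
pose r := Num.min (Num.min (r1 / 2) (r2 / 2)) (T - t).
have r0 : 0 < r by rewrite !lt_min !divr_gt0//= subr_gt0.
have rT : t + r <= T by rewrite -lerBrDl /r ge_min lexx orbT.
have rr1 : r < r1.
  by apply: (@le_lt_trans _ _ (r1 / 2)); [rewrite /r !ge_min lexx|lra].
have rr2 : r < r2.
  by apply: (@le_lt_trans _ _ (r2 / 2)); [rewrite /r !ge_min lexx orbT|lra].
have posN s u : t <= s <= t + r -> t <= u <= t + r -> e <= M s u - M' s u.
  move=> /andP[ts sr] /andP[tu ur].
  have sT : t <= s <= T by rewrite ts (le_trans sr).
  have uT : t <= u <= T by rewrite tu (le_trans ur).
  have := H1 s u sT uT; have := H2 s u sT uT.
  have s1 : s < t + r1 by rewrite (le_lt_trans sr)// ltrD2l.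
  have u1 : u < t + r1 by rewrite (le_lt_trans ur)// ltrD2l.
  have s2 : s < t + r2 by rewrite (le_lt_trans sr)// ltrD2l.
  have u2 : u < t + r2 by rewrite (le_lt_trans ur)// ltrD2l.
  move=> /(_ s2 u2) + /(_ s1 u1).
  rewrite !ltr_norml /e; lra.
pose f (u : R) : R := if u <= t + r then 1 else 0.
have Lf : L2 t T f.
  apply: (@bounded_L2 _ _ _ _ 1).
    by apply: measurable_funTS; apply: measurable_fun_ifT => //; exact: measurable_fun_ler.
  by move=> u _; rewrite /f; case: ifP; rewrite ?normr1// normr0.
(* The resolvent equations speak of [f] only as an image under 1 + 2 K; with [g] its preimage, both
   kernels map [f] to [K g] almost everywhere. *)
have [g Lg gf] := surj f Lf.
have opE (N : R -> R -> R) s : integral_op t T N f s = \int[mu]_(u in `[t, t + r]) N s u.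
  rewrite /integral_op !Rintegral_itv_indic; apply: eq_Rintegral => u _; rewrite /f.
  have [ur|ur] := leP u (t + r); last by rewrite mulr0 andbF; case: ifP.
  by rewrite mulr1 andbT (le_trans ur rT) andbT.
have posI s : t <= s <= t + r -> integral_op t T M f s != integral_op t T M' f s.
  move=> sr; rewrite !opE -subr_eq0; have sT : t <= s <= T.
    by case/andP: sr => -> sr; rewrite (le_trans sr).
  have sub : `[t, t + r] `<=` `[t, T].
    by move=> x; rewrite /= !in_itv/= => /andP[-> xr]; rewrite (le_trans xr).
  have I (N : R -> R -> R) :
      {within `[t, T] `*` `[t, T], continuous (fun p : R * R => N p.1 p.2)} ->
      mu.-integrable `[t, t + r] (EFin \o N s).
    move=> cN; apply: integrable_continuous_itv.
    by apply: (continuous_subspaceW sub); exact: within_continuous_section.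
  have IM := I _ cM; have IM' := I _ cM'.
  rewrite -RintegralB// gt_eqF//.
  apply: (@lt_le_trans _ _ (\int[mu]_(u in `[t, t + r]) e)).
    by rewrite Rintegral_itvcc_cst ?mulr_gt0//; lra.
  apply: le_Rintegral => //.
  - apply: (@integrable_bounded_itv _ _ _ _ `|e|) => //.
  - by under [EFin \o _]eq_fun do rewrite /= EFinB; exact: integrableB.
  - by move=> u; rewrite /= in_itv/=; exact: posN.
have : {ae mu, forall s, ~ (t <= s <= t + r)}.
  have := @filterS2 _ _ (ae_filter_ringOfSetsType mu) _ _ _ _ (MK f g Lf Lg gf) (MK' f g Lf Lg gf).
  apply => s h1 h2 sr; have sT : s \in `[t, T].
    by rewrite in_itv/=; case/andP: sr => -> sr; rewrite (le_trans sr).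
  by have := posI s sr; rewrite (h1 sT) (h2 sT) eqxx.
case=> A [mA A0 sA].
pose I := `[t, t + r]%classic.
have : (mu I <= mu A)%E.
  apply: le_measure; rewrite ?inE//; first exact: measurable_itv.
  by move=> s; rewrite /I /= in_itv/= => sr; apply: sA => /=.
by rewrite A0 /I /= lebesgue_measure_itv/= lte_fin ltrDl r0 -EFinB addrC addKr lee_fin leNgt r0.
Unshelve. all: end_near.
Qed.

Lemma is_resolvent_kernel_unique (K M M' : R -> R -> R) :
  is_resolvent_kernel t T K M -> is_resolvent_kernel t T K M' -> M t t = M' t t.
Proof.
by move=> H H'; apply/le_anti/andP; split; [exact: (resolvent_kernel_le H)|exact: (resolvent_kernel_le H')].
Qed.

End ResolventUniqueness.

(** * Green functions of second-order operators *)

Section GreenKernels.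
Context {R : realType}.
Notation mu := (@lebesgue_measure R).

(** The shape of a Green function on an interval: [phi] carries the boundary condition on the left,
    [psi] the one on the right. *)
Definition separable_kernel (phi psi : R -> R) (s u : R) :=
  phi (Num.min s u) * psi (Num.max s u).

Lemma separable_kernelC phi psi s u :
  separable_kernel phi psi s u = separable_kernel phi psi u s.
Proof. by rewrite /separable_kernel minC maxC. Qed.

Lemma separable_kernel_le phi psi s u : s <= u ->
  separable_kernel phi psi s u = phi s * psi u.
Proof. by move=> su; rewrite /separable_kernel min_l// max_r. Qed.

Lemma continuous_separable_kernel phi psi : continuous phi -> continuous psi ->
  continuous (fun p : R * R => separable_kernel phi psi p.1 p.2).
Proof.
move=> cphi cpsi p; rewrite /separable_kernel.
apply: cvgM.
  apply: (@continuous_comp _ _ _ (fun p : R * R => Num.min p.1 p.2) phi); last exact: cphi.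
  by apply: continuous_min; [exact: cvg_fst|exact: cvg_snd].
apply: (@continuous_comp _ _ _ (fun p : R * R => Num.max p.1 p.2) psi); last exact: cpsi.
by apply: continuous_max; [exact: cvg_fst|exact: cvg_snd].
Qed.

Lemma continuous_separable_kernel_section phi psi s : continuous phi -> continuous psi ->
  continuous (separable_kernel phi psi s).
Proof.
move=> cphi cpsi u; rewrite /separable_kernel.
apply: cvgM.
  apply: (@continuous_comp _ _ _ (fun u : R => Num.min s u) phi); last exact: cphi.
  by apply: continuous_min; [exact: cvg_cst|exact: cvg_id].
apply: (@continuous_comp _ _ _ (fun u : R => Num.max s u) psi); last exact: cpsi.
by apply: continuous_max; [exact: cvg_cst|exact: cvg_id].
Qed.

Lemma bounded_separable_kernel t T phi psi : continuous phi -> continuous psi ->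
  bounded_kernel t T (separable_kernel phi psi).
Proof.
move=> cphi cpsi; split.
  apply: measurable_funM.
    apply: (measurableT_comp (continuous_measurable_fun cphi)
      (g := fun p : R * R => Num.min p.1 p.2)).
    exact: measurable_minr.
  apply: (measurableT_comp (continuous_measurable_fun cpsi)
    (g := fun p : R * R => Num.max p.1 p.2)).
  exact: measurable_maxr.
have [A phiA] := continuous_itv_bounded (continuous_subspaceT (A := `[t, T]) cphi).
have [B psiB] := continuous_itv_bounded (continuous_subspaceT (A := `[t, T]) cpsi).
exists (A * B) => s u sT uT; rewrite normrM ler_pM//.
  by apply: phiA; rewrite /Num.min; case: ifP.
by apply: psiB; rewrite /Num.max; case: ifP.
Qed.

Variables (t T : R).

(** Two solutions of y'' = l y with Wronskian [w]. The derivative of [separable_kernel phi psi]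
    jumps by [- w] across the diagonal, so this kernel is [w] times a Green function of - y'' + l
    y. *)
Record green_pair (phi dphi psi dpsi : R -> R) (l w : R) : Prop := GreenPair {
  green_phi : forall x : R, is_derive x 1 phi (dphi x);
  green_dphi : forall x : R, is_derive x 1 dphi (l * phi x);
  green_psi : forall x : R, is_derive x 1 psi (dpsi x);
  green_dpsi : forall x : R, is_derive x 1 dpsi (l * psi x);
  green_wronskian : forall x, dphi x * psi x - phi x * dpsi x = w }.

(* The Wronskian p q' - p' q of solutions of p'' = l1 p and q'' = l2 q has
   derivative (l2 - l1) p q. *)
Lemma Rintegral_wronskian (p dp q dq : R -> R) l1 l2 (x y : R) : x <= y ->
  (forall x : R, is_derive x 1 p (dp x)) -> (forall x : R, is_derive x 1 dp (l1 * p x)) ->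
  (forall x : R, is_derive x 1 q (dq x)) -> (forall x : R, is_derive x 1 dq (l2 * q x)) ->
  (l2 - l1) * \int[mu]_(u in `[x, y]) (p u * q u) =
  (p y * dq y - dp y * q y) - (p x * dq x - dp x * q x).
Proof.
move=> xy Dp Ddp Dq Ddq.
have cp := is_derive_continuous Dp; have cq := is_derive_continuous Dq.
have cpq : continuous (fun u => p u * q u) by move=> u; apply: cvgM; [exact: cp|exact: cq].
rewrite -Rintegral_itvZl; last first.
  by apply: integrable_continuous_itv; exact: continuous_subspaceT.
have dW (u : R) : is_derive u 1 (fun u => p u * dq u - dp u * q u) ((l2 - l1) * (p u * q u)).
  have := is_deriveB_pt (is_deriveM_pt (Dp u) (Ddq u)) (is_deriveM_pt (Ddp u) (Dq u)).
  by move/is_derive_eq; apply; ring.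
rewrite (Rintegral_FTC2 xy _ dW)// => u.
by apply: cvgM; [exact: cvg_cst|exact: cpq].
Qed.

Lemma Rintegral_wronskianZ k1 k2 (p dp q dq : R -> R) l1 l2 (x y : R) : x <= y ->
  (forall x : R, is_derive x 1 p (dp x)) -> (forall x : R, is_derive x 1 dp (l1 * p x)) ->
  (forall x : R, is_derive x 1 q (dq x)) -> (forall x : R, is_derive x 1 dq (l2 * q x)) ->
  (l2 - l1) * \int[mu]_(u in `[x, y]) ((k1 * p u) * (k2 * q u)) =
  k1 * k2 * ((p y * dq y - dp y * q y) - (p x * dq x - dp x * q x)).
Proof.
move=> xy Dp Ddp Dq Ddq; rewrite -(Rintegral_wronskian xy Dp Ddp Dq Ddq) mulrCA.
have I : mu.-integrable `[x, y] (EFin \o (fun u => p u * q u)).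
  apply: integrable_continuous_itv; apply: continuous_subspaceT => u.
  by apply: cvgM; [exact: (is_derive_continuous Dp)|exact: (is_derive_continuous Dq)].
rewrite -(Rintegral_itvZl (k1 * k2) I).
by congr (_ * _); apply: eq_Rintegral => u _; ring.
Qed.

(** Green's identity. The points [s <= v] cut [[t, T]] into three intervals, on each of which the
    integrand is a product of solutions and integrates to a difference of mixed Wronskians. Those at
    [t] and [T] vanish by the common boundary conditions; those at [s] combine to [w1] and those at
    [v] to [w2]. *)
Lemma separable_kernel_comp_le phi1 dphi1 psi1 dpsi1 phi2 dphi2 psi2 dpsi2 l1 l2 w1 w2 :
  green_pair phi1 dphi1 psi1 dpsi1 l1 w1 -> green_pair phi2 dphi2 psi2 dpsi2 l2 w2 ->
  phi1 t * dphi2 t = dphi1 t * phi2 t -> psi1 T * dpsi2 T = dpsi1 T * psi2 T ->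
  forall s v, t <= s -> s <= v -> v <= T ->
  (l2 - l1) * \int[mu]_(u in `[t, T])
    (separable_kernel phi1 psi1 s u * separable_kernel phi2 psi2 u v) =
  w2 * separable_kernel phi1 psi1 s v - w1 * separable_kernel phi2 psi2 s v.
Proof.
move=> [Dp1 Ddp1 Dq1 Ddq1 W1] [Dp2 Ddp2 Dq2 Ddq2 W2] bt bT s v ts sv vT.
have I x y : mu.-integrable `[x, y] (EFin \o (fun u =>
    separable_kernel phi1 psi1 s u * separable_kernel phi2 psi2 u v)).
  apply: integrable_continuous_itv; apply: continuous_subspaceT => u.
  have c2 : continuous (separable_kernel phi2 psi2 ^~ v).
    rewrite (_ : _ ^~ v = separable_kernel phi2 psi2 v).
      by apply: continuous_separable_kernel_section; apply: is_derive_continuous; eassumption.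
    by apply/funext => z; rewrite separable_kernelC.
  apply: cvgM.
    by apply: continuous_separable_kernel_section; apply: is_derive_continuous; eassumption.
  exact: c2.
have sT : s <= T by exact: le_trans vT.
rewrite (Rintegral_itv_split (c := s))//; last by rewrite ts.
rewrite (Rintegral_itv_split (a := s) (c := v))//; last by rewrite sv.
have E1 : (l2 - l1) * \int[mu]_(u in `[t, s]) (separable_kernel phi1 psi1 s u * separable_kernel phi2 psi2 u v) =
    psi1 s * psi2 v * (phi1 s * dphi2 s - dphi1 s * phi2 s).
  transitivity ((l2 - l1) * \int[mu]_(u in `[t, s]) ((psi1 s * phi1 u) * (psi2 v * phi2 u))).
    congr (_ * _); apply: eq_Rintegral => u; rewrite mem_itvccE => /andP[tu us].
    rewrite (separable_kernelC _ _ s) !separable_kernel_le ?(le_trans us sv)//.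
    by rewrite mulrC [psi1 s * _]mulrC [psi2 v * _]mulrC mulrC.
  by rewrite (Rintegral_wronskianZ _ _ ts Dp1 Ddp1 Dp2 Ddp2) bt subrr subr0.
have E2 : (l2 - l1) * \int[mu]_(u in `[s, v]) (separable_kernel phi1 psi1 s u * separable_kernel phi2 psi2 u v) =
    phi1 s * psi2 v * ((psi1 v * dphi2 v - dpsi1 v * phi2 v) - (psi1 s * dphi2 s - dpsi1 s * phi2 s)).
  transitivity ((l2 - l1) * \int[mu]_(u in `[s, v]) ((phi1 s * psi1 u) * (psi2 v * phi2 u))).
    congr (_ * _); apply: eq_Rintegral => u; rewrite mem_itvccE => /andP[su uv].
    by rewrite !separable_kernel_le// [psi2 v * _]mulrC.
  by rewrite (Rintegral_wronskianZ _ _ sv Dq1 Ddq1 Dp2 Ddp2).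
have E3 : (l2 - l1) * \int[mu]_(u in `[v, T]) (separable_kernel phi1 psi1 s u * separable_kernel phi2 psi2 u v) =
    - (phi1 s * phi2 v * (psi1 v * dpsi2 v - dpsi1 v * psi2 v)).
  transitivity ((l2 - l1) * \int[mu]_(u in `[v, T]) ((phi1 s * psi1 u) * (phi2 v * psi2 u))).
    congr (_ * _); apply: eq_Rintegral => u; rewrite mem_itvccE => /andP[vu uT].
    by rewrite (separable_kernelC phi2) !separable_kernel_le ?(le_trans sv).
  by rewrite (Rintegral_wronskianZ _ _ vT Dq1 Ddq1 Dq2 Ddq2) bT subrr sub0r mulrN.
rewrite 2!mulrDr E1 E2 E3 !separable_kernel_le// -(W1 s) -(W2 v).
by ring.
Qed.

(** The case [v < s] follows by exchanging the two pairs: the kernels are symmetric, and both sides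
    change sign. *)
Lemma separable_kernel_comp phi1 dphi1 psi1 dpsi1 phi2 dphi2 psi2 dpsi2 l1 l2 w1 w2 :
  green_pair phi1 dphi1 psi1 dpsi1 l1 w1 -> green_pair phi2 dphi2 psi2 dpsi2 l2 w2 ->
  phi1 t * dphi2 t = dphi1 t * phi2 t -> psi1 T * dpsi2 T = dpsi1 T * psi2 T ->
  forall s v, t <= s <= T -> t <= v <= T ->
  (l2 - l1) * \int[mu]_(u in `[t, T])
    (separable_kernel phi1 psi1 s u * separable_kernel phi2 psi2 u v) =
  w2 * separable_kernel phi1 psi1 s v - w1 * separable_kernel phi2 psi2 s v.
Proof.
move=> G1 G2 bt bT s v /andP[ts sT] /andP[tv vT].
have [sv|/ltW vs] := leP s v.
  exact: (separable_kernel_comp_le G1 G2 bt bT).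
have bt' : phi2 t * dphi1 t = dphi2 t * phi1 t by rewrite mulrC -bt mulrC.
have bT' : psi2 T * dpsi1 T = dpsi2 T * psi1 T by rewrite mulrC -bT mulrC.
have := separable_kernel_comp_le G2 G1 bt' bT' tv vs sT.
have -> : \int[mu]_(u in `[t, T])
    (separable_kernel phi2 psi2 v u * separable_kernel phi1 psi1 u s) =
  \int[mu]_(u in `[t, T])
    (separable_kernel phi1 psi1 s u * separable_kernel phi2 psi2 u v).
  apply: eq_Rintegral => u _.
  by rewrite mulrC (separable_kernelC phi1) (separable_kernelC phi2).
rewrite (separable_kernelC phi1 _ v) (separable_kernelC phi2 _ v).
lra.
Qed.

End GreenKernels.

(** * The resolvent of the bond kernel *)

Section BondResolvent.
Context {R : realType}.
Notation mu := (@lebesgue_measure R).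
Variables a c t T : R.
Hypotheses (a_gt0 : 0 < a) (c_gt0 : 0 < c) (tT : t < T).

Let a0 : a != 0. Proof. by rewrite gt_eqF. Qed.
Local Notation p := (bond_num a c).
Local Notation q := (bond_den a c).
Local Notation tau := (T - t).

Let phi1 s := expR (a / 2 * s).
Let psi1 s := c ^+ 2 / (4 * a) * (expR (- (a / 2) * s) - expR (- a * T) * expR (a / 2 * s)).
(** The functions exp(a x / 2) q(x) and exp(a x / 2) p(x) solve y'' = (a^2/4 + c^2/2) y. The former,
    started at [t], satisfies y' = (a/2) y there as [phi1] does; the latter, reflected at [T],
    vanishes there as [psi1] does. The constant [k] makes the Wronskian c^2/4, that of the first
    pair. *)
Let phi2 s := expR (a / 2 * s + - (a / 2) * t) * q (s - t).
Let k := c ^+ 2 / 4 / (expR (a / 2 * tau) * q tau).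
Let psi2 s := k * (expR (- (a / 2) * s + a / 2 * T) * p (T - s)).

Definition bond_resolvent := separable_kernel phi2 psi2.

Lemma bond_kernelE : bond_kernel a c T = separable_kernel phi1 psi1.
Proof.
have E s u : s <= u -> bond_kernel a c T s u = separable_kernel phi1 psi1 s u.
  move=> su; rewrite bond_kernel_le// separable_kernel_le// /phi1 /psi1.
  by rewrite -expRD; congr (_ * (_ * (_ - expR _))); ring.
apply/funext => s; apply/funext => u; have [|/ltW] := leP s u; first exact: E.
by rewrite bond_kernelC separable_kernelC; exact: E.
Qed.

Let dexp m l (x : R) : is_derive x 1 (fun y => expR (m * y + l)) (m * expR (m * x + l)).
Proof. exact: is_derive_affine. Qed.

Let dshift (f : R -> R) (df u : R) : is_derive (u - t) 1 f df ->
  is_derive u 1 (fun u => f (u - t)) df.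
Proof.
have E : (fun y => f (1 * y + - t)) = (fun y => f (y - t)).
  by apply/funext => y; rewrite mul1r.
move=> H; have := @is_derive_affine _ f 1 (- t) u df.
by rewrite E !mul1r; apply.
Qed.

Let drefl (f : R -> R) (df u : R) : is_derive (T - u) 1 f df ->
  is_derive u 1 (fun u => f (T - u)) (- df).
Proof.
have E : (fun y => f (-1 * y + T)) = (fun y => f (T - y)).
  by apply/funext => y; rewrite mulN1r addrC.
move=> H; have := @is_derive_affine _ f (-1) T u df.
by rewrite E !mulN1r addrC; apply.
Qed.

Let dphi1 s := a / 2 * expR (a / 2 * s).
Let dpsi1 s := c ^+ 2 / (4 * a) *
  (- (a / 2) * expR (- (a / 2) * s) - expR (- a * T) * (a / 2 * expR (a / 2 * s))).

Let green1 : green_pair phi1 dphi1 psi1 dpsi1 (a ^+ 2 / 4) (c ^+ 2 / 4).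
Proof.
split.
- by move=> x; exact: is_derive_expRM.
- move=> x; have := is_deriveZ_pt (a / 2) (is_derive_expRM (a / 2) x).
  by move/is_derive_eq; apply; rewrite /phi1; field.
- move=> x; exact: (is_deriveZ_pt _ (is_deriveB_pt (is_derive_expRM _ x)
    (is_deriveZ_pt _ (is_derive_expRM _ x)))).
- move=> x; have := is_deriveZ_pt (c ^+ 2 / (4 * a)) (is_deriveB_pt
    (is_deriveZ_pt (- (a / 2)) (is_derive_expRM (- (a / 2)) x))
    (is_deriveZ_pt (expR (- a * T)) (is_deriveZ_pt (a / 2) (is_derive_expRM (a / 2) x)))).
  by move/is_derive_eq; apply; rewrite /psi1; field.
- move=> x; rewrite /dphi1 /psi1 /phi1 /dpsi1.
  have : expR (a / 2 * x) * expR (- (a / 2) * x) = 1.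
    by rewrite -expRD -[RHS]expR0; congr expR; ring.
  move: (expR _) (expR _) (expR _) => x1 x2 x3 h.
  transitivity (c ^+ 2 / 4 * (x3 * x2)); last by rewrite h mulr1.
  by field.
Qed.

Let dphi2 s := expR (a / 2 * s + - (a / 2) * t) *
  (a / 2 * q (s - t) + c ^+ 2 / 2 * p (s - t)).
Let dpsi2 s := k * (expR (- (a / 2) * s + a / 2 * T) * (a / 2 * p (T - s) - q (T - s))).

Let q_neq0 x : q x != 0.
Proof. by rewrite gt_eqF// bond_den_gt0. Qed.

Let phi2D (x : R) : is_derive x 1 phi2 (dphi2 x).
Proof.
have dq := dshift (is_derive_bond_den a_gt0 c_gt0 (x - t)).
have := is_deriveM_pt (dexp (a / 2) (- (a / 2) * t) x) dq.
by move/is_derive_eq; apply; rewrite /dphi2; ring.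
Qed.

Let dphi2D (x : R) : is_derive x 1 dphi2 ((a ^+ 2 / 4 + c ^+ 2 / 2) * phi2 x).
Proof.
have dq := dshift (is_derive_bond_den a_gt0 c_gt0 (x - t)).
have dp := dshift (is_derive_bond_num a_gt0 c_gt0 (x - t)).
have := is_deriveM_pt (dexp (a / 2) (- (a / 2) * t) x)
  (is_deriveD_pt (is_deriveZ_pt (a / 2) dq) (is_deriveZ_pt (c ^+ 2 / 2) dp)).
by move/is_derive_eq; apply; rewrite /phi2; field.
Qed.

Let psi2D (x : R) : is_derive x 1 psi2 (dpsi2 x).
Proof.
have dp := drefl (is_derive_bond_num a_gt0 c_gt0 (T - x)).
have := is_deriveZ_pt k (is_deriveM_pt (dexp (- (a / 2)) (a / 2 * T) x) dp).
by move/is_derive_eq; apply; rewrite /dpsi2; field.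
Qed.

Let dpsi2D (x : R) : is_derive x 1 dpsi2 ((a ^+ 2 / 4 + c ^+ 2 / 2) * psi2 x).
Proof.
have dq := drefl (is_derive_bond_den a_gt0 c_gt0 (T - x)).
have dp := drefl (is_derive_bond_num a_gt0 c_gt0 (T - x)).
have := is_deriveZ_pt k (is_deriveM_pt (dexp (- (a / 2)) (a / 2 * T) x)
  (is_deriveB_pt (is_deriveZ_pt (a / 2) dp) dq)).
by move/is_derive_eq; apply; rewrite /psi2; field.
Qed.

(* The Wronskian is constant, so it is computed at t. *)
Let wronskian2 x : dphi2 x * psi2 x - phi2 x * dpsi2 x = c ^+ 2 / 4.
Proof.
have D (y : R) : is_derive y 1 (fun y => dphi2 y * psi2 y - phi2 y * dpsi2 y) 0.
  have := is_deriveB_pt (is_deriveM_pt (dphi2D y) (psi2D y)) (is_deriveM_pt (phi2D y) (dpsi2D y)).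
  by move/is_derive_eq; apply; ring.
have /= -> := is_derive_0_is_cst x t D.
rewrite /dphi2 /psi2 /phi2 /dpsi2 !subrr bond_num0 bond_den0//.
have -> : a / 2 * t + - (a / 2) * t = 0 by ring.
have -> : - (a / 2) * t + a / 2 * T = a / 2 * tau by ring.
by rewrite expR0 /k; field; rewrite q_neq0 gt_eqF// expR_gt0.
Qed.

Let green2 : green_pair phi2 dphi2 psi2 dpsi2 (a ^+ 2 / 4 + c ^+ 2 / 2) (c ^+ 2 / 4).
Proof. by split. Qed.

Let bc_t : phi1 t * dphi2 t = dphi1 t * phi2 t.
Proof. by rewrite /phi1 /dphi1 /dphi2 /phi2 subrr bond_num0 bond_den0//; ring. Qed.

Let bc_T : psi1 T * dpsi2 T = dpsi1 T * psi2 T.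
Proof.
rewrite /psi2 subrr bond_num0 !mulr0 /psi1 -expRD.
have -> : - a * T + a / 2 * T = - (a / 2) * T by field.
by rewrite subrr mulr0 mul0r.
Qed.

Lemma bond_resolvent_diag : bond_resolvent t t = c ^+ 2 / 4 * (p tau / q tau).
Proof.
rewrite /bond_resolvent separable_kernel_le// /phi2 /psi2 subrr bond_den0//.
have -> : a / 2 * t + - (a / 2) * t = 0 by ring.
have -> : - (a / 2) * t + a / 2 * T = a / 2 * tau by ring.
by rewrite expR0 /k; field; rewrite q_neq0 gt_eqF// expR_gt0.
Qed.

(** The potentials differ by c^2/2 and both Wronskians are c^2/4, so Green's identity is precisely
    the resolvent identity with its factor 1/2. The identity for the other order of composition
    follows from the symmetry of the kernels. *)
Lemma is_resolvent_kernel_bond : is_resolvent_kernel t T (bond_kernel a c T) bond_resolvent.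
Proof.
have c1 : continuous phi1 by apply: is_derive_continuous; exact: green_phi green1.
have c2 : continuous psi1 by apply: is_derive_continuous; exact: green_psi green1.
have c3 : continuous phi2 by apply: is_derive_continuous; exact: phi2D.
have c4 : continuous psi2 by apply: is_derive_continuous; exact: psi2D.
have c2n0 : c != 0 by rewrite gt_eqF.
have H s v : t <= s <= T -> t <= v <= T ->
    \int[mu]_(u in `[t, T]) (separable_kernel phi1 psi1 s u * separable_kernel phi2 psi2 u v) =
    (separable_kernel phi1 psi1 s v - separable_kernel phi2 psi2 s v) / 2.
  move=> sT vT; have := separable_kernel_comp green1 green2 bc_t bc_T sT vT.
  move: (separable_kernel _ _ s v) (separable_kernel _ _ s v) (Rintegral _ _ _) => x y I h.
  have /mulfI : c ^+ 2 / 2 != 0 by rewrite mulf_neq0// expf_neq0.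
  apply.
  have -> : c ^+ 2 / 2 * I = (a ^+ 2 / 4 + c ^+ 2 / 2 - a ^+ 2 / 4) * I by ring.
  by rewrite h; field.
rewrite bond_kernelE; apply: is_resolvent_kernelI => //.
- exact: bounded_separable_kernel.
- exact: bounded_separable_kernel.
- by apply: continuous_subspaceT; exact: continuous_separable_kernel.
- move=> s v sT vT; rewrite separable_kernelC /bond_resolvent (separable_kernelC phi2 _ s).
  apply: eq_trans (H v s vT sT); apply: eq_Rintegral => u _.
  by rewrite mulrC (separable_kernelC phi1) (separable_kernelC phi2).
Qed.

End BondResolvent.

(** * Gaussian integration of independent increments *)

Section GaussianIntegral.
Context {R : realType}.
Notation mu := (@lebesgue_measure R).

(** The Radon-Nikodym derivative of [normal_prob] and [normal_pdf] have the same integral over every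
    measurable set, hence agree almost everywhere. The bounds on [f] provide integrability. *)
Lemma ge0_integral_normal_prob (m s : R) (f : R -> R) : measurable_fun setT f ->
  (forall x, 0 <= f x <= 1) ->
  (\int[normal_prob m s]_x (f x)%:E =
   \int[mu]_x (f x * normal_pdf m s x)%:E)%E.
Proof.
move=> mf f01.
have If : (normal_prob m s).-integrable setT (EFin \o f).
  apply: (@le_integrable _ _ _ _ _ measurableT _ (EFin \o cst 1)).
  - exact/measurable_EFinP.
  - move=> x _ /=; case/andP: (f01 x) => f0 f1.
    by rewrite lee_fin normr1 ger0_norm.
  - exact: finite_measure_integrable_cst.
have dom := normal_prob_dominates m s.
rewrite -(Radon_Nikodym_change_of_variables dom measurableT If).
under [RHS]eq_integral do rewrite EFinM.
have mpdf : measurable_fun setT (EFin \o normal_pdf m s).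
  by apply/measurable_EFinP; exact: measurable_normal_pdf.
have mRN : measurable_fun setT
    (Radon_Nikodym (charge_of_finite_measure (normal_prob m s)) mu).
  by apply: (measurable_int mu); exact: Radon_Nikodym_integrable.
apply: ae_eq_integral => //.
- by apply: emeasurable_funM => //; exact/measurable_EFinP.
- by apply: emeasurable_funM => //; exact/measurable_EFinP.
- apply: ae_eqe_mul2l => /=.
  apply: integral_ae_eq => //=; first exact: Radon_Nikodym_integrable.
  by move=> E _ mE; rewrite -Radon_Nikodym_integral.
Qed.

(* Complete the square in the exponent. *)
Lemma integral_normal_prob_expR_sqr (v b y k : R) : 0 < v -> 0 <= b ->
  (\int[normal_prob 0 (Num.sqrt v)]_x (expR (- b * (y + k * x) ^+ 2))%:E =
   ((Num.sqrt (1 + 2 * b * k ^+ 2 * v))^-1 *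
     expR (- b * y ^+ 2 / (1 + 2 * b * k ^+ 2 * v)))%:E)%E.
Proof.
move=> v0 b0.
set ka := 1 + 2 * b * k ^+ 2 * v.
have ka0 : 0 < ka.
  have : 0 <= 2 * b * k ^+ 2 * v.
    by apply: mulr_ge0; [apply: mulr_ge0; [exact: mulr_ge0|exact: sqr_ge0]|exact: ltW].
  by rewrite /ka; lra.
have mh : measurable_fun setT (fun x : R => expR (- b * (y + k * x) ^+ 2)).
  apply: (measurableT_comp (@measurable_expR R)); apply: measurable_funM => //.
  by apply: measurable_funX; apply: measurable_funD => //; exact: measurable_funM.
rewrite ge0_integral_normal_prob//; last first.
  move=> x; rewrite expR_ge0/= -[leRHS]expR0 ler_expR mulNr oppr_le0.
  by rewrite mulr_ge0// sqr_ge0.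
(* Variance and mean of the Gaussian density that remains once the square is completed. *)
pose v' := v / ka; pose m := - 2 * b * k * y * v / ka.
have v'0 : 0 < v' by rewrite divr_gt0.
pose C := (Num.sqrt ka)^-1 * expR (- b * y ^+ 2 / ka).
have E (x : R) : expR (- b * (y + k * x) ^+ 2) * normal_pdf 0 (Num.sqrt v) x =
    C * normal_pdf m (Num.sqrt v') x.
  rewrite !normal_pdfE ?gt_eqF ?sqrtr_gt0// /normal_peak /normal_fun.
  rewrite !sqr_sqrtr ?ltW// subr0 mulrCA -expRD.
  have -> : - b * (y + k * x) ^+ 2 + - x ^+ 2 / (v *+ 2) =
      - b * y ^+ 2 / ka + - (x - m) ^+ 2 / (v' *+ 2).
    have ka_neq0 : ka != 0 by rewrite gt_eqF.
    have v_neq0 : v != 0 by rewrite gt_eqF.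
    rewrite -[v *+ 2]mulr_natr -[v' *+ 2]mulr_natr /m /v'.
    have -> : - b * (y + k * x) ^+ 2 = - b * y ^+ 2 / ka * ka - b * (2 * y * k * x + k ^+ 2 * x ^+ 2).
      by field.
    rewrite /ka; field; rewrite -/ka ?ka_neq0 ?v_neq0//.
  have -> : (Num.sqrt (v * pi *+ 2))^-1 =
      (Num.sqrt ka)^-1 * (Num.sqrt (v' * pi *+ 2))^-1.
    rewrite -invfM -sqrtrM ?ltW//; congr (Num.sqrt _)^-1.
    by rewrite /v'; field; rewrite gt_eqF.
  by rewrite /C expRD; ring.
under eq_integral do rewrite E EFinM.
rewrite integralZl//; last exact: integrable_normal_pdf.
by rewrite integral_normal_pdf mule1.
Qed.

End GaussianIntegral.

(** * Integrating out independent variables *)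

Section IndependentIntegral.
Context {d : measure_display} {Omega : measurableType d} {R : realType}.
Variable P : probability Omega R.
Variable G : set (set Omega).
Hypothesis GP : G `<=` measurable.
Hypothesis sG : sigma_algebra setT G.
Local Notation OmegaG := (g_sigma_algebraType G).

Lemma measurable_g_sigma_id : measurable_fun setT (fun w : Omega => w : OmegaG).
Proof.
move=> _ B; rewrite measurable_g_measurableTypeE// => GB.
by rewrite setTI; exact: GP.
Qed.

(** Moves [measurable_wrt] to the type carrying the sigma-algebra [G], where the closure properties
    of measurable functions are available. *)
Lemma measurable_wrtP (f : Omega -> R) :
  measurable_wrt G f <-> measurable_fun setT (f : OmegaG -> R).
Proof.
split => [mf _ B mB|mf B mB].
  by rewrite setTI measurable_g_measurableTypeE//; exact: mf.
by have := mf measurableT B mB; rewrite setTI measurable_g_measurableTypeE.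
Qed.

Lemma g_sigma_measurable_fun (f : Omega -> R) :
  measurable_fun setT (f : OmegaG -> R) -> measurable_fun setT f.
Proof. by move=> mf; exact: (measurableT_comp mf measurable_g_sigma_id). Qed.

(** The freezing lemma. By independence the joint law of the identity into [OmegaG] and of [xi]
    agrees with a product measure on rectangles, hence everywhere, and Tonelli integrates [xi] out
    first. *)
Lemma independent_integral (nu : probability (measurableTypeR R) R) (xi : Omega -> R)
    (k : OmegaG * R -> \bar R) :
  measurable_fun setT xi ->
  (forall A B, G A -> measurable B -> P (A `&` xi @^-1` B) = (P A * nu B)%E) ->
  measurable_fun setT k -> (forall p, 0 <= k p)%E ->
  (\int[P]_w k (w, xi w) = \int[P]_w \int[nu]_x k (w, x))%E.
Proof.
move=> mxi ind mk k0.
have mid := measurable_g_sigma_id.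
pose idG : {RV P >-> OmegaG} := HB.pack (fun w : Omega => w : OmegaG)
  (isMeasurableFun.Build _ _ _ _ _ mid).
have mpair : measurable_fun setT (fun w : Omega => ((w : OmegaG), xi w : measurableTypeR R)).
  exact: measurable_fun_pair.
pose PG := distribution P idG.
pose pairG : {RV P >-> (OmegaG * measurableTypeR R)%type} := HB.pack (fun w : Omega => ((w : OmegaG), xi w : measurableTypeR R))
  (isMeasurableFun.Build _ _ _ _ _ mpair).
have E X : measurable X -> (PG \x nu)%E X = distribution P pairG X.
  move=> mX; apply: product_measure_unique => // A B mA mB.
  have GA : G A by move: mA; rewrite measurable_g_measurableTypeE.
  exact: ind.
transitivity (\int[distribution P pairG]_p k p)%E.
  by rewrite ge0_integral_distribution.
transitivity (\int[(PG \x nu)%E]_p k p)%E.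
  by apply: eq_measure_integral => X mX _; exact/esym/E.
rewrite fubini_tonelli1//.
rewrite ge0_integral_distribution//.
  exact: measurable_fun_fubini_tonelli_F.
by move=> w; exact: integral_ge0.
Qed.

End IndependentIntegral.

Section IndependentComponents.
Context {d : measure_display} {Omega : measurableType d} {R : realType}.
Variable P : probability Omega R.
Variable G : set (set Omega).
Hypothesis GP : G `<=` measurable.
Hypothesis sG : sigma_algebra setT G.
Variables (N : nat) (nu : probability (measurableTypeR R) R) (xi : 'I_N -> Omega -> R).
Hypothesis mxi : forall i, measurable_fun setT (xi i).
Hypothesis indep : forall A (B : 'I_N -> set R), G A -> (forall i, measurable (B i)) ->
  P (A `&` [set w | forall i, B i (xi i w)]) = (P A * \prod_(i < N) nu (B i))%E.

(* A pi-system generating the events determined by G and the components of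
   index smaller than j. *)
Let gen (j : nat) : set (set Omega) := [set E | exists A (B : 'I_N -> set R),
  [/\ G A, forall i, measurable (B i), forall i : 'I_N, (j <= i)%N -> B i = setT
    & E = A `&` [set w | forall i, B i (xi i w)]]].
Let Gj j := <<s gen j >>.

Let GT : G setT.
Proof. by case: sG => G0 GC _; have := GC _ G0; rewrite setD0. Qed.

Let GI A B : G A -> G B -> G (A `&` B).
Proof.
move=> GA GB; rewrite -(measurable_g_measurableTypeE sG).
apply: (@measurableI _ (g_sigma_algebraType G));
  by rewrite (measurable_g_measurableTypeE sG).
Qed.

Let mbox (B : 'I_N -> set R) : (forall i, measurable (B i)) ->
  measurable [set w | forall i, B i (xi i w)].
Proof.
move=> mB; rewrite (_ : [set w | _] = \bigcap_(i in [set: 'I_N]) (xi i @^-1` B i)).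
  apply: fin_bigcap_measurable => // i _.
  by rewrite -[X in measurable X]setTI; exact: mxi.
by apply/seteqP; split => w /= h i; [move=> _; exact: h|exact: h].
Qed.

Let gen_measurable j : gen j `<=` measurable.
Proof.
by move=> _ [A [B [GA mB _ ->]]]; apply: measurableI; [exact: GP|exact: mbox].
Qed.

Let Gj_measurable j : Gj j `<=` measurable.
Proof. exact: (smallest_sub (@sigma_algebra_measurable _ _) (@gen_measurable j)). Qed.

Let sGj j : sigma_algebra setT (Gj j).
Proof. exact: smallest_sigma_algebra. Qed.

Let gen_setI j : setI_closed (gen j).
Proof.
move=> _ _ [A [B [GA mB BT ->]]] [A' [B' [GA' mB' BT' ->]]].
exists (A `&` A'), (fun i => B i `&` B' i); split.
- exact: GI.
- by move=> i; exact: measurableI.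
- by move=> i ji; rewrite BT// BT'// setIid.
- apply/seteqP; split => w /=; first by move=> [[Aw Bw] [A'w B'w]]; split => // i; split.
  by move=> [[Aw A'w] BBw]; split; split => // i; case: (BBw i).
Qed.

Let G_gen j : G `<=` gen j.
Proof.
move=> A GA; exists A, (fun=> setT); split => //.
by apply/seteqP; split => w //=; case.
Qed.

Let boxT (i0 : 'I_N) (B : set R) : [set w | forall i, (if i == i0 then B else setT) (xi i w)] = xi i0 @^-1` B.
Proof.
apply/seteqP; split => w /=; first by move/(_ i0); rewrite eqxx.
by move=> Bw i; case: eqP => // ->.
Qed.

Let Gj_xi j (i : 'I_N) (B : set R) : (i < j)%N -> measurable B -> Gj j (xi i @^-1` B).
Proof.
move=> ij mB; apply: sub_sigma_algebra.
exists setT, (fun k => if k == i then B else setT); split.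
- exact: GT.
- by move=> k; case: eqP.
- by move=> k jk; case: eqP jk => // ->; rewrite leqNgt ij.
- by rewrite boxT setTI.
Qed.

Let nuT (B : 'I_N -> set R) (i0 : 'I_N) C : B i0 = setT ->
  (\prod_(i < N) nu (if i == i0 then C else B i) = (\prod_(i < N) nu (B i)) * nu C)%E.
Proof.
move=> Bi0; rewrite (bigD1 i0)//= [in RHS](bigD1 i0)//= eqxx Bi0 probability_setT mul1e.
rewrite muleC; congr (_ * _)%E; apply: eq_bigr => i ii0.
by rewrite (negbTE ii0).
Qed.

(** In [A], both sides are finite measures, so they need comparing only on the pi-system [gen j].
    Its events leave component [j] free, so that imposing [C] on it multiplies the product by
    [nu C]. *)
Let indep_Gj (j : 'I_N) A C : Gj j A -> measurable C ->
  P (A `&` xi j @^-1` C) = (P A * nu C)%E.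
Proof.
move=> GA mC.
have mXC : measurable (xi j @^-1` C).
  by rewrite -[X in measurable X]setTI; exact: mxi.
have nuCE : nu C = (fine (nu C))%:E by rewrite fineK ?fin_num_measure.
have nuC0 : 0 <= fine (nu C) by rewrite fine_ge0.
pose m1 := mrestr P mXC.
pose m2 := mscale (NngNum nuC0) P.
have m1E X : m1 X = P (X `&` xi j @^-1` C) by [].
have m2E X : m2 X = (nu C * P X)%E by rewrite /m2 /mscale/= -nuCE.
suff : m1 A = m2 A by rewrite m1E m2E muleC.
apply: (g_sigma_algebra_measure_unique (gen j) (@gen_measurable j) (fun=> setT)) => //.
- by move=> _; apply: G_gen; exact: GT.
- by rewrite bigcup_const.
- move=> _ [E [B [GE mB BT ->]]].
  rewrite -[LHS]/(m1 _) -[RHS]/(m2 _) m1E m2E.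
  have -> : E `&` [set w | forall i, B i (xi i w)] `&` xi j @^-1` C =
      E `&` [set w | forall i, (if i == j then C else B i) (xi i w)].
    apply/seteqP; split => w /=.
      by move=> [[Ew Bw] Cw]; split => // i; case: eqP => [->|_].
    move=> [Ew H]; split; last by have := H j; rewrite eqxx.
    split => // i; have := H i; case: eqP => // -> _.
    by rewrite BT.
  have mB' i : measurable (if i == j then C else B i) by case: eqP.
  rewrite (indep GE mB) (indep GE mB').
  by rewrite nuT ?BT// muleA muleC.
- by move=> _; rewrite -[ltLHS]/(m1 _) m1E setTI (le_lt_trans (probability_le1 _ _)) ?ltry.
Qed.

Variables (h : R -> R -> R) (H : R -> R).
Hypothesis mh : measurable_fun setT (fun p : R * R => h p.1 p.2).
Hypothesis h0 : forall y x, 0 <= h y x.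
Hypothesis hH : forall y, (\int[nu]_x (h y x)%:E = (H y)%:E)%E.
Hypothesis mH : measurable_fun setT H.
Hypothesis H0 : forall y, 0 <= H y.
Variables (Z : Omega -> R) (y : 'I_N -> Omega -> R).
Hypothesis mZ : measurable_wrt G Z.
Hypothesis Z0 : forall w, 0 <= Z w.
Hypothesis my : forall i, measurable_wrt G (y i).

(** Components of index below [j] are still random; the others have been integrated out. *)
Let fac j (i : 'I_N) w := if (i < j)%N then h (y i w) (xi i w) else H (y i w).

Let mGj j (f : Omega -> R) : measurable_wrt G f -> measurable_wrt (Gj j) f.
Proof. by move=> mf B mB; apply: sub_sigma_algebra; apply: G_gen; exact: mf. Qed.

(** Each step integrates out the component of index [j], the smaller ones being frozen because
    [Gj j] contains their events. *)
Let chain (j : nat) : (j <= N)%N ->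
  (\int[P]_w (Z w * \prod_(i < N) fac j i w)%:E =
   \int[P]_w (Z w * \prod_(i < N) H (y i w))%:E)%E.
Proof.
elim: j => [_|j IH jN]; first by apply: eq_integral => w _.
rewrite -IH ?(ltnW jN)//; pose j0 := Ordinal jN.
pose U w := Z w * \prod_(i < N | i != j0) fac j i w.
have U0 w : 0 <= U w.
  by rewrite mulr_ge0// prodr_ge0// => i _; rewrite /fac; case: ifP.
have sj := sGj j.
have mU : measurable_fun setT (U : g_sigma_algebraType (Gj j) -> R).
  apply: measurable_funM; first by apply/(measurable_wrtP sj); exact: mGj.
  under eq_fun do rewrite -big_filter.
  apply: measurable_prod => i _; rewrite /fac.
  have myi : measurable_fun setT (y i : g_sigma_algebraType (Gj j) -> R).
    by apply/(measurable_wrtP sj); exact: mGj.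
  have [ij|ij] := boolP (i < j)%N; last exact: (measurableT_comp mH myi).
  apply: (measurableT_comp mh (g := fun w : g_sigma_algebraType (Gj j) => (y i w, xi i w))).
  apply: measurable_fun_pair => //; apply/(measurable_wrtP sj) => B mB.
  exact: Gj_xi.
have myj : measurable_fun setT (y j0 : g_sigma_algebraType (Gj j) -> R).
  by apply/(measurable_wrtP sj); exact: mGj.
pose k (p : g_sigma_algebraType (Gj j) * R) : \bar R := (U p.1 * h (y j0 p.1) p.2)%:E.
have mk : measurable_fun setT k.
  apply/measurable_EFinP; apply: measurable_funM.
    exact: (measurableT_comp mU measurable_fst).
  apply: (measurableT_comp mh (g := fun p : g_sigma_algebraType (Gj j) * R => (y j0 p.1, p.2))).
  by apply: measurable_fun_pair => //; exact: (measurableT_comp myj measurable_fst).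
have k0 p : (0 <= k p)%E by rewrite lee_fin mulr_ge0.
transitivity (\int[P]_w k (w, xi j0 w))%E.
  apply: eq_integral => w _; congr EFin.
  rewrite /k/= /U (bigD1 j0)//= /fac/= ltnSn -!mulrA; congr (_ * _).
  rewrite mulrC; congr (_ * _); apply: eq_bigr => i ij; congr (if _ then _ else _).
  rewrite ltnS leq_eqVlt; case: eqP => // ijE.
  by move: ij; rewrite -val_eqE/= ijE eqxx.
rewrite (independent_integral (@Gj_measurable j) sj (mxi j0) (@indep_Gj j0) mk k0).
apply: eq_integral => w _; rewrite /k/=.
under eq_integral do rewrite EFinM.
rewrite ge0_integralZl//=; last 3 first.
- by apply/measurable_EFinP; apply: (measurableT_comp mh (g := fun x => (y j0 w, x)));
    exact: measurable_fun_pair.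
- by move=> x _; rewrite lee_fin.
- by rewrite lee_fin.
rewrite hH -EFinM /U [in RHS](bigD1 j0)//=; congr EFin.
by rewrite -!mulrA /fac/= ltnn [_ * H _]mulrC.
Qed.

Lemma integral_independent_prod :
  (\int[P]_w (Z w * \prod_(i < N) h (y i w) (xi i w))%:E =
   \int[P]_w (Z w * \prod_(i < N) H (y i w))%:E)%E.
Proof.
rewrite -(chain (leqnn N)); apply: eq_integral => w _; congr (_ * _)%:E.
by apply: eq_bigr => i _; rewrite /fac ltn_ord.
Qed.

End IndependentComponents.

(** * The Euler scheme *)

Section EulerScheme.
Context {d : measure_display} {Omega : measurableType d} {R : realType}.
Variable P : probability Omega R.
Variables (a c : R) (N : nat).
Variables (F : R -> set (set Omega)) (W X : R -> Omega -> 'cV[R]_N).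
Hypothesis hF : filtration F.
Hypothesis hW : brownian_motion P F W.
Hypothesis aX : adapted F X.
Variables (t dt : R).
Hypotheses (t0 : 0 <= t) (dt0 : 0 < dt).

Definition grid (k : nat) : R := t + k%:R * dt.

Fixpoint euler (k : nat) (w : Omega) (i : 'I_N) : R :=
  if k is k'.+1 then
    (1 - a / 2 * dt) * euler k' w i
      + c / 2 * (W (grid k'.+1) w i 0 - W (grid k') w i 0)
  else X t w i 0.

Definition euler_sqr k w : R := \sum_(i < N) euler k w i ^+ 2.

Definition euler_sum n w : R := \sum_(k < n) dt * euler_sqr k w.

(* Numerator and denominator of the coefficient b_j in
   E[exp(- dt (|Y_0|^2 + ... + |Y_(j-1)|^2))] = den_j^(-N/2) exp(- b_j |Y_0|^2). *)
Fixpoint euler_num_den (j : nat) : R * R :=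
  if j is j'.+1 then
    let: (p, q) := euler_num_den j' in
    let q' := q + c ^+ 2 / 2 * dt * p in
    (dt * q' + (1 - a / 2 * dt) ^+ 2 * p, q')
  else (0, 1).

Definition euler_num j := (euler_num_den j).1.
Definition euler_den j := (euler_num_den j).2.

Lemma euler_denS j : euler_den j.+1 = euler_den j + c ^+ 2 / 2 * dt * euler_num j.
Proof. by rewrite /euler_den /euler_num /=; case: euler_num_den. Qed.

Lemma euler_numS j : euler_num j.+1 =
  dt * euler_den j.+1 + (1 - a / 2 * dt) ^+ 2 * euler_num j.
Proof. by rewrite /euler_den /euler_num /=; case: euler_num_den. Qed.

Lemma euler_num_ge0_den_gt0 j : 0 <= euler_num j /\ 0 < euler_den j.
Proof.
elim: j => [|j [p0 q0]]; first by rewrite /euler_num /euler_den/=; split.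
have q1 : 0 < euler_den j.+1.
  rewrite euler_denS; apply: ltr_pwDl => //; apply: mulr_ge0 => //.
  by apply: mulr_ge0; [rewrite divr_ge0 ?sqr_ge0|exact: ltW].
split => //; rewrite euler_numS; apply: addr_ge0; apply: mulr_ge0;
  by rewrite ?sqr_ge0// ltW.
Qed.

Lemma euler_den_ge1 j : 1 <= euler_den j.
Proof.
elim: j => // j; rewrite euler_denS => /le_trans; apply; rewrite lerDl.
have [p0 _] := euler_num_ge0_den_gt0 j; apply: mulr_ge0 => //.
by apply: mulr_ge0; [rewrite divr_ge0 ?sqr_ge0|exact: ltW].
Qed.

Lemma grid_ge0 k : 0 <= grid k.
Proof. by rewrite addr_ge0// mulr_ge0// ltW. Qed.

Lemma grid_lt k : grid k < grid k.+1.
Proof. by rewrite ltrD2l ltr_pM2r// ltr_nat. Qed.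

Lemma measurable_wrt_le (s r : R) (f : Omega -> R) : 0 <= s -> s <= r ->
  measurable_wrt (F s) f -> measurable_wrt (F r) f.
Proof. by move=> s0 sr mf B mB; case: hF => _ _ Fsr; apply: (Fsr s r) => //; exact: mf. Qed.

Lemma euler_measurable k i : measurable_wrt (F (grid k)) (fun w => euler k w i).
Proof.
case: hF => sF _ _; case: hW => aW _ _ _ _.
elim: k => [|k IH] /=; first by rewrite /grid mul0r addr0; exact: aX.
have sk := sF _ (grid_ge0 k.+1).
have m1 : measurable_wrt (F (grid k.+1)) (fun w => euler k w i).
  by apply: (measurable_wrt_le (grid_ge0 k)) IH; rewrite ltW// grid_lt.
have m2 : measurable_wrt (F (grid k.+1)) (fun w => W (grid k) w i 0).
  apply: (measurable_wrt_le (grid_ge0 k)); first by rewrite ltW// grid_lt.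
  by apply: aW; exact: grid_ge0.
have m3 := aW _ (grid_ge0 k.+1) i.
move/(measurable_wrtP sk) in m1; move/(measurable_wrtP sk) in m2.
move/(measurable_wrtP sk) in m3.
apply/(measurable_wrtP sk); apply: measurable_funD; apply: measurable_funM => //.
exact: measurable_funB.
Qed.

Lemma euler_sqr_measurable k l : (k <= l)%N ->
  measurable_wrt (F (grid l)) (euler_sqr k).
Proof.
case: hF => sF _ _ kl; have sk := sF _ (grid_ge0 l).
apply/(measurable_wrtP sk); apply: measurable_sum => i.
apply: measurable_funX; apply/(measurable_wrtP sk).
apply: (measurable_wrt_le (grid_ge0 k)); last exact: euler_measurable.
by rewrite lerD2l; apply: ler_wpM2r; [exact: ltW|rewrite ler_nat].
Qed.

(** The last index in the sum is [n - 1], so the sum is known at time [grid l] as soon as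
    [n <= l.+1]. *)
Lemma euler_sum_measurable n l : (n <= l.+1)%N ->
  measurable_wrt (F (grid l)) (euler_sum n).
Proof.
case: hF => sF _ _ nl; have sk := sF _ (grid_ge0 l).
apply/(measurable_wrtP sk); apply: measurable_sum => k.
apply: measurable_funM => //; apply/(measurable_wrtP sk); apply: euler_sqr_measurable.
by rewrite -ltnS (leq_trans _ nl).
Qed.

(** Given [F (grid k)], the components of the next state are independent and normal, with mean
    [1 - a / 2 * dt] times the current one and variance (c/2)^2 dt. The Gaussian integral thus
    yields a factor kap^(-1/2) for each component, where kap = 1 + 2 b (c/2)^2 dt. *)
Lemma euler_step k (b : R) (Z : Omega -> R) : 0 <= b ->
  measurable_wrt (F (grid k)) Z -> (forall w, 0 <= Z w) ->
  let kap := 1 + c ^+ 2 / 2 * dt * b in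
  (\int[P]_w (Z w * expR (- b * euler_sqr k.+1 w))%:E =
   \int[P]_w (Z w * ((Num.sqrt kap)^-1 ^+ N *
     expR (- ((1 - a / 2 * dt) ^+ 2 * b / kap) * euler_sqr k w)))%:E)%E.
Proof.
move=> b0 mZ Z0 kap.
case: hF => sF mF _; case: hW => aW _ _ indW normW.
have gk := grid_ge0 k; have gkk := grid_lt k.
have [boxW lawW] := normW _ _ gk gkk.
have dtE : grid k.+1 - grid k = dt.
  by rewrite /grid -natr1 mulrDl mul1r; ring.
rewrite dtE in lawW.
pose xi i w := (W (grid k.+1) w - W (grid k) w) i 0.
have mxi i : measurable_fun setT (xi i).
  have sk := sF _ (grid_ge0 k.+1).
  apply: (g_sigma_measurable_fun (mF _ (grid_ge0 k.+1)) sk).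
  rewrite (_ : xi i = fun w => W (grid k.+1) w i 0 - W (grid k) w i 0); last first.
    by apply/funext => w; rewrite /xi !mxE.
  apply: measurable_funB; apply/(measurable_wrtP sk).
    exact: (aW _ (grid_ge0 k.+1) i).
  by apply: (measurable_wrt_le gk); [exact: ltW|exact: (aW _ gk i)].
pose nu : probability (measurableTypeR R) R := normal_prob (0 : R) (Num.sqrt dt).
have indep A (B : 'I_N -> set R) : F (grid k) A -> (forall i, measurable (B i)) ->
    P (A `&` [set w | forall i, B i (xi i w)]) = (P A * \prod_(i < N) nu (B i))%E.
  move=> FA mB; rewrite (indW _ _ gk gkk)//; last first.
    rewrite (_ : [set w | _] = \bigcap_(i in [set: 'I_N]) (xi i @^-1` B i)).
      apply: (@fin_bigcap_measurable _ (g_sigma_algebraType _)) => // i _.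
      by apply: sub_sigma_algebra; exists i, (B i).
    by apply/seteqP; split => w /= h i; [move=> _; exact: h|exact: h].
  rewrite boxW//; congr (_ * _)%E; apply: eq_bigr => i _.
  exact: lawW.
pose m := 1 - a / 2 * dt.
pose h y x := expR (- b * (m * y + c / 2 * x) ^+ 2).
pose H y := (Num.sqrt kap)^-1 * expR (- b * (m * y) ^+ 2 / kap).
have hH y : (\int[nu]_x (h y x)%:E = (H y)%:E)%E.
  rewrite /h integral_normal_prob_expR_sqr//.
  by have -> : 1 + 2 * b * (c / 2) ^+ 2 * dt = kap by rewrite /kap; field.
have mh : measurable_fun setT (fun p : R * R => h p.1 p.2).
  apply: (measurableT_comp (@measurable_expR R)); apply: measurable_funM => //.
  apply: measurable_funX; apply: measurable_funD; exact: measurable_funM.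
have mH : measurable_fun setT H.
  apply: measurable_funM => //; apply: (measurableT_comp (@measurable_expR R)).
  apply: measurable_funM => //; apply: measurable_funM => //.
  by apply: measurable_funX; exact: measurable_funM.
have h0 y x : 0 <= h y x by exact: expR_ge0.
have H0 y : 0 <= H y by rewrite mulr_ge0 ?expR_ge0// invr_ge0.
have := integral_independent_prod (mF _ gk) (sF _ gk) mxi indep mh h0 hH mH H0 mZ Z0
  (fun i => euler_measurable k i).
congr (_ = _); apply: eq_integral => w _; congr (_ * _)%:E.
  rewrite /h -expR_sum; congr expR; rewrite /euler_sqr mulr_sumr.
  by apply: eq_bigr => i _; rewrite /xi !mxE.
rewrite /H big_split/= prodr_const card_ord -expR_sum; congr (_ * expR _).
rewrite /euler_sqr mulr_sumr; apply: eq_bigr => i _.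
by rewrite exprMn /m; ring.
Qed.

(** Integrating out one step sends the coefficient b to dt + m^2 b / (1 + (c^2/2) dt b), where m = 1
    - (a/2) dt. This is a discrete Riccati recursion, and [euler_num_den] is its linearisation. *)
Lemma euler_integral (A : set Omega) n : F t A ->
  (\int[P]_(w in A) (expR (- euler_sum n w))%:E =
   \int[P]_(w in A) ((Num.sqrt (euler_den n))^-1 ^+ N *
     expR (- (euler_num n / euler_den n) * euler_sqr 0 w))%:E)%E.
Proof.
move=> FA; case: hF => sF mF Fle.
pose Z l w := \1_A w * expR (- euler_sum l.+1 w).
have Z0 l w : 0 <= Z l w by rewrite mulr_ge0 ?expR_ge0//; case: ifP.
have mZ l : measurable_wrt (F (grid l)) (Z l).
  have sl := sF _ (grid_ge0 l).
  apply/(measurable_wrtP sl); apply: measurable_funM.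
    apply: measurable_indic; rewrite measurable_g_measurableTypeE//.
    by apply: (Fle t) => //; rewrite lerDl mulr_ge0// ltW.
  apply: (measurableT_comp (@measurable_expR R)); apply: measurableT_comp => //.
  by apply/(measurable_wrtP sl); exact: euler_sum_measurable.
have IZ (f : Omega -> R) : (\int[P]_(w in A) (f w)%:E = \int[P]_w (\1_A w * f w)%:E)%E.
  rewrite integral_mkcond; apply: eq_integral => w _; rewrite patchE.
  by rewrite indicE; case: ifP; rewrite ?mul1r// mul0r.
(* The last [j] states are integrated out backwards and [l] terms of the sum are left. Each step
   contributes [kap], the quotient of two consecutive denominators, so these factors telescope to
   [euler_den j]. *)
have claim j l : (\int[P]_(w in A) (expR (- euler_sum (j + l) w))%:E =
    \int[P]_(w in A) (((Num.sqrt (euler_den j))^-1 ^+ N *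
      expR (- (euler_num j / euler_den j) * euler_sqr l w)) * expR (- euler_sum l w))%:E)%E.
  elim: j l => [|j IH] l.
    apply: eq_integral => w _; rewrite /euler_num /euler_den/= sqrtr1 invr1 expr1n mul0r oppr0 mul0r expR0.
    by rewrite !mul1r.
  rewrite addSnnS IH IZ [in RHS]IZ.
  have [p0 q0] := euler_num_ge0_den_gt0 j.
  have [p1 q1] := euler_num_ge0_den_gt0 j.+1.
  pose b := euler_num j / euler_den j.
  have b0 : 0 <= b by rewrite divr_ge0// ltW.
  pose C := (Num.sqrt (euler_den j))^-1 ^+ N.
  have C0 : 0 <= C by rewrite exprn_ge0// invr_ge0.
  have mCZ : measurable_wrt (F (grid l)) (fun w => C * Z l w).
    have sl := sF _ (grid_ge0 l).
    by apply/(measurable_wrtP sl); apply: measurable_funM => //; apply/(measurable_wrtP sl).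
  have CZ0 w : 0 <= C * Z l w by exact: mulr_ge0.
  have := euler_step b0 mCZ CZ0; rewrite /=.
  set kap := 1 + _.
  have kapE : kap * euler_den j = euler_den j.+1.
    by rewrite euler_denS /kap /b; field; rewrite gt_eqF.
  have kap0 : 0 < kap by rewrite -(pmulr_lgt0 _ q0) kapE.
  move=> E; transitivity (\int[P]_w (C * Z l w * expR (- b * euler_sqr l.+1 w))%:E)%E.
    by apply: eq_integral => w _; rewrite /Z -/b -/C; congr EFin; ring.
  rewrite E; apply: eq_integral => w _; congr EFin; rewrite /Z /C.
  rewrite -kapE sqrtrM ?ltW// invfM exprMn kapE.
  have -> : expR (- euler_sum l.+1 w) = expR (- euler_sum l w) * expR (- dt * euler_sqr l w).
    by rewrite -expRD /euler_sum big_ord_recr/=; congr expR; ring.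
  have -> : expR (- (euler_num j.+1 / euler_den j.+1) * euler_sqr l w) =
      expR (- dt * euler_sqr l w) * expR (- ((1 - a / 2 * dt) ^+ 2 * b / kap) * euler_sqr l w).
    rewrite -expRD; congr expR; rewrite euler_numS /b -kapE.
    by field; rewrite !gt_eqF.
  by ring.
rewrite -[in LHS](addn0 n) claim; apply: eq_integral => w _.
by rewrite /euler_sum big_ord0 oppr0 expR0 mulr1.
Qed.

End EulerScheme.

(** * Convergence of the discrete coefficients *)

Section EulerRecursion.
Context {R : realType}.
Variables a c : R.
Hypotheses (a_gt0 : 0 < a) (c_gt0 : 0 < c).

Lemma step_size_le (tau e : R) : 0 < e -> \forall n \near \oo, tau / n.+1%:R <= e.
Proof.
move=> e0; have [tau0|tau0] := leP tau 0.
  by near=> n; apply: le_trans (ltW e0); rewrite pmulr_lle0 ?invr_gt0.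
have et : 0 < e / tau by rewrite divr_gt0.
have := near_infty_natSinv_lt (PosNum et); apply: filterS => n /= /ltW H.
by rewrite mulrC -ler_pdivlMr.
Unshelve. all: end_near.
Qed.

(** The mean value theorem, applied to [f] and then to [df]. The constant is not the sharp K/2, but
    only the order [dx ^+ 2] matters. *)
Lemma taylor1_le (f df ddf : R -> R) (K A x dx : R) :
  (forall x : R, is_derive x 1 f (df x)) -> (forall x : R, is_derive x 1 df (ddf x)) ->
  (forall y : R, 0 <= y <= A -> `|ddf y| <= K) -> 0 <= x -> 0 <= dx -> x + dx <= A ->
  `|f (x + dx) - f x - dx * df x| <= K * dx ^+ 2.
Proof.
move=> Df Ddf ddfK x0 dx0 xA.
have xdx : x <= x + dx by rewrite lerDl.
have [y yx ->] := MVT_segment xdx (fun z _ => Df z)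
  (continuous_subspaceT (is_derive_continuous Df)).
move: yx; rewrite in_itv/= => /andP[xy yx].
have [z zx E] := MVT_segment xy (fun z _ => Ddf z)
  (continuous_subspaceT (is_derive_continuous Ddf)).
move: zx; rewrite in_itv/= => /andP[xz zy].
have -> : df y * (x + dx - x) - dx * df x = dx * (df y - df x) by ring.
rewrite E !normrM (ger0_norm dx0) [`|y - x|]ger0_norm ?subr_ge0//.
have zK : `|ddf z| <= K.
  by apply: ddfK; rewrite (le_trans x0 xz) (le_trans zy (le_trans yx xA)).
have K0 : 0 <= K by apply: le_trans zK.
have -> : K * dx ^+ 2 = dx * (K * dx) by ring.
rewrite ler_wpM2l//; apply: ler_pM => //; first by rewrite subr_ge0.
by rewrite lerBlDl.
Qed.

Let p := bond_num a c.
Let q := bond_den a c.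

(** Consistency and stability: the recursion is a one-step scheme for the system of p and q, with
    local error of order dt^2 and amplification [1 + L * dt]. Over the [n.+1] steps the error is of
    order dt. *)
Lemma euler_num_den_cvg (tau : R) : 0 < tau ->
  (fun n => euler_num a c (tau / n.+1%:R) n.+1) @ \oo --> bond_num a c tau /\
  (fun n => euler_den a c (tau / n.+1%:R) n.+1) @ \oo --> bond_den a c tau.
Proof.
move=> tau0.
have Dp (x : R) : is_derive x 1 p (- a * p x + q x) := is_derive_bond_num a_gt0 c_gt0 x.
have Dq (x : R) : is_derive x 1 q (c ^+ 2 / 2 * p x) := is_derive_bond_den a_gt0 c_gt0 x.
have DDp (x : R) : is_derive x 1 (fun x => - a * p x + q x)
    (- a * (- a * p x + q x) + c ^+ 2 / 2 * p x).
  exact: (is_deriveD_pt (is_deriveZ_pt (- a) (Dp x)) (Dq x)).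
have DDq (x : R) : is_derive x 1 (fun x => c ^+ 2 / 2 * p x)
    (c ^+ 2 / 2 * (- a * p x + q x)).
  exact: (is_deriveZ_pt _ (Dp x)).
have cp : continuous p by exact: is_derive_continuous Dp.
have cq : continuous q by exact: is_derive_continuous Dq.
have [K1 pK1] := continuous_itv_bounded (continuous_subspaceT (A := `[0, tau]) cp).
have [K2 qK2] := continuous_itv_bounded (continuous_subspaceT (A := `[0, tau]) cq).
have a0 : 0 <= a := ltW a_gt0.
have tau00 : 0 <= (0 : R) <= tau by rewrite lexx (ltW tau0).
have K10 : 0 <= K1 by apply: le_trans (pK1 0 tau00).
have K20 : 0 <= K2 by apply: le_trans (qK2 0 tau00).
pose g := c ^+ 2 / 2.
have g0 : 0 <= g by rewrite divr_ge0// sqr_ge0.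
pose Kq := g * (a * K1 + K2).
pose Kp := a * (a * K1 + K2) + g * K1.
have ddqK x : 0 <= x <= tau -> `|g * (- a * p x + q x)| <= Kq.
  move=> xt; rewrite normrM (ger0_norm g0) ler_wpM2l//.
  rewrite (le_trans (ler_normD _ _))// lerD ?qK2// normrM normrN (gtr0_norm a_gt0).
  by apply: ler_wpM2l; [exact: ltW|exact: pK1].
have ddpK x : 0 <= x <= tau -> `|- a * (- a * p x + q x) + g * p x| <= Kp.
  move=> xt; rewrite (le_trans (ler_normD _ _))// lerD//.
    rewrite normrM normrN (gtr0_norm a_gt0) ler_wpM2l ?(ltW a_gt0)//.
    rewrite (le_trans (ler_normD _ _))// lerD ?qK2// normrM normrN (gtr0_norm a_gt0).
    by apply: ler_wpM2l; [exact: ltW|exact: pK1].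
  by rewrite normrM (ger0_norm g0) ler_wpM2l// pK1.
(* [L] collects the coefficients through which an error in one unknown feeds the other or itself. In
   [K], [Kp] and [Kq] bound the Taylor remainders, and [g + a ^+ 2 / 4] comes from the second-order
   terms by which the recursion differs from the explicit Euler scheme. *)
pose L := 1 + 2 * g.
pose K := Kp + (g + a ^+ 2 / 4) * K1 + Kq.
have Kq0 : 0 <= Kq by apply: mulr_ge0 => //; apply: addr_ge0 => //; exact: mulr_ge0.
have Kp0 : 0 <= Kp.
  by apply: addr_ge0; apply: mulr_ge0 => //; apply: addr_ge0 => //; exact: mulr_ge0.
have ga0 : 0 <= g + a ^+ 2 / 4 by rewrite addr_ge0// divr_ge0// sqr_ge0.
have K0 : 0 <= K by rewrite /K; do 2 (apply: addr_ge0 => //); exact: mulr_ge0.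
have L0 : 0 <= L by rewrite /L; lra.
(* The first condition bounds dt^2 by dt, the second keeps the square of [1 - a / 2 * dt] at most 1;
   both hold for large [n]. *)
have err n : tau / n.+1%:R <= 1 -> a / 2 * (tau / n.+1%:R) <= 1 ->
  `|euler_num a c (tau / n.+1%:R) n.+1 - p tau| +
  `|euler_den a c (tau / n.+1%:R) n.+1 - q tau| <= tau * K * expR (L * tau) * (tau / n.+1%:R).
  set dt := tau / n.+1%:R => dt1 adt1.
  have dt0 : 0 < dt by rewrite divr_gt0.
  have dt00 : 0 <= dt := ltW dt0.
  have nE : n.+1%:R * dt = tau by rewrite /dt mulrC divfK.
  pose ep k := `|euler_num a c dt k - p (k%:R * dt)|.
  pose eq k := `|euler_den a c dt k - q (k%:R * dt)|.
  have ktau k : (k <= n.+1)%N -> k%:R * dt <= tau.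
    by move=> kn; rewrite -nE ler_wpM2r ?ler_nat.
  have step k : (k < n.+1)%N -> ep k.+1 + eq k.+1 <= (1 + L * dt) * (ep k + eq k) + K * dt ^+ 2.
    move=> kn; have kE : k.+1%:R * dt = k%:R * dt + dt by rewrite -natr1 mulrDl mul1r.
    have k0 : 0 <= k%:R * dt by rewrite mulr_ge0.
    have kt : k%:R * dt <= tau by exact/ktau/ltnW.
    have kdt : k%:R * dt + dt <= tau by rewrite -kE ktau.
    have Tq := taylor1_le Dq DDq ddqK k0 (ltW dt0) kdt.
    have Tp := taylor1_le Dp DDp ddpK k0 (ltW dt0) kdt.
    have pk := pK1 (k%:R * dt); rewrite k0 kt in pk; have {}pk := pk isT.
    rewrite /ep /eq kE; set x := k%:R * dt in Tq Tp pk *.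
    set P := euler_num a c dt k; set Q := euler_den a c dt k.
    set rq := q (x + dt) - q x - dt * (c ^+ 2 / 2 * p x) in Tq.
    set rp := p (x + dt) - p x - dt * (- a * p x + q x) in Tp.
    have Eq : euler_den a c dt k.+1 - q (x + dt) = (Q - q x) + g * dt * (P - p x) - rq.
      by rewrite euler_denS -/P -/Q /rq /g; ring.
    have Ep : euler_num a c dt k.+1 - p (x + dt) =
        (1 - a / 2 * dt) ^+ 2 * (P - p x) + dt * (Q - q x) + g * dt ^+ 2 * (P - p x)
        + (g + a ^+ 2 / 4) * dt ^+ 2 * p x - rp.
      by rewrite euler_numS euler_denS -/P -/Q /rp /g; field.
    have Bq : `|euler_den a c dt k.+1 - q (x + dt)| <= `|Q - q x| + g * dt * `|P - p x| + Kq * dt ^+ 2.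
      rewrite Eq (le_trans (ler_normB _ _))// lerD// (le_trans (ler_normD _ _))// lerD2l//.
      by rewrite normrM ger0_norm// mulr_ge0.
    have m1 : (1 - a / 2 * dt) ^+ 2 <= 1.
      have : 0 <= a / 2 * dt by rewrite mulr_ge0// divr_ge0.
      move: adt1; set z := a / 2 * dt => z1 z0; rewrite expr2; nra.
    have Bp : `|euler_num a c dt k.+1 - p (x + dt)| <= `|P - p x| + dt * `|Q - q x|
        + g * dt * `|P - p x| + (g + a ^+ 2 / 4) * dt ^+ 2 * K1 + Kp * dt ^+ 2.
      rewrite Ep (le_trans (ler_normB _ _))// lerD//.
      rewrite (le_trans (ler_normD _ _))// lerD//; last first.
        rewrite normrM ger0_norm; last by rewrite mulr_ge0// sqr_ge0.
        by rewrite ler_wpM2l// mulr_ge0// sqr_ge0.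
      rewrite (le_trans (ler_normD _ _))// lerD//; last first.
        rewrite normrM ger0_norm; last by rewrite mulr_ge0// sqr_ge0.
        by rewrite ler_wpM2r// ler_wpM2l// expr2 ler_piMr.
      rewrite (le_trans (ler_normD _ _))// lerD//; last first.
        by rewrite normrM ger0_norm.
      by rewrite normrM ger0_norm ?sqr_ge0// ler_piMl.
    apply: (le_trans (lerD Bp Bq)).
    have : 0 <= `|P - p x| by []. have : 0 <= `|Q - q x| by [].
    move: `|P - p x| `|Q - q x| => u v v0 u0.
    rewrite /K /L.
    have h1 : 0 <= dt * u by rewrite mulr_ge0.
    have h2 : 0 <= g * dt * v by rewrite mulr_ge0// mulr_ge0.
    rewrite -subr_ge0; set z := _ - _.
    have -> : z = dt * u + 2 * (g * dt * v) by rewrite /z; ring.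
    by rewrite addr_ge0// mulr_ge0.
  have bound k : (k <= n.+1)%N -> ep k + eq k <= k%:R * (K * dt ^+ 2) * (1 + L * dt) ^+ k.
    elim: k => [|k IH] kn.
      by rewrite /ep /eq !mul0r /p /q bond_num0 bond_den0// /euler_num /euler_den/= !subrr normr0 addr0.
    apply: (le_trans (step k kn)).
    have Ldt1 : 1 <= 1 + L * dt by rewrite lerDl mulr_ge0.
    have -> : k.+1%:R * (K * dt ^+ 2) * (1 + L * dt) ^+ k.+1 =
      k%:R * (K * dt ^+ 2) * (1 + L * dt) ^+ k.+1 + K * dt ^+ 2 * (1 + L * dt) ^+ k.+1.
      by rewrite -natr1; ring.
    apply: lerD.
      rewrite [_ ^+ k.+1]exprS [leRHS]mulrCA; apply: ler_wpM2l; first exact: le_trans Ldt1.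
      exact: IH (ltnW kn).
    by rewrite ler_peMr ?exprn_ege1// mulr_ge0// sqr_ge0.
  have := bound n.+1 (leqnn _); rewrite /ep /eq nE => /le_trans; apply.
  have -> : n.+1%:R * (K * dt ^+ 2) = tau * K * dt by rewrite -nE; ring.
  rewrite mulrAC ler_wpM2r// ler_wpM2l//; first by rewrite mulr_ge0// ltW.
  have -> : expR (L * tau) = expR (L * dt) ^+ n.+1 by rewrite -expRM_natl -nE; congr expR; ring.
  rewrite lerXn2r ?nnegrE ?expR_ge0//; last exact: expR_ge1Dx.
  by rewrite addr_ge0// mulr_ge0.
have h : (fun n : nat => tau * K * expR (L * tau) * (tau / n.+1%:R)) @ \oo --> 0.
  rewrite -[X in _ --> X](mulr0 (tau * K * expR (L * tau))).
  apply: cvgM; first exact: cvg_cst.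
  by rewrite -[X in _ --> X](mulr0 tau); apply: cvgM; [exact: cvg_cst|exact: cvg_harmonic].
have small := step_size_le tau.
have both : \forall n \near \oo,
  `|euler_num a c (tau / n.+1%:R) n.+1 - p tau| +
  `|euler_den a c (tau / n.+1%:R) n.+1 - q tau| <= tau * K * expR (L * tau) * (tau / n.+1%:R).
  near=> n; apply: err; first by near: n; exact: small.
  have -> : a / 2 * (tau / n.+1%:R) <= 1 = (tau / n.+1%:R <= 2 / a).
    by rewrite ler_pdivlMr// -[RHS](ler_pM2r (x := 2^-1))//; congr (_ <= _); field.
  by near: n; apply: small; rewrite divr_gt0.
split.
- apply/subr_cvg0/norm_cvg0P.
  apply: (@squeeze_cvgr _ _ _ _ (cst 0) (fun n : nat => tau * K * expR (L * tau) * (tau / n.+1%:R))) => //.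
  + apply: filterS both => n H; rewrite normr_ge0/= (le_trans _ H)// lerDl//.
  + exact: cvg_cst.
- apply/subr_cvg0/norm_cvg0P.
  apply: (@squeeze_cvgr _ _ _ _ (cst 0) (fun n : nat => tau * K * expR (L * tau) * (tau / n.+1%:R))) => //.
  + apply: filterS both => n H; rewrite normr_ge0/= (le_trans _ H)// lerDr//.
  + exact: cvg_cst.
Unshelve. all: end_near.
Qed.

End EulerRecursion.

(** * Uniform continuity and Riemann sums *)

Section RiemannSums.
Context {R : realType}.
Notation mu := (@lebesgue_measure R).
Implicit Types f : R -> R.

(** Heine's theorem, from compactness in its near-covering form; the inequalities are large to fit
    the closed steps of the grid. *)
Lemma uniform_continuity_itv f (a b e : R) : {within `[a, b], continuous f} -> 0 < e ->
  exists2 del : R, 0 < del & forall s u, a <= s <= b -> a <= u <= b ->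
    `|s - u| <= del -> `|f s - f u| <= e.
Proof.
move=> /subspace_continuousP cf e0.
have /compact_near_coveringP/near_covering_withinP cov := @segment_compact R a b.
have [|del /= del0 H] := cov _ (0^'+) (fun del s => forall u, a <= u <= b ->
    `|s - u| < del -> `|f s - f u| <= e) _.
  move=> x xab; have e20 : 0 < e / 2 by rewrite divr_gt0.
  have /cvgrPdist_lt/(_ _ e20) := cf x xab.
  rewrite near_withinE => -[r /= r0 xr].
  have r20 : 0 < r / 2 by rewrite divr_gt0.
  exists (ball x (r / 2), [set y | y < r / 2]) => /=.
    split; first exact: nbhsx_ballx.
    exact: nbhs_right_lt.
  move=> [s y] [/= xs yr] sab u uab su; rewrite /from_subspace/= in xr.
  have s1 : `|f x - f s| < e / 2.
    by apply: xr => //; apply: lt_le_trans xs _; rewrite ler_piMr ?ltW// invf_lt1// ltr1n.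
  have u1 : `|f x - f u| < e / 2.
    apply: xr; last by rewrite /= in_itv.
    rewrite /= -(subrKA s) (le_lt_trans (ler_normD _ _))// (splitr r) ltrD//.
    exact: lt_trans yr.
  have -> : f s - f u = (f x - f u) - (f x - f s) by ring.
  by rewrite (le_trans (ler_normB _ _))// (splitr e) lerD// ltW.
(* One halving picks a point of the right neighbourhood of 0, the other makes the large inequality
   strict. *)
exists (del / 2 / 2); first by rewrite !divr_gt0.
move=> s u sab uab su; have del2 : 0 < del / 2 by rewrite divr_gt0.
apply: (H (del / 2) _ del2) => //=.
- by rewrite sub0r normrN gtr0_norm// ltr_pdivrMr// ltr_pMr// ltr1n.
- by rewrite (le_lt_trans su)// ltr_pdivrMr// ltr_pMr// ltr1n.
Qed.

Lemma Rintegral_sub_left_le (f : R -> R) (s h e : R) : 0 <= h ->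
  {within `[s, s + h], continuous f} ->
  (forall r, s <= r <= s + h -> `|f r - f s| <= e) ->
  `|\int[mu]_(r in `[s, s + h]) f r - h * f s| <= h * e.
Proof.
move=> h0 cf fe.
have sh : s <= s + h by rewrite lerDl.
have hE : s + h - s = h by ring.
have If := integrable_continuous_itv cf.
have Ic : mu.-integrable `[s, s + h] (EFin \o cst (f s)).
  by apply: integrable_continuous_itv; apply: continuous_subspaceT => x; exact: cvg_cst.
rewrite -{2 3}hE mulrC -Rintegral_itvcc_cst// -RintegralB// mulrC.
apply: normr_Rintegral_itv_le => //.
apply: measurable_funB => //.
by have /integrableP[/measurable_EFinP] := If.
Qed.

Variables (f : R -> R) (t T : R).
Hypothesis cf : {within `[t, T], continuous f}.

Lemma riemann_sum_le (dt e : R) n : 0 < dt -> t + n%:R * dt <= T ->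
  (forall s u, t <= s <= T -> t <= u <= T -> `|s - u| <= dt -> `|f s - f u| <= e) ->
  `|\sum_(k < n) dt * f (grid t dt k) - \int[mu]_(s in `[t, grid t dt n]) f s|
    <= n%:R * dt * e.
Proof.
move=> dt0 + mod; elim: n => [|n IH] nT.
  rewrite big_ord0 /grid mul0r addr0 set_itv1 Rintegral_set1 subrr normr0.
  by rewrite mul0r.
have gS : grid t dt n.+1 = grid t dt n + dt by rewrite /grid -natr1 mulrDl mul1r addrA.
have g0 : t <= grid t dt n by rewrite lerDl mulr_ge0// ltW.
have gT : grid t dt n + dt <= T by rewrite -gS.
have gl : grid t dt n <= grid t dt n + dt by rewrite lerDl ltW.
rewrite big_ord_recr/= (@Rintegral_itv_split _ _ _ (grid t dt n)); last 2 first.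
- by rewrite g0 gS.
- apply: integrable_continuous_itv; apply: continuous_subspaceW cf => x /=.
  by rewrite !in_itv/= => /andP[-> /le_trans]; apply.
have H1 : `|\int[mu]_(r in `[grid t dt n, grid t dt n + dt]) f r
    - dt * f (grid t dt n)| <= dt * e.
  apply: Rintegral_sub_left_le (ltW dt0) _ _.
    apply: continuous_subspaceW cf => r /=; rewrite !in_itv/= => /andP[gr rg].
    by rewrite (le_trans g0 gr) (le_trans rg).
  move=> r /andP[gr rg]; apply: mod.
  - by rewrite (le_trans g0 gr) (le_trans rg).
  - by rewrite g0 (le_trans gl).
  - by rewrite ger0_norm ?subr_ge0// lerBlDl.
have {}IH := IH (le_trans gl gT).
rewrite gS.
set A := \sum_(i < n) _ in IH *; set B := \int[mu]_(s in `[t, _]) _ in IH *.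
set C := \int[mu]_(s in _) _ in H1 *.
have -> : A + dt * f (grid t dt n) - (B + C) = (A - B) - (C - dt * f (grid t dt n)) by ring.
rewrite -natr1 !mulrDl mul1r; apply: (le_trans (ler_normB _ _)).
exact: lerD.
Qed.

Lemma riemann_sum_cvg : t < T ->
  (fun n => \sum_(k < n.+1) (T - t) / n.+1%:R * f (grid t ((T - t) / n.+1%:R) k)) @ \oo -->
  \int[mu]_(s in `[t, T]) f s.
Proof.
move=> tT; have tau0 : 0 < T - t by rewrite subr_gt0.
apply/cvgrPdist_le => e e0.
have e'0 : 0 < e / (T - t) by rewrite divr_gt0.
have [del del0 mod] := uniform_continuity_itv cf e'0.
near=> n.
have dtdel : (T - t) / n.+1%:R <= del by near: n; exact: step_size_le.
set dt := (T - t) / n.+1%:R in dtdel *.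
have dt0 : 0 < dt by rewrite divr_gt0.
have nE : n.+1%:R * dt = T - t by rewrite /dt mulrC divfK.
have tE : t + n.+1%:R * dt = T by rewrite nE addrC subrK.
have tT' : t + n.+1%:R * dt <= T by rewrite tE.
have modn s u : t <= s <= T -> t <= u <= T -> `|s - u| <= dt -> `|f s - f u| <= e / (T - t).
  by move=> sT uT su; apply: mod => //; exact: le_trans dtdel.
have := riemann_sum_le dt0 tT' modn.
by rewrite /grid tE distrC nE mulrC divfK ?gt_eqF.
Unshelve. all: end_near.
Qed.

End RiemannSums.

(** * Pathwise convergence of the scheme *)

Section PathwiseEuler.
Context {R : realType}.
Notation mu := (@lebesgue_measure R).
Variables (a c t T : R) (x v : R -> R).
Hypotheses (a_gt0 : 0 < a) (tT : t < T).
Hypothesis cx : {within `[t, T], continuous x}.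
Hypothesis xE : forall s u, t <= s -> s <= u -> u <= T ->
  x u = x s - a / 2 * \int[mu]_(r in `[s, u]) x r + c / 2 * (v u - v s).

(** The noise cancels in the difference of scheme and path. Each step multiplies the error by
    [1 - a / 2 * dt], which lies between 0 and 1, and adds a/2 times the error of one rectangle of
    the integral; these contributions simply add up. *)
Lemma euler_path_le (dt e : R) (y : nat -> R) n : 0 < dt -> a / 2 * dt <= 1 ->
  (forall s u, t <= s <= T -> t <= u <= T -> `|s - u| <= dt -> `|x s - x u| <= e) ->
  y 0%N = x t ->
  (forall k, y k.+1 = (1 - a / 2 * dt) * y k
    + c / 2 * (v (grid t dt k.+1) - v (grid t dt k))) ->
  t + n%:R * dt <= T -> `|y n - x (grid t dt n)| <= n%:R * dt * (a / 2 * e).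
Proof.
move=> dt0 adt mod y0 yS; elim: n => [|n IH] nT.
  by rewrite y0 /grid mul0r addr0 subrr normr0 mul0r.
have gS : grid t dt n.+1 = grid t dt n + dt by rewrite /grid -natr1 mulrDl mul1r addrA.
have g0 : t <= grid t dt n by rewrite lerDl mulr_ge0// ltW.
have gT : grid t dt n + dt <= T by rewrite -gS.
have gl : grid t dt n <= grid t dt n + dt by rewrite lerDl ltW.
have {}IH := IH (le_trans gl gT).
have H1 : `|\int[mu]_(r in `[grid t dt n, grid t dt n + dt]) x r - dt * x (grid t dt n)| <= dt * e.
  apply: Rintegral_sub_left_le (ltW dt0) _ _.
    apply: continuous_subspaceW cx => r /=; rewrite !in_itv/= => /andP[gr rg].
    by rewrite (le_trans g0 gr) (le_trans rg).
  move=> r /andP[gr rg]; apply: mod.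
  - by rewrite (le_trans g0 gr) (le_trans rg).
  - by rewrite g0 (le_trans gl).
  - by rewrite ger0_norm ?subr_ge0// lerBlDl.
rewrite yS gS (xE g0 gl gT).
set I := \int[mu]_(r in _) _ in H1 *.
set z := x (grid t dt n) in IH H1 *.
set w := c / 2 * _.
have -> : (1 - a / 2 * dt) * y n + w - (z - a / 2 * I + w) =
  (1 - a / 2 * dt) * (y n - z) + a / 2 * (I - dt * z) by ring.
have a20 : 0 <= a / 2 by rewrite divr_ge0// ltW.
have m0 : 0 <= 1 - a / 2 * dt by rewrite subr_ge0.
have -> : n.+1%:R * dt * (a / 2 * e) = n%:R * dt * (a / 2 * e) + dt * (a / 2 * e).
  by rewrite -natr1; ring.
apply: (le_trans (ler_normD _ _)); apply: lerD.
  rewrite normrM (ger0_norm m0); apply: le_trans IH.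
  by rewrite ler_piMl// gerBl mulr_ge0// ltW.
by rewrite normrM (ger0_norm a20) [leRHS]mulrCA ler_wpM2l.
Qed.

Lemma euler_sqr_sub_cvg (y : nat -> nat -> R) :
  (forall n, y n 0%N = x t) ->
  (forall n k, y n k.+1 = (1 - a / 2 * ((T - t) / n.+1%:R)) * y n k
    + c / 2 * (v (grid t ((T - t) / n.+1%:R) k.+1) - v (grid t ((T - t) / n.+1%:R) k))) ->
  (fun n => \sum_(k < n.+1) (T - t) / n.+1%:R *
     (y n k ^+ 2 - x (grid t ((T - t) / n.+1%:R) k) ^+ 2)) @ \oo --> 0.
Proof.
move=> y0 yS; have tau0 : 0 < T - t by rewrite subr_gt0.
have [B xB] := continuous_itv_bounded cx.
have B0 : 0 <= B by apply: le_trans (xB t _); rewrite ?lexx// ltW.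
have a20 : 0 < a / 2 by rewrite divr_gt0.
pose K := (T - t) * (a / 2).
have K0 : 0 < K by rewrite mulr_gt0.
(* The scheme stays within [K * e'] of the path, which is bounded by [B]; for [e' <= 1] the squares
   differ by at most [K * (2 * B + K) * e'], and the whole sum by at most [M * e']. *)
pose M := (T - t) * (K * (2 * B + K)) + 1.
have M0 : 0 < M by rewrite ltr_wpDl// !mulr_ge0// ltW// ltr_wpDl// mulr_ge0.
apply/cvgrPdist_le => e e0.
pose e' := Num.min 1 (e / M).
have e'0 : 0 < e' by rewrite lt_min ltr01 divr_gt0.
have [del del0 mod] := uniform_continuity_itv cx e'0.
near=> n.
have dtdel : (T - t) / n.+1%:R <= del by near: n; exact: step_size_le.
have dta : (T - t) / n.+1%:R <= 2 / a.
  by near: n; apply: step_size_le; rewrite divr_gt0.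
set dt := (T - t) / n.+1%:R in dtdel dta *.
have dt0 : 0 < dt by rewrite divr_gt0.
have nE : n.+1%:R * dt = T - t by rewrite /dt mulrC divfK.
have adt : a / 2 * dt <= 1.
  have := ler_wpM2l (ltW a20) dta; have -> : a / 2 * (2 / a) = 1 by field; rewrite gt_eqF.
  by [].
have modn s u : t <= s <= T -> t <= u <= T -> `|s - u| <= dt -> `|x s - x u| <= e'.
  by move=> sT uT su; apply: mod => //; exact: le_trans dtdel.
rewrite sub0r normrN.
have term (k : 'I_n.+1) : `|dt * (y n k ^+ 2 - x (grid t dt k) ^+ 2)| <=
    dt * (K * (2 * B + K) * e').
  have kdt : k%:R * dt <= T - t by rewrite -nE; apply: ler_wpM2r; [exact: ltW|rewrite ler_nat ltnW].
  have kT : t + k%:R * dt <= T by rewrite -lerBrDl.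
  have := euler_path_le dt0 adt modn (y0 n) (yS n) kT.
  rewrite normrM gtr0_norm// => err; apply: ler_wpM2l; first exact: ltW.
  have {}err : `|y n k - x (grid t dt k)| <= K * e'.
    apply: le_trans err _; have -> : K * e' = (T - t) * (a / 2 * e') by rewrite /K; ring.
    by apply: ler_wpM2r kdt; rewrite mulr_ge0// ltW.
  have xb : `|x (grid t dt k)| <= B.
    by apply: xB; rewrite kT andbT lerDl mulr_ge0// ltW.
  move: err xb; set u := y n k; set z := x _ => err xb.
  have -> : u ^+ 2 - z ^+ 2 = (u - z) * (2 * z + (u - z)) by ring.
  rewrite normrM [leRHS]mulrAC; apply: ler_pM => //.
  apply: (le_trans (ler_normD _ _)); apply: lerD.
    by rewrite normrM ger0_norm// ler_wpM2l.
  apply: le_trans err _; rewrite ler_piMr ?(ltW K0)//.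
  by rewrite ge_min lexx.
apply: (le_trans (ler_norm_sum _ _ _)).
apply: (le_trans (ler_sum _ (fun k _ => term k))).
rewrite sumr_const card_ord.
have -> : dt * (K * (2 * B + K) * e') *+ n.+1 = (T - t) * (K * (2 * B + K)) * e'.
  by rewrite -mulr_natl -nE; ring.
apply: (@le_trans _ _ (M * e')); first by rewrite ler_wpM2r ?(ltW e'0)// lerDl.
by rewrite mulrC -ler_pdivlMr// ge_min lexx orbT.
Unshelve. all: end_near.
Qed.

End PathwiseEuler.

Section EulerConvergence.
Context {d : measure_display} {Omega : measurableType d} {R : realType}.
Notation mu := (@lebesgue_measure R).
Variables (a c t T : R) (N : nat) (W X : R -> Omega -> 'cV[R]_N).
Hypotheses (a_gt0 : 0 < a) (t0 : 0 <= t) (tT : t < T).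

Lemma spot_rateE s (w : Omega) : spot_rate X s w = \sum_(i < N) X s w i 0 ^+ 2.
Proof. by rewrite /spot_rate mxE; apply: eq_bigr => i _; rewrite mxE expr2. Qed.

Lemma continuous_spot_rate (w : Omega) : continuous_path (X^~ w) ->
  {within `[0, +oo[, continuous (spot_rate X ^~ w)}.
Proof.
move=> cX; rewrite (_ : spot_rate X ^~ w = fun s => \sum_(i < N) X s w i 0 ^+ 2).
  apply: continuous_big => [|i _]; first exact: add_continuous.
  by move=> s; apply: (continuous_comp (g := fun z : R => z ^+ 2)); [exact: cX|exact: exprn_continuous].
by apply/funext => s; exact: spot_rateE.
Qed.

(** The sum along the scheme is a Riemann sum of the spot rate plus a sum of differences of squares
    that tends to 0. *)
Lemma euler_sum_cvg (x0 : 'cV[R]_N) (w : Omega) : continuous_path (X^~ w) ->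
  (forall s : R, 0 <= s -> forall i, X s w i 0 = x0 i 0
     - a / 2 * \int[mu]_(r in `[0, s]) X r w i 0 + c / 2 * W s w i 0) ->
  (fun n => euler_sum a c W X t ((T - t) / n.+1%:R) n.+1 w) @ \oo -->
  \int[mu]_(s in `[t, T]) spot_rate X s w.
Proof.
move=> cX XE.
have cXi i s u : 0 <= s -> {within `[s, u], continuous (fun r => X r w i 0)}.
  move=> s0; apply: continuous_subspaceW (cX i) => r /=; rewrite !in_itv/= andbT.
  by move=> /andP[+ _]; exact: le_trans.
have crT : {within `[t, T], continuous (spot_rate X ^~ w)}.
  apply: continuous_subspaceW (continuous_spot_rate cX) => r /=; rewrite !in_itv/= andbT.
  by move=> /andP[+ _]; exact: le_trans.
have XE2 i s u : t <= s -> s <= u -> u <= T -> X u w i 0 = X s w i 0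
    - a / 2 * \int[mu]_(r in `[s, u]) X r w i 0 + c / 2 * (W u w i 0 - W s w i 0).
  move=> ts su uT; have s0 : 0 <= s by exact: le_trans ts.
  rewrite (XE u (le_trans s0 su)) (XE s s0) (@Rintegral_itv_split _ 0 u s); last 2 first.
  - by rewrite s0.
  - by apply: integrable_continuous_itv; exact: cXi.
  by ring.
have diff : (fun n => \sum_(i < N) \sum_(k < n.+1) (T - t) / n.+1%:R *
    (euler a c W X t ((T - t) / n.+1%:R) k w i ^+ 2
     - X (grid t ((T - t) / n.+1%:R) k) w i 0 ^+ 2)) @ \oo --> \sum_(i < N) (0 : R).
  apply: cvg_big => [|i _]; first exact: add_continuous.
  apply: (euler_sqr_sub_cvg (c := c) (v := fun s => W s w i 0) a_gt0 tT (cXi i _ _ t0) (XE2 i)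
    (y := fun n k => euler a c W X t ((T - t) / n.+1%:R) k w i)) => //.
rewrite big1 // in diff.
have sum := riemann_sum_cvg crT tT.
have := cvgD diff sum; rewrite add0r => /(_ _) H.
move: H; set u : nat -> R := _ + _ => H.
rewrite (eq_cvg _ _ (g := u)); first exact: H.
move=> n; rewrite /u fctE/=.
set dt := (T - t) / n.+1%:R.
rewrite exchange_big/= -big_split/=; apply: eq_bigr => k _.
rewrite -mulr_sumr -mulrDr; congr (_ * _).
rewrite sumrB spot_rateE subrK; exact: eq_bigr.
Qed.

End EulerConvergence.

(** * Conditional expectation of the discount factor *)

Section ConditionalExpectation.
Context {d : measure_display} {Omega : measurableType d} {R : realType}.
Variable P : probability Omega R.
Variable G : set (set Omega).
Hypothesis GP : G `<=` measurable.
Hypothesis sG : sigma_algebra setT G.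

(** Transported to the type carrying [G], both versions have equal integrals over all measurable
    sets, hence agree almost everywhere there; the exceptional set belongs to [G], so it is a null
    set for [P] too. *)
Lemma cond_exp_unique (Z p p' : Omega -> R) : is_cond_exp P G Z p ->
  is_cond_exp P G Z p' -> {ae P, forall w, p w = p' w}.
Proof.
move=> [_ Ip mp pE] [_ Ip' mp' pE'].
have mid := measurable_g_sigma_id GP sG.
pose idG : {RV P >-> g_sigma_algebraType G} :=
  HB.pack (fun w : Omega => w : g_sigma_algebraType G) (isMeasurableFun.Build _ _ _ _ _ mid).
pose PG := distribution P idG.
have mpG : measurable_fun setT (EFin \o p : g_sigma_algebraType G -> \bar R).
  by apply/measurable_EFinP/(measurable_wrtP sG).
have mpG' : measurable_fun setT (EFin \o p' : g_sigma_algebraType G -> \bar R).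
  by apply/measurable_EFinP/(measurable_wrtP sG).
have GE E : measurable (E : set (g_sigma_algebraType G)) -> G E.
  by rewrite measurable_g_measurableTypeE.
have IG (f : Omega -> R) E : measurable_fun setT (EFin \o f : g_sigma_algebraType G -> \bar R) ->
    P.-integrable setT (EFin \o f) -> measurable (E : set (g_sigma_algebraType G)) ->
    (\int[PG]_(w in E) (f w)%:E = \int[P]_(w in E) (f w)%:E)%E.
  move=> mf If mE; apply: (@integral_pushforward _ _ _ _ _ _ mid P E (EFin \o f)) => //.
  by apply: integrableS If => //; exact: GP (GE _ mE).
have Ipp : PG.-integrable setT (EFin \o p).
  exact: (integrable_pushforward mid).
have : ae_eq PG setT (EFin \o p) (EFin \o p').
  apply: integral_ae_eq => // E _ mE.
  by rewrite !IG//; have GE' := GE _ mE; rewrite pE// pE'.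
move=> [E [mE PE sub]].
exists E; split => //; first exact: GP (GE _ mE).
move=> w /= pp'; apply: sub => /= /(_ I) [H]; exact: pp'.
Qed.

End ConditionalExpectation.

(** * The bond price *)

Section BondPrice.
Context {d : measure_display} {Omega : measurableType d} {R : realType}.
Notation mu := (@lebesgue_measure R).
Variables (P : probability Omega R) (a c : R) (N : nat) (x0 : 'cV[R]_N).
Variables (F : R -> set (set Omega)) (W X : R -> Omega -> 'cV[R]_N) (t T : R).
Hypotheses (a_gt0 : 0 < a) (c_gt0 : 0 < c).
Hypotheses (hF : filtration F) (hW : brownian_motion P F W).
Hypothesis hX : ornstein_uhlenbeck P a c x0 F W X.
Hypotheses (t0 : 0 <= t) (tT : t < T).

Let p := bond_num a c (T - t).
Let q := bond_den a c (T - t).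

Definition bond_price w :=
  (Num.sqrt q)^-1 ^+ N * expR (- (p / q) * spot_rate X t w).

Let cX w : continuous_path (X^~ w). Proof. by case: hX. Qed.

Let crs (s u : R) w : 0 <= s -> {within `[s, u], continuous (spot_rate X ^~ w)}.
Proof.
move=> s0; apply: continuous_subspaceW (continuous_spot_rate (@cX w)) => r /=.
by rewrite !in_itv/= andbT => /andP[+ _]; exact: le_trans.
Qed.

Let spot_rate_ge0 s w : 0 <= spot_rate X s w.
Proof. by rewrite spot_rateE; apply: sumr_ge0 => i _; exact: sqr_ge0. Qed.

Let spot_rate_wrt (s : R) : 0 <= s -> measurable_wrt (F s) (spot_rate X s).
Proof.
case: hF => sF _ _; case: hX => aX _ _ s0.
apply/(measurable_wrtP (sF s s0)).
rewrite (_ : spot_rate X s = fun w => \sum_(i < N) X s w i 0 ^+ 2); last first.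
  by apply/funext => w; exact: spot_rateE.
apply: measurable_sum => i; apply: measurable_funX.
by apply/(measurable_wrtP (sF s s0)); exact: aX.
Qed.

Let measurable_spot_rate (s : R) : 0 <= s -> measurable_fun setT (spot_rate X s).
Proof.
case: hF => sF mF _ s0; apply: (g_sigma_measurable_fun (mF s s0) (sF s s0)).
by apply/(measurable_wrtP (sF s s0)); exact: spot_rate_wrt.
Qed.

Let J w := \int[mu]_(s in `[t, T]) spot_rate X s w.

(** Every path is continuous, so [J] is a pointwise limit of Riemann sums, each of which is
    measurable in [w]. *)
Let measurable_J : measurable_fun setT J.
Proof.
apply: (measurable_fun_cvg (h := fun n w => \sum_(k < n.+1) (T - t) / n.+1%:R *
    spot_rate X (grid t ((T - t) / n.+1%:R) k) w)).
  move=> n; apply: measurable_sum => k; apply: measurable_funM => //.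
  apply: measurable_spot_rate; apply: grid_ge0 => //.
  by rewrite divr_gt0// subr_gt0.
by move=> w _; exact: (riemann_sum_cvg (@crs t T w t0) tT).
Qed.

Let J_ge0 w : 0 <= J w.
Proof. by apply: Rintegral_ge0. Qed.

Let pq0 : 0 <= p / q.
Proof.
by rewrite divr_ge0 ?(ltW (bond_den_gt0 _ _ _))// bond_num_ge0// subr_ge0 ltW.
Qed.

(** [euler_integral] with [n.+1] steps is passed to the limit on both sides. The constant 1
    dominates both integrands: the exponents are nonpositive, and the prefactor on the Gaussian side
    is at most 1 by [euler_den_ge1]. *)
Lemma integral_bond_price A : F t A ->
  (\int[P]_(w in A) (bond_price w)%:E =
   \int[P]_(w in A) (expR (- J w))%:E)%E.
Proof.
move=> FA; case: (hF) => sF mF _.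
have mA : measurable A := mF t t0 A FA.
have tau0 : 0 < T - t by rewrite subr_gt0.
pose dt n := (T - t) / n.+1%:R.
have dt0 n : 0 < dt n by rewrite divr_gt0.
have [numq denq] := euler_num_den_cvg a_gt0 c_gt0 tau0.
have q0 : 0 < q by exact: bond_den_gt0.
have aX : adapted F X by case: hX.
have euler_wrt n m : measurable_fun setT (euler_sum a c W X t (dt n) m).
  have g0 : 0 <= grid t (dt n) m by apply: grid_ge0.
  apply: (g_sigma_measurable_fun (mF _ g0) (sF _ g0)).
  by apply/(measurable_wrtP (sF _ g0)); exact: (euler_sum_measurable a c hF hW aX t0 (dt0 n) (leqnSn m)).
have Ione : P.-integrable A (cst 1%E).
  by apply: finite_measure_integrable_cst.
have cvgL : (fun n => \int[P]_(w in A) (expR (- euler_sum a c W X t (dt n) n.+1 w))%:E)%E @ \oo -->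
    (\int[P]_(w in A) (expR (- J w))%:E)%E.
  have [] // := @dominated_convergence _ _ _ P A mA
    (fun n w => (expR (- euler_sum a c W X t (dt n) n.+1 w))%:E)
    (fun w => (expR (- J w))%:E) (cst 1%E).
  - move=> n; apply/measurable_EFinP; apply: measurable_funTS.
    by apply: measurableT_comp => //; exact: measurableT_comp.
  - apply/measurable_EFinP; apply: measurable_funTS.
    by apply: measurableT_comp => //; exact: measurableT_comp.
  (* The equation holds for almost every [w] only, hence so does the convergence. *)
  - case: hX => _ _; apply: filterS => w XE _.
    apply: cvg_EFin; first exact: nearW.
    apply: (continuous_cvg _ (@continuous_expR R _)); apply: cvgN.
    exact: (euler_sum_cvg a_gt0 t0 tT (@cX w) XE).
  - apply: aeW => w n _ /=; rewrite lee_fin ger0_norm ?expR_ge0//.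
    rewrite -[leRHS]expR0 ler_expR oppr_le0; apply: sumr_ge0 => k _.
    by apply: mulr_ge0; [exact: ltW|apply: sumr_ge0 => i _; exact: sqr_ge0].
pose B n w := (Num.sqrt (euler_den a c (dt n) n.+1))^-1 ^+ N *
  expR (- (euler_num a c (dt n) n.+1 / euler_den a c (dt n) n.+1) * spot_rate X t w).
have cvgR : (fun n => \int[P]_(w in A) (B n w)%:E)%E @ \oo -->
    (\int[P]_(w in A) (bond_price w)%:E)%E.
  have mB (u v : R) : measurable_fun A (fun w => (u * expR (v * spot_rate X t w))%:E).
    apply/measurable_EFinP; apply: measurable_funTS; apply: measurable_funM => //.
    by apply: measurableT_comp => //; apply: measurable_funM => //; exact: measurable_spot_rate.
  have [] // := @dominated_convergence _ _ _ P A mA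
    (fun n w => (B n w)%:E) (fun w => (bond_price w)%:E) (cst 1%E).
  - by move=> n; exact: mB.
  - exact: mB.
  - apply: aeW => w _; apply: cvg_EFin; first exact: nearW.
    apply: cvgM.
      have H : (fun n => (Num.sqrt (euler_den a c (dt n) n.+1))^-1) @ \oo --> (Num.sqrt q)^-1.
        apply: cvgV; first by rewrite gt_eqF// sqrtr_gt0.
        exact: (continuous_cvg _ (@sqrt_continuous R _) denq).
      exact: (continuous_cvg _ (@exprn_continuous R N _) H).
    apply: (continuous_cvg _ (@continuous_expR R _)).
    apply: cvgM; last exact: cvg_cst.
    by apply: cvgN; apply: cvgM => //; apply: cvgV => //; rewrite gt_eqF.
  - apply: aeW => w n _ /=.
    have [num0 den0] := euler_num_ge0_den_gt0 a c (dt0 n) n.+1.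
    have den1 := euler_den_ge1 a c (dt0 n) n.+1.
    have sd1 : 1 <= Num.sqrt (euler_den a c (dt n) n.+1).
      by rewrite -[leLHS]sqrtr1 ler_wsqrtr.
    rewrite lee_fin /B normrM !ger0_norm ?expR_ge0 ?exprn_ge0 ?invr_ge0//.
    apply: mulr_ile1; rewrite ?expR_ge0 ?exprn_ge0 ?invr_ge0//.
      by rewrite exprn_ile1 ?invr_ge0// invf_le1// (lt_le_trans ltr01).
    rewrite -[leRHS]expR0 ler_expR mulNr oppr_le0 mulr_ge0// divr_ge0//.
    exact: ltW.
apply: (cvg_unique (@ereal_hausdorff R) cvgR) => /=.
rewrite (eq_cvg _ _ (g := fun n => \int[P]_(w in A)
  (expR (- euler_sum a c W X t (dt n) n.+1 w))%:E)%E); first exact: cvgL.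
move=> n; rewrite (euler_integral a c hF hW aX t0 (dt0 n) n.+1 FA).
by apply: eq_integral => w _; rewrite /B /euler_sqr spot_rateE.
Qed.

Lemma is_cond_exp_bond_price : is_cond_exp P (F t)
  (fun w => (state_price_density X t w)^-1 * state_price_density X T w) bond_price.
Proof.
case: (hF) => sF mF _.
have q0 : 0 < q by exact: bond_den_gt0.
have ZE : (fun w => (state_price_density X t w)^-1 * state_price_density X T w) =
    fun w => expR (- J w).
  apply/funext => w; rewrite /state_price_density -expRN opprK -expRD.
  rewrite [X in _ - X](@Rintegral_itv_split _ 0 T t); last 2 first.
  - by rewrite t0 ltW.
  - by apply: integrable_continuous_itv; exact: crs.
  by congr expR; rewrite /J; ring.
have Ibd (f : Omega -> R) (C : R) : measurable_fun setT f -> (forall w, `|f w| <= C) ->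
    P.-integrable setT (EFin \o f).
  move=> mf fC; apply: measurable_bounded_integrable => //.
    by rewrite (le_lt_trans (probability_le1 _ _))// ltry.
  exists C; split; first exact: num_real.
  by move=> M CM w /= _; rewrite (le_trans (fC w))// ltW.
have bwrt : measurable_wrt (F t) bond_price.
  apply/(measurable_wrtP (sF t t0)); apply: measurable_funM => //.
  apply: measurableT_comp => //; apply: measurable_funM => //.
  by apply/(measurable_wrtP (sF t t0)); exact: spot_rate_wrt.
rewrite ZE; split => //.
- apply: (Ibd _ 1); first by apply: measurableT_comp => //; exact: measurableT_comp.
  by move=> w; rewrite ger0_norm ?expR_ge0// -[leRHS]expR0 ler_expR oppr_le0.
- apply: (Ibd _ ((Num.sqrt q)^-1 ^+ N)).
    by apply: (g_sigma_measurable_fun (mF t t0) (sF t t0)); apply/(measurable_wrtP (sF t t0)).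
  have sq0 : 0 <= (Num.sqrt q)^-1 ^+ N by rewrite exprn_ge0// invr_ge0.
  move=> w; rewrite ger0_norm ?mulr_ge0 ?expR_ge0//.
  by rewrite ler_piMr// -[leRHS]expR0 ler_expR mulNr oppr_le0 mulr_ge0.
- by move=> A FA; exact: integral_bond_price.
Qed.

End BondPrice.

Theorem mainTheorem2 (R : realType) (d : measure_display)
    (Omega : measurableType d) (P : probability Omega R)
    (a c : R) (ha : 0 < a) (hc : 0 < c)
    (N : nat) (hN : (2 <= N)%N) (x0 : 'cV[R]_N)
    (F : R -> set (set Omega)) (hF : filtration F)
    (W : R -> Omega -> 'cV[R]_N) (hW : brownian_motion P F W)
    (X : R -> Omega -> 'cV[R]_N) (hX : ornstein_uhlenbeck P a c x0 F W X)
    (t T : R) (ht : 0 <= t) (htT : t < T) :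
  let V := state_price_density X in
  let C := bond_kernel a c T in
  let D := fredholm_det t T (fun s1 s2 => 2 * C s1 s2) in
  cvgn (series (fredholm_term t T (fun s1 s2 => 2 * C s1 s2))) /\
  0 < D /\
  exists M : R -> R -> R,
    is_resolvent_kernel t T C M /\
    (forall M' : R -> R -> R, is_resolvent_kernel t T C M' -> M' t t = M t t) /\
    let beta := 4 / c ^+ 2 * M t t in
    let alpha := N%:R / 2 * ln D in
    (exists p : Omega -> R,
      is_cond_exp P (F t) (fun w => (V t w)^-1 * V T w) p) /\
    forall p : Omega -> R,
      is_cond_exp P (F t) (fun w => (V t w)^-1 * V T w) p ->
      {ae P, forall w, p w =
        D `^ (- (N%:R / 2)) *
        \prod_(mu < N) expR (- (4 / c ^+ 2) * X t w mu 0 ^+ 2 * M t t)} /\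
      {ae P, forall w, p w = expR (- beta * spot_rate X t w - alpha)}.
Proof.
move=> V C D.
have DC := fredholm_series_bond_kernel ha hc (ltW htT).
have DE : D = bond_den a c (T - t) by exact: cvg_lim DC.
have D0 : 0 < D by rewrite DE; exact: bond_den_gt0.
split; first by apply/cvg_ex; eexists; exact: DC.
split => //; exists (bond_resolvent a c t T); split; first exact: is_resolvent_kernel_bond.
split.
  move=> M' HM'; apply: (is_resolvent_kernel_unique htT HM').
  exact: is_resolvent_kernel_bond.
move=> beta alpha.
have cp := is_cond_exp_bond_price ha hc hF hW hX ht htT.
split; first by eexists; exact: cp.
move=> p Hp; have [sF mF _] := hF.
have pE := cond_exp_unique (mF t ht) (sF t ht) Hp cp.
have c0 : c != 0 by rewrite gt_eqF.
(* The two sides meet here: 4/c^2 cancels the Wronskian constant c^2/4 in the diagonal value of the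
   resolvent and leaves the quotient p / q found by Gaussian integration. *)
have betaE : beta = bond_num a c (T - t) / bond_den a c (T - t).
  by rewrite /beta bond_resolvent_diag//; field; rewrite c0 gt_eqF// bond_den_gt0.
have powE : D `^ (- (N%:R / 2)) = (Num.sqrt (bond_den a c (T - t)))^-1 ^+ N.
  rewrite powRN exprVn -DE -powR12_sqrt ?ltW// -powR_mulrn ?powR_ge0// -powRrM.
  by congr (_ `^ _)^-1; rewrite mulrC.
have expE : expR (- alpha) = D `^ (- (N%:R / 2)).
  by rewrite /powR gt_eqF// mulNr.
split; apply: filterS pE => w ->; rewrite /bond_price -betaE -powE.
  congr (_ * _); rewrite -expR_sum; congr expR; rewrite spot_rateE mulr_sumr.
  by apply: eq_bigr => i _; rewrite /beta; ring.
by rewrite -expE -expRD addrC.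
Qed.
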